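(* Assume $k_{n-1}k_{n+1}=\ell_{n-1}\ell_{n+1}$ for all $n\in\mathbb Z/N\mathbb Z$. Let $\tau:M\to L$ be the $\tau$-function and, for $\Lambda\in M$, let $\Phi_\Lambda(\zeta)$ be the normalized defining polynomial of the corresponding hypersurface, with the substitution $\zeta_n^0=\xi_{n+1}\eta_{n-1}$, $\zeta_n^\infty=\xi_{n-1}\eta_{n+1}$. Then for any $$\Lambda=\sum_n d_nH_n-\sum_{n,i}\mu_n^iE_n^i\in M$$ (the second sum being over all $n\in\mathbb Z/N\mathbb Z$ and $i\in\{1,\dots,k_n\}\cup\{-1,\dots,-\ell_n\}$) the following equality holds in $L$: $$\tau(\Lambda)\prod_{n,i}(\tau_n^i)^{\mu_n^i}=\Phi_\Lambda(\zeta).$$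
   Context: Fix $N\ge3$ and sequences ${\boldsymbol k}=(k_1,\dots,k_N)$, ${\boldsymbol\ell}=(\ell_1,\dots,\ell_N)$ of positive integers. Lower indices are read in $\mathbb Z/N\mathbb Z$. Upper indices on $u,v,a,C,E,e,\alpha,s,\tau,\zeta,\mu$ are labels unless they are visibly exponents. Parameters. The multiplicative root variables $a=(a_n^i)$, $-\ell_n+1\le i\le k_n-1$, are indeterminates; set $$u_n^1=u_n=\frac{\left(a_n^0\prod_{j=1}^{\ell_n-1}(a_n^{-j})^{1-j/\ell_n}\right)^{\ell_n/(k_n+\ell_n)}}{\left(\prod_{i=1}^{k_n-1}(a_n^i)^{1-i/k_n}\right)^{k_n/(k_n+\ell_n)}},\qquad v_n^{-1}=v_n=\frac{\left(a_n^0\prod_{i=1}^{k_n-1}(a_n^i)^{1-i/k_n}\right)^{k_n/(k_n+\ell_n)}}{\left(\prod_{j=1}^{\ell_n-1}(a_n^{-j})^{1-j/\ell_n}\right)^{\ell_n/(k_n+\ell_n)}}$$ ($v_n^{-1}$ meaning $v_n^{-j}$ with $j=1$), and $u_n^i=a_n^{i-1}u_n^{i-1}$, $v_n^{-j}=a_n^{-j+1}v_n^{-j+1}$ for $i,j\ge2$. $\mathbb K=\mathbb C(a^{1/p})$ is generated by the $(a_n^i)^{1/p}$ for a suitable integer $p>0$ such that all fractional powers used lie in $\mathbb K$. Variety and lattice. Let $f=(f_1,\dots,f_N)$ be inhomogeneous coordinates on $(\mathbb P^1)^N$, and let $X$ be the blowing-up of $(\mathbb P^1)^N$ along $$C_n^i=\{f_{n-1}=0,\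 f_n=-u_n^i,\ f_{n+1}=\infty\}\ (1\le i\le k_n),\qquad C_n^{-j}=\{f_{n-1}=\infty,\ f_n=-1/v_n^{-j},\ f_{n+1}=0\}\ (1\le j\le\ell_n).$$ $H^2(X,\mathbb Z)$ is free with basis $H_n$ (class of $\{f_n=\mathrm{const}\}$), $E_n^i$, $E_n^{-j}$ (classes of the exceptional divisors over $C_n^i$, $C_n^{-j}$). $H_2(X,\mathbb Z)$ is free with dual-type basis $h_n,e_n^i,e_n^{-j}$ and pairing $\langle H_m,h_n\rangle=\delta_{m,n}$, $\langle E_m^i,e_n^j\rangle=-\delta_{m,n}\delta_{i,j}$, all others $0$. Put $\alpha_n^0=H_n-E_n^1-E_n^{-1}$, $\check\alpha_n^0=h_{n-1}+h_{n+1}-e_n^1-e_n^{-1}$; $\alpha_n^i=E_n^i-E_n^{i+1}$, $\check\alpha_n^i=e_n^i-e_n^{i+1}$ ($1\le i\le k_n-1$); $\alpha_n^{-j}=E_n^{-j}-E_n^{-j-1}$, $\check\alpha_n^{-j}=e_n^{-j}-e_n^{-j-1}$ ($1\le j\le\ell_n-1$). The Weyl group $W=W(T^{\boldsymbol k}_{\boldsymbol\ell})=\langle s_n^i\rangle$ (with simple reflections $s_n^i$, $-\ell_n+1\le i\le k_n-1$, and simple roots $\alpha_n^i$) acts on $H^2(X,\mathbb Z)$ by $s_n^i(\Lambda)=\Lambda+\langle\Lambda,\check\alpha_n^i\rangle\alpha_n^i$. Let $M=W.\{E_n^i\}\subset H^2(X,\mathbb Z)$ be the $W$-orbit of the set of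 all classes $E_n^i$, $i\in\{1,\dots,k_n\}\cup\{-1,\dots,-\ell_n\}$. Action on $\tau$-variables. Let $\tau_n^i$ ($i\in\{1,\dots,k_n\}\cup\{-1,\dots,-\ell_n\}$) be indeterminates, $L=\mathbb K(\tau)$, $\xi_n=\prod_{i=1}^{k_n}\tau_n^i$, $\eta_n=\prod_{j=1}^{\ell_n}\tau_n^{-j}$, $\theta_n^0=k_{n+1}+\ell_{n-1}$, $\theta_n^\infty=k_{n-1}+\ell_{n+1}$, $\omega_n=\theta_n^0/(\theta_n^0+\theta_n^\infty)$. $W$ acts on $L$ by field automorphisms determined by $$s_n^0(\tau_n^1)=\frac{{v_n}^{\omega_n}\xi_{n+1}\eta_{n-1}+{v_n}^{-1+\omega_n}\xi_{n-1}\eta_{n+1}}{\tau_n^{-1}},\qquad s_n^0(\tau_n^{-1})=\frac{{u_n}^{-\omega_n}\xi_{n+1}\eta_{n-1}+{u_n}^{1-\omega_n}\xi_{n-1}\eta_{n+1}}{\tau_n^1},$$ $s_n^i$ interchanges $\tau_n^i$ and $\tau_n^{i+1}$ ($1\le i\le k_n-1$), $s_n^{-j}$ interchanges $\tau_n^{-j}$ and $\tau_n^{-j-1}$ ($1\le j\le\ell_n-1$), $s_n^i(\tau_m^j)=\tau_m^j$ otherwise, and on parameters $s_n^i(a_n^i)=1/a_n^i$, $s_n^i(a_n^{i\pm1})=a_n^ia_n^{i\pm1}$, $s_n^0(a_{n\pm1}^0)=a_n^0a_{n\pm1}^0$, other $a$'s fixed (extended multiplicatively to fractional powers). $\tau$-function.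 $\tau:M\to L$ is defined by (i) $\tau(E_n^i)=\tau_n^i$; (ii) $\tau(w.\Lambda)=w.\tau(\Lambda)$ for all $\Lambda\in M$, $w\in W$, where $w$ acts on $R(a,\tau)\in L$ by substituting for the independent variables $a,\tau$ their images under $w$. Normalized defining polynomial. Let $\zeta=(\zeta_1^0:\zeta_1^\infty,\dots,\zeta_N^0:\zeta_N^\infty)$ be homogeneous coordinates of $(\mathbb P^1)^N$ with $f_n=\zeta_n^0/\zeta_n^\infty$, and for $m=(m_1^0,m_1^\infty,\dots,m_N^0,m_N^\infty)\in(\mathbb Z_{\ge0})^{2N}$ put $\zeta^m=\prod_n(\zeta_n^0)^{m_n^0}(\zeta_n^\infty)^{m_n^\infty}$. Each $\Lambda=\sum d_nH_n-\sum\mu_n^iE_n^i\in M$ corresponds to a unique hypersurface in $(\mathbb P^1)^N$ of multidegree $d=(d_1,\dots,d_N)$ passing through each $C_n^i$ with multiplicity $\mu_n^i$ (for $\Lambda=E_n^i$ the defining polynomial is the constant $1$). Let $\Phi_\Lambda(\zeta)=\sum_mA_m\zeta^m\in\mathbb K[\zeta]$ be its (multihomogeneous) defining polynomial, written as a sum of terms in which each $A_m$ is a monic monomial in (fractional powers of) the multiplicative root variables; here several terms with the same exponent $m$ are allowed, so that the total coefficient of $\zeta^m$ is a sum of monic monomials. It is normalized by the condition $$\prod_mA_m^{(1/\theta)^m}=1,\qquad(1/\theta)^m=\prod_n(1/\theta_n^0)^{m_n^0}(1/\theta_n^\infty)^{m_n^\infty},$$ the product being over all the terms. For example, $\Ph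i_{H_n-E_n^1}={u_n}^{-\omega_n}\zeta_n^\infty(f_n+u_n)={u_n}^{-\omega_n}\zeta_n^0+{u_n}^{1-\omega_n}\zeta_n^\infty$.
   Formalization: The normalized defining polynomial is also required to have coefficients with no common factor among integral Laurent polynomials in the a^{1/p}, since the stated normalization alone is met by 2Φ and (a+1/a)Φ too, for which the equality fails. *)

(* Defs.v *)
From HB Require Import structures.
From mathcomp Require Import all_boot all_order all_algebra.
From mathcomp Require Import reals complex mpoly.
Set Implicit Arguments.
Unset Strict Implicit.
Unset Printing Implicit Defensive.
Import Order.TTheory GRing.Theory Num.Theory.
Local Open Scope ring_scope.

(* Substitution in a field of fractions: [f] evaluates polynomials, and it is
   extended to a quotient by evaluating numerator and denominator. *)
Definition subst_frac (A : idomainType) (F : fieldType) (f : A -> F)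
  (x : {fraction A}) : F := f \n_(repr x) / f \d_(repr x).

(* [ideal_pow gens m P] : P lies in the m-th power of the ideal generated by
   the family [gens]. *)
Fixpoint ideal_pow (A : comNzRingType) (r : nat) (gens : 'I_r -> A) (m : nat)
  (P : A) : Prop :=
  if m is m'.+1 then
    exists2 Q : 'I_r -> A,
      forall j, ideal_pow gens m' (Q j) & P = \sum_(j < r) gens j * Q j
  else True.

Section TropicalWeyl.

Variables (R : realType) (N : nat) (k l : 'Z_N -> nat).

(* Indices (n, i) of the classes E_n^i and of the variables tau_n^i:
   [inl i] stands for the upper label i + 1, in {1, .., k_n}, and
   [inr j] for the upper label -(j + 1), in {-1, .., -l_n}. *)
Definition eidx : finType := {n : 'Z_N & ('I_(k n) + 'I_(l n))%type}.

Definition epos (n : 'Z_N) (i : 'I_(k n)) : eidx :=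
  Tagged (fun n => ('I_(k n) + 'I_(l n))%type) (inl i).
Definition eneg (n : 'Z_N) (j : 'I_(l n)) : eidx :=
  Tagged (fun n => ('I_(k n) + 'I_(l n))%type) (inr j).

Definition elab (x : eidx) : 'Z_N * int :=
  (tag x, match tagged x with
          | inl i => i.+1%:Z
          | inr j => - j.+1%:Z
          end).

(* Indices (n, i), - l_n + 1 <= i <= k_n - 1, of the simple reflections and of
   the parameters a_n^i: [None] stands for the upper label 0. *)
Definition ridx : finType :=
  {n : 'Z_N & option ('I_(k n).-1 + 'I_(l n).-1)%type}.

Definition rlab (r : ridx) : 'Z_N * int :=
  (tag r, match tagged r with
          | None => 0
          | Some (inl i) => i.+1%:Z
          | Some (inr j) => - j.+1%:Z
          end).

(* The neighbour, away from 0, of a nonzero upper label: s_n^i exchanges the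
   labels i and [outer i]. *)
Definition outer (i : int) : int := if 0 < i then i + 1 else i - 1.

(* H^2(X, Z) and H_2(X, Z): the first component holds the coordinates on the
   H_n (resp. h_n), the second one those on the E_n^i (resp. e_n^i). *)
Definition H2 : zmodType :=
  ({ffun 'Z_N -> int} * {ffun eidx -> int})%type.
Definition H_2 : zmodType :=
  ({ffun 'Z_N -> int} * {ffun eidx -> int})%type.

Definition clH (n : 'Z_N) : H2 := ([ffun m => (m == n)%:R], 0).
Definition clE (n : 'Z_N) (i : int) : H2 :=
  (0, [ffun x => (elab x == (n, i))%:R]).
Definition clh (n : 'Z_N) : H_2 := ([ffun m => (m == n)%:R], 0).
Definition cle (n : 'Z_N) (i : int) : H_2 :=
  (0, [ffun x => (elab x == (n, i))%:R]).

Definition pairing (La : H2) (x : H_2) : int :=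
  \sum_n La.1 n * x.1 n - \sum_y La.2 y * x.2 y.

(* d_n and mu_n^i in La = sum d_n H_n - sum mu_n^i E_n^i *)
Definition deg (La : H2) (n : 'Z_N) : int := La.1 n.
Definition mult (La : H2) (x : eidx) : int := - La.2 x.

Definition root (r : ridx) : H2 :=
  let: (n, i) := rlab r in
  if i == 0 then clH n - clE n 1 - clE n (-1)
  else clE n i - clE n (outer i).

Definition coroot (r : ridx) : H_2 :=
  let: (n, i) := rlab r in
  if i == 0 then clh (n - 1) + clh (n + 1) - cle n 1 - cle n (-1)
  else cle n i - cle n (outer i).

Definition refl (r : ridx) (La : H2) : H2 :=
  La + root r *~ pairing La (coroot r).

(* Elements of W are represented by words in the simple reflections. *)
Definition wact (w : seq ridx) (La : H2) : H2 := foldr refl La w.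

Definition in_M (La : H2) : Prop :=
  exists (w : seq ridx) (x : eidx), La = wact w (clE (elab x).1 (elab x).2).

(* A monic monomial in fractional powers of the a_n^i is given by its vector
   of exponents; the group law is thus written additively. *)
Definition expo : lmodType rat := {ffun ridx -> rat^o}.

Definition expa (n : 'Z_N) (i : int) : expo :=
  [ffun r => (rlab r == (n, i))%:R].

Definition expu1 (n : 'Z_N) : expo :=
  let kn := (k n)%:R : rat in let ln := (l n)%:R : rat in
  (ln / (kn + ln)) *: (expa n 0 +
      \sum_(1 <= j < l n) (1 - j%:R / ln) *: expa n (- j%:Z))
  - (kn / (kn + ln)) *: \sum_(1 <= i < k n) (1 - i%:R / kn) *: expa n i%:Z.

Definition expv1 (n : 'Z_N) : expo :=
  let kn := (k n)%:R : rat in let ln := (l n)%:R : rat in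
  (kn / (kn + ln)) *: (expa n 0 +
      \sum_(1 <= i < k n) (1 - i%:R / kn) *: expa n i%:Z)
  - (ln / (kn + ln)) *: \sum_(1 <= j < l n) (1 - j%:R / ln) *: expa n (- j%:Z).

(* u_n^i = a_n^{i-1} u_n^{i-1} and v_n^{-j} = a_n^{-j+1} v_n^{-j+1} *)
Definition expu (n : 'Z_N) (i : nat) : expo :=
  expu1 n + \sum_(1 <= h < i) expa n h%:Z.
Definition expv (n : 'Z_N) (j : nat) : expo :=
  expv1 n + \sum_(1 <= h < j) expa n (- h%:Z).

Definition theta0 (n : 'Z_N) : nat := (k (n + 1)%R + l (n - 1)%R)%N.
Definition thetaoo (n : 'Z_N) : nat := (k (n - 1)%R + l (n + 1)%R)%N.
Definition omega (n : 'Z_N) : rat :=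
  (theta0 n)%:R / (theta0 n + thetaoo n)%:R.

(* K = C(a^{1/p}), as the field of rational functions in the indeterminates
   (a_n^i)^{1/p} *)
Definition K : fieldType := {fraction {mpoly R[i][#|ridx|]}}.

Definition root_a (r : ridx) : K :=
  tofrac ('X_(enum_rank r) : {mpoly R[i][#|ridx|]}).

(* L = K(tau) *)
Definition L : fieldType := {fraction {mpoly K[#|eidx|]}}.

Definition KtoL (c : K) : L := tofrac (c%:MP : {mpoly K[#|eidx|]}).

Definition tauX (x : eidx) : L :=
  tofrac ('X_(enum_rank x) : {mpoly K[#|eidx|]}).

(* tau_n^i for an integer label i; the value at a label out of range is
   irrelevant. *)
Definition tau_ (n : 'Z_N) (i : int) : L :=
  if [pick x : eidx | elab x == (n, i)] is Some x then tauX x else 1.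

Definition xi (n : 'Z_N) : L := \prod_(i < k n) tauX (epos i).
Definition eta (n : 'Z_N) : L := \prod_(j < l n) tauX (eneg j).

(* Homogeneous coordinates: [(n, false)] indexes zeta_n^0 and [(n, true)]
   indexes zeta_n^oo. *)
Definition zidx : finType := ('Z_N * bool)%type.
Definition Kzeta : idomainType := {mpoly K[#|zidx|]}.
Definition zeta (n : 'Z_N) (b : bool) : Kzeta := 'X_(enum_rank (n, b)).

Definition zetaL (z : zidx) : L :=
  let: (n, b) := z in
  if b then xi (n - 1) * eta (n + 1) else xi (n + 1) * eta (n - 1).

Definition eval_zeta (Phi : {mpoly K[#|zidx|]}) : L :=
  mmap KtoL (fun t => zetaL (enum_val t)) Phi.

Definition zexp (m : 'X_{1..#|zidx|}) (n : 'Z_N) (b : bool) : nat :=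
  m (enum_rank (n, b)).

Section RootDegree.

Variable p : nat.

Definition in_K (e : expo) : Prop :=
  forall r, p%:R * (e r : rat) \is a Num.int.

(* The monomial with exponent vector [e]; meaningful when [in_K e]. *)
Definition mono (e : expo) : K :=
  \prod_(r : ridx) root_a r ^ Num.floor (p%:R * (e r : rat)).

Definition suitable : Prop :=
  [/\ (0 < p)%N,
      forall n, in_K (expu1 n) /\ in_K (expv1 n)
    & forall n, in_K (omega n *: expu1 n) /\ in_K (omega n *: expv1 n)].

(* Images of (a_q)^{1/p} and of tau_x under the simple reflection s_r *)
Definition adjacent (r q : ridx) : bool :=
  let: (n, i) := rlab r in
  let: (m, j) := rlab q in
  ((m == n) && ((j == i + 1) || (j == i - 1)))
  || [&& i == 0, j == 0 & (m == n + 1) || (m == n - 1)].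

Definition refl_a (r q : ridx) : K :=
  if q == r then (root_a r)^-1
  else if adjacent r q then root_a r * root_a q
  else root_a q.

Definition refl_tau (r : ridx) (x : eidx) : L :=
  let: (n, i) := rlab r in
  if i == 0 then
    if elab x == (n, 1) then
      (KtoL (mono (omega n *: expv1 n)) * (xi (n + 1) * eta (n - 1))
       + KtoL (mono ((-1 + omega n) *: expv1 n)) * (xi (n - 1) * eta (n + 1)))
      / tau_ n (-1)
    else if elab x == (n, -1) then
      (KtoL (mono (- omega n *: expu1 n)) * (xi (n + 1) * eta (n - 1))
       + KtoL (mono ((1 - omega n) *: expu1 n)) * (xi (n - 1) * eta (n + 1)))
      / tau_ n 1
    else tauX x
  else
    if elab x == (n, i) then tau_ n (outer i)
    else if elab x == (n, outer i) then tau_ n i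
    else tauX x.

Definition reflK (r : ridx) : K -> K :=
  subst_frac (mmap (fun c : R[i] => tofrac (c%:MP : {mpoly R[i][#|ridx|]}) : K)
                   (fun q => refl_a r (enum_val q))).

Definition reflL (r : ridx) : L -> L :=
  subst_frac (mmap (fun c : K => KtoL (reflK r c))
                   (fun x => refl_tau r (enum_val x))).

Definition wactL (w : seq ridx) (f : L) : L := foldr reflL f w.

(* Only the values of [tau] on M matter. *)
Definition tau_function (tau : H2 -> L) : Prop :=
  (forall x : eidx, tau (clE (elab x).1 (elab x).2) = tauX x) /\
  (forall (w : seq ridx) (La : H2), in_M La ->
     tau (wact w La) = wactL w (tau La)).

(* Generators of the homogeneous ideal of C_n^i, resp. C_n^{-j} *)
Definition C_gens (x : eidx) (t : 'I_3) : Kzeta :=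
  let n := tag x in
  match tagged x with
  | inl i =>
      tnth [tuple zeta (n - 1) false;
                  zeta n false + mono (expu n i.+1) *: zeta n true;
                  zeta (n + 1) true] t
  | inr j =>
      tnth [tuple zeta (n - 1) true;
                  zeta n false + (mono (expv n j.+1))^-1 *: zeta n true;
                  zeta (n + 1) false] t
  end.

(* The ideal I of C_n^i is generated by linear forms in independent
   variables, so that I^mu consists of the polynomials vanishing to order at
   least mu along C_n^i.  A multiplicity mu <= 0 imposes no condition; it is
   negative only for La = E_n^i. *)
Definition passes_through (Phi : Kzeta) (La : H2) : Prop :=
  forall x : eidx,
    if mult La x is Posz mu then ideal_pow (C_gens x) mu Phi else True.

Definition multihomogeneous (Phi : {mpoly K[#|zidx|]}) (La : H2) : Prop :=
  forall m, m \in msupp Phi ->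
    forall n, (zexp m n false + zexp m n true)%N%:Z = deg La n.

(* A term A_m zeta^m with A_m a monic monomial; the same zeta^m may occur in
   several terms. *)
Definition term : eqType := (expo * 'X_{1..#|zidx|})%type.

Definition expansion (T : seq term) (Phi : {mpoly K[#|zidx|]}) : Prop :=
  (forall t, t \in T -> in_K t.1) /\
  Phi = \sum_(t <- T) mono t.1 *: 'X_[t.2].

(* (1/theta)^m *)
Definition theta_weight (m : 'X_{1..#|zidx|}) : rat :=
  \prod_(n : 'Z_N) ((theta0 n)%:R ^- zexp m n false
                    * (thetaoo n)%:R ^- zexp m n true).

(* prod A_m^{(1/theta)^m} = 1, in additive notation *)
Definition normalized (T : seq term) : Prop :=
  \sum_(t <- T) theta_weight t.2 *: t.1 = 0.

(* The ring Z[a^{1/p}, a^{-1/p}] of Laurent polynomials, inside K *)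
Definition integral_laurent (c : K) : Prop :=
  exists2 s : seq (int * expo),
    forall t, t \in s -> in_K t.2
    & c = \sum_(t <- s) t.1%:~R * mono t.2.

(* The coefficients have no common factor but units.  Without this, the
   condition on the A_m does not determine the polynomial: if Phi satisfies
   it, then so do 2 Phi and (a + a^-1) Phi. *)
Definition primitive (Phi : {mpoly K[#|zidx|]}) : Prop :=
  forall (g : K) (Psi : {mpoly K[#|zidx|]}),
    g != 0 -> integral_laurent g -> (forall m, integral_laurent Psi@_m) ->
    Phi = g *: Psi -> integral_laurent g^-1.

Definition normalized_defining_polynomial
  (La : H2) (Phi : {mpoly K[#|zidx|]}) : Prop :=
  [/\ Phi != 0,
      multihomogeneous Phi La,
      passes_through Phi La,
      primitive Phi
    & exists2 T : seq term, expansion T Phi & normalized T].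

End RootDegree.

End TropicalWeyl.

(* Main.v *)
Require Import Defs.
From HB Require Import structures.
From mathcomp Require Import all_boot all_order all_algebra generic_quotient.
From mathcomp Require Import perm reals complex mpoly ring lra zify.
Set Implicit Arguments.
Unset Strict Implicit.
Unset Printing Implicit Defensive.
Import Order.TTheory GRing.Theory Num.Theory.
Local Open Scope ring_scope.

(** Write V(La) for the space of polynomials that have the multidegree of La
    and vanish along every center to the order prescribed by La ([linsys]).
    The proof transports these spaces, together with evaluation at the tau
    variables, along a word in the simple reflections.

    A reflection with a nonzero label exchanges two centers over the same
    factor and two tau variables, and it acts on polynomials through their
    coefficients only ([linsys_swap], [reflL_eval_tau_swap]). The reflection s
    at (n, 0) replaces tau_n^1 by A / tau_n^{-1} and tau_n^{-1} by B /
    tau_n^1, where A and B are linear forms in zeta_n ([exch]). The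
    coordinates zeta_{n-1} and zeta_{n+1} are the ones that contain these two
    variables, so that up to a power of tau_n^1 tau_n^{-1} they get multiplied
    by A or by B; [mut] is the corresponding operation on polynomials. If P is
    in V(La), then the mutation of P is divisible by the powers of A and B
    prescribed by the multiplicities of La along C_n^1 and C_n^{-1}
    ([mut_dvd]), and the quotient lies in V(s La) ([linsys_mut]). The relation
    between k and l enters here: it makes omega_n the exponent for which
    mutation preserves the ideals of the centers over the factors n - 1 and
    n + 1 ([compat_center_exp]).

    Starting from the constant 1 in V(E), one obtains for each word w a
    polynomial P_w whose value at the tau variables is tau(La) prod
    (tau_n^i)^(mu_n^i) ([constructed_word]). Mutating twice amounts to a
    multiplication by a power of A B ([mut_mut]), hence mutation is injective,
    and the dimension of V(La) is that of V(E), which is 1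
    ([linsys_unique_word]).
    Therefore Phi = c P_w for some constant c.

    It remains to see that c = 1 ([normalized_unique]). The coefficient of Phi
    on the monomial in the zeta_n^0 alone is a sum of monic monomials, and the
    one of P_w is a single monomial; so c is itself a sum of monic monomials.
    Since Phi is primitive, c is invertible among the integral Laurent
    polynomials, and comparing values at a = 1 shows that the sum has a single
    term ([unit_mono_sum]): c is a monomial. Finally the product in the
    normalization condition has as exponents the logarithmic gradient at a = 1
    of the value of the polynomial at zeta = 1 / theta. This gradient vanishes
    for Phi by assumption. It vanishes for P_w because it does so for A and B
    ([jet_eval_theta_exch]), so that mutation only rescales the values at zeta
    = 1 / theta, to first order ([jet_eval_theta_mut]). A monomial with
    vanishing gradient is 1. *)

(** * Substitution in polynomial rings and fraction fields *)

Lemma mpoly_ring_ind n (F : comNzRingType) (P : {mpoly F[n]} -> Prop) :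
  (forall c, P c%:MP) -> (forall i, P 'X_i) ->
  (forall p q, P p -> P q -> P (p + q)) ->
  (forall p q, P p -> P q -> P (p * q)) -> forall p, P p.
Proof.
move=> PC PX PD PM p; rewrite (mpolyE p).
elim: (msupp p : seq _) => [|m s IH]; first by rewrite big_nil -(mpolyC0 n F).
rewrite big_cons; apply: PD => //; rewrite -mul_mpolyC; apply: (PM) => //.
rewrite mpolyXE_id; apply: (big_ind P) => [|q1 q2 P1 P2|i _]; [by rewrite -mpolyC1 | exact: PM |].
elim: (m i) => [|j IHj]; first by rewrite expr0 -mpolyC1.
by rewrite exprS; apply: PM.
Qed.

Lemma frac_subE (F : fieldType) (a b c d : F) : b != 0 -> d != 0 ->
  a / b - c / d = (a * d - c * b) / (b * d).
Proof. by move=> b0 d0; rewrite -mulNr addf_div // mulNr. Qed.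

Lemma fracE (A : idomainType) (x : {fraction A}) :
  x = tofrac \n_(repr x) / tofrac \d_(repr x).
Proof.
have d0 : tofrac \d_(repr x) != 0 by rewrite tofrac_eq0 denom_ratioP.
apply: (mulIf d0); rewrite mulfVK //; rewrite -{1}[x]reprK.
have := denom_ratioP (repr x); move: (repr x) => y dn0; unlock FracField.tofrac.
transitivity (\pi_({fraction A})%qT (FracField.mulf y (Ratio \d_y 1))).
  by symmetry; apply: FracField.pi_mul.
apply/eqmodP => /=.
rewrite FracField.equivfE /FracField.mulf /=.
by rewrite !numden_Ratio ?oner_neq0 ?mulr1 ?mulf_neq0 ?oner_neq0 // mulrC.
Qed.

Section InvolutiveSubst.

Variables (A : idomainType) (f : {rmorphism A -> {fraction A}}).

(** Asks that the substitution given by [f], applied twice, fixes [a]; the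
    value [f a] is kept as a quotient [b / c] of elements of [A], on which [f]
    is already defined. *)
Definition inv_at (a : A) : Prop := exists b c : A,
  [/\ f a * tofrac c = tofrac b, f c != 0 & f b = tofrac a * f c].

Lemma inv_at_poly a b : f a = tofrac b -> f b = tofrac a -> inv_at a.
Proof.
by move=> ab ba; exists b, 1; rewrite !rmorph1 !mulr1 oner_neq0.
Qed.

Lemma inv_atD a b : inv_at a -> inv_at b -> inv_at (a + b).
Proof.
move=> [a1 [a2 [e1 e2 e3]]] [b1 [b2 [h1 h2 h3]]].
exists (a1 * b2 + b1 * a2), (a2 * b2); split.
- rewrite !(rmorphD, rmorphM) /= -e1 -h1; ring.
- by rewrite rmorphM mulf_neq0.
- rewrite !(rmorphD, rmorphM) /= e3 h3; ring.
Qed.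

Lemma inv_atM a b : inv_at a -> inv_at b -> inv_at (a * b).
Proof.
move=> [a1 [a2 [e1 e2 e3]]] [b1 [b2 [h1 h2 h3]]].
exists (a1 * b1), (a2 * b2); split.
- rewrite !rmorphM /= -e1 -h1; ring.
- by rewrite rmorphM mulf_neq0.
- rewrite !rmorphM /= e3 h3; ring.
Qed.

Hypothesis invf : forall a, inv_at a.

(** A substitution that squares to the identity has trivial kernel, which is
    what makes its values on quotients independent of the representatives. *)
Lemma inv_subst_inj a : f a = 0 -> a = 0.
Proof.
move=> fa0; have [b [c [e1 e2 e3]]] := invf a.
move/esym/eqP: e1; rewrite fa0 mul0r tofrac_eq0 => /eqP b0.
move/esym/eqP: e3; rewrite b0 rmorph0 mulf_eq0 (negPf e2) orbF tofrac_eq0.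
by move/eqP.
Qed.

Lemma inv_subst_neq0 a : a != 0 -> f a != 0.
Proof. by apply: contraNneq => /inv_subst_inj ->. Qed.

Lemma subst_fracE n d : d != 0 -> subst_frac f (tofrac n / tofrac d) = f n / f d.
Proof.
move=> d0; rewrite /subst_frac; move e0: (tofrac n / tofrac d) => x.
have dx0 := denom_ratioP (repr x).
have e : \n_(repr x) * d = n * \d_(repr x).
  apply/eqP; rewrite -tofrac_eq !rmorphM /= -eqr_div ?tofrac_eq0 //.
  by rewrite -(fracE x) e0.
apply/eqP; rewrite eqr_div ?inv_subst_neq0 //; apply/eqP.
by rewrite -(rmorphM f) e (rmorphM f).
Qed.

Lemma subst_frac_tofrac a : subst_frac f (tofrac a) = f a.
Proof.
by rewrite -[tofrac a]divr1 -(rmorph1 (@FracField.tofrac A)) subst_fracE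
  ?oner_neq0 // rmorph1 divr1.
Qed.

Lemma subst_frac_zmod : zmod_morphism (subst_frac f).
Proof.
move=> x y; rewrite (fracE x) (fracE y).
have := denom_ratioP (repr x); have := denom_ratioP (repr y).
move: (\n_(repr x)) (\d_(repr x)) (\n_(repr y)) (\d_(repr y)) => a b c d d0 b0.
rewrite frac_subE ?tofrac_eq0 // -!rmorphM -rmorphB.
rewrite !subst_fracE ?mulf_neq0 // frac_subE ?inv_subst_neq0 //.
by rewrite rmorphB !rmorphM.
Qed.

Lemma subst_frac_monoid : monoid_morphism (subst_frac f).
Proof.
split=> [|x y]; first by rewrite -(rmorph1 (@FracField.tofrac A)) subst_frac_tofrac rmorph1.
rewrite (fracE x) (fracE y).
have := denom_ratioP (repr x); have := denom_ratioP (repr y).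
move: (\n_(repr x)) (\d_(repr x)) (\n_(repr y)) (\d_(repr y)) => a b c d d0 b0.
by rewrite mulf_div -!rmorphM !subst_fracE ?mulf_neq0 // mulf_div -!rmorphM.
Qed.

Lemma subst_frac_tofracK a : subst_frac f (f a) = tofrac a.
Proof.
have [b [c [e1 e2 e3]]] := invf a.
have c0 : c != 0 by apply: contraNneq e2 => ->; rewrite rmorph0.
have -> : f a = tofrac b / tofrac c by rewrite -e1 mulfK // tofrac_eq0.
by rewrite subst_fracE // e3 mulfK.
Qed.

Lemma subst_fracK : involutive (subst_frac f).
Proof.
move=> x; have {2}-> := fracE x; have {1}-> := fracE x.
have := denom_ratioP (repr x).
move: (\n_(repr x)) (\d_(repr x)) => a b b0.
rewrite subst_fracE // (subst_frac_monoid).2.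
rewrite subst_frac_tofracK; congr (_ * _).
have fb0 := inv_subst_neq0 b0; have tb0 : tofrac b != 0 by rewrite tofrac_eq0.
have e : subst_frac f (f b)^-1 * subst_frac f (f b) = 1.
  have := subst_frac_monoid.2 (f b)^-1 (f b).
  by rewrite mulVf // subst_frac_monoid.1 => <-.
by apply: (mulIf tb0); rewrite mulVf // -e subst_frac_tofracK.
Qed.

End InvolutiveSubst.

Fact pvar_key : unit. Proof. exact: tt. Qed.
Fact psubst_key : unit. Proof. exact: tt. Qed.

Section PolySubst.

Variables (I : finType) (F S : comNzRingType).

(** Locked, like [psubst], so that ring morphisms are compared through their
    values on constants and variables, and never by unfolding. *)
Definition pvar (i : I) : {mpoly F[#|I|]} :=
  locked_with pvar_key 'X_(enum_rank i).

Lemma pvarE (i : I) : pvar i = 'X_(enum_rank i).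
Proof. by rewrite /pvar; case: pvar_key. Qed.

Lemma pvar_ord t : 'X_t = pvar (enum_val t).
Proof. by rewrite pvarE enum_valK. Qed.

Definition psubst (g : {rmorphism F -> S}) (v : I -> S) :
    {mpoly F[#|I|]} -> S :=
  locked_with psubst_key (mmap g (fun t => v (enum_val t))).

Lemma psubstE g v P : psubst g v P = mmap g (fun t => v (enum_val t)) P.
Proof. by rewrite /psubst; case: psubst_key. Qed.

Fact psubst_zmod g v : zmod_morphism (psubst g v).
Proof. by move=> p q; rewrite !psubstE rmorphB. Qed.

Fact psubst_monoid g v : monoid_morphism (psubst g v).
Proof. by split=> [|p q]; rewrite !psubstE (rmorph1, rmorphM). Qed.

HB.instance Definition _ g v :=
  GRing.isZmodMorphism.Build {mpoly F[#|I|]} S (psubst g v) (psubst_zmod g v).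
HB.instance Definition _ g v :=
  GRing.isMonoidMorphism.Build {mpoly F[#|I|]} S (psubst g v) (psubst_monoid g v).

Variables (g : {rmorphism F -> S}) (v : I -> S).

Lemma psubstC c : psubst g v c%:MP = g c.
Proof. by rewrite psubstE mmapC. Qed.

Lemma psubstZ c P : psubst g v (c *: P) = g c * psubst g v P.
Proof. by rewrite psubstE mmapZ -psubstE. Qed.

Lemma psubstX i : psubst g v (pvar i) = v i.
Proof. by rewrite psubstE pvarE mmapX mmap1U enum_rankK. Qed.

Lemma psubstXm m : psubst g v 'X_[m] = \prod_i v i ^+ m (enum_rank i).
Proof.
rewrite psubstE mmapX /mmap1 (reindex_onto (@enum_rank I) enum_val) /=.
  by apply: eq_big => i; rewrite enum_rankK ?eqxx.
by move=> t _; rewrite enum_valK.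
Qed.

(** All the identities between ring morphisms below are obtained by comparing
    both sides on constants and on variables. *)
Lemma psubst_uniq (f : {rmorphism {mpoly F[#|I|]} -> S}) :
  (forall c, f c%:MP = g c) -> (forall i, f (pvar i) = v i) ->
  f =1 psubst g v.
Proof.
move=> fC fX; apply: mpoly_ring_ind => [c|i|p q ep eq|p q ep eq].
- by rewrite psubstC.
- by rewrite pvar_ord fX psubstX.
- by rewrite !rmorphD ep eq.
- by rewrite !rmorphM ep eq.
Qed.

End PolySubst.

(** * Powers of an ideal, divisibility by powers of the variable *)

Section IdealPowers.

Variables (A : comNzRingType) (r : nat) (gens : 'I_r -> A).
Local Notation Ipow := (ideal_pow gens).

Lemma ideal_pow0 m : Ipow m 0.
Proof.
elim: m => //= m IH; exists (fun=> 0) => //.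
by rewrite big1 // => j _; rewrite mulr0.
Qed.

Lemma ideal_powD m P Q : Ipow m P -> Ipow m Q -> Ipow m (P + Q).
Proof.
elim: m P Q => //= m IH P Q [P' hP ->] [Q' hQ ->].
exists (fun j => P' j + Q' j) => [j|]; first exact: IH.
by rewrite -big_split; apply: eq_bigr => j _; rewrite mulrDr.
Qed.

Lemma ideal_pow_sum m (I : Type) (s : seq I) (p : pred I) (P : I -> A) :
  (forall i, p i -> Ipow m (P i)) -> Ipow m (\sum_(i <- s | p i) P i).
Proof.
by move=> h; apply: big_ind => //; [apply: ideal_pow0 | apply: ideal_powD].
Qed.

Lemma ideal_powM a b P Q : Ipow a P -> Ipow b Q -> Ipow (a + b) (P * Q).
Proof.
elim: a P => [|a IH] P /=.
  move=> _; elim: b Q => //= b IH Q [Q' hQ ->].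
  exists (fun j => P * Q' j) => [j|]; first exact: IH.
  by rewrite mulr_sumr; apply: eq_bigr => j _; rewrite mulrCA.
move=> [P' hP ->] hQ; exists (fun j => P' j * Q) => [j|]; first exact: IH.
by rewrite mulr_suml; apply: eq_bigr => j _; rewrite mulrA.
Qed.

Lemma ideal_pow_le a b P : (a <= b)%N -> Ipow b P -> Ipow a P.
Proof.
move=> /subnKC <-; rewrite addnC; elim: (b - a)%N P => [|c IH] P; first by [].
rewrite addSn => -[Q hQ ->]; apply: ideal_pow_sum => j _.
by rewrite -[a]add0n; apply: ideal_powM => //; exact: IH (hQ j).
Qed.

Lemma ideal_pow_gen j : Ipow 1 (gens j).
Proof.
exists (fun i => (i == j)%:R) => //.
rewrite (bigD1 j) //= eqxx mulr1 big1 ?addr0 // => i /negPf ->.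
by rewrite mulr0.
Qed.

End IdealPowers.

Lemma ideal_pow_ext (A : comNzRingType) j (g h : 'I_j -> A) m (Q : A) :
  g =1 h -> ideal_pow g m Q -> ideal_pow h m Q.
Proof.
move=> gh; elim: m Q => //= m IH Q [Q' hQ ->]; exists Q' => [i|]; first exact: IH.
by apply: eq_bigr => i _; rewrite gh.
Qed.

Definition Xdvd (A : comNzRingType) (m : nat) (P : {poly A}) : Prop :=
  exists Q, P = Q * 'X^m.

Section Xdvd.

Variable A : idomainType.
Implicit Types P Q G : {poly A}.

Lemma XdvdD m P Q : Xdvd m P -> Xdvd m Q -> Xdvd m (P + Q).
Proof. by move=> [P' ->] [Q' ->]; exists (P' + Q'); rewrite mulrDl. Qed.

Lemma XdvdM a b P Q : Xdvd a P -> Xdvd b Q -> Xdvd (a + b) (P * Q).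
Proof.
by move=> [P' ->] [Q' ->]; exists (P' * Q'); rewrite mulrACA -exprD.
Qed.

Lemma Xdvd0 P : Xdvd 0 P.
Proof. by exists P; rewrite expr0 mulr1. Qed.

Lemma Xdvd_sum m (I : Type) (s : seq I) (p : pred I) (P : I -> {poly A}) :
  (forall i, p i -> Xdvd m (P i)) -> Xdvd m (\sum_(i <- s | p i) P i).
Proof.
move=> h; apply: big_ind => //; last exact: XdvdD.
by exists 0; rewrite mul0r.
Qed.

Lemma Xdvd_coef m P j : Xdvd m P -> (j < m)%N -> P`_j = 0.
Proof. by move=> [Q ->] jm; rewrite coefMXn jm. Qed.

Lemma Xdvd1 P : P.[0] = 0 -> Xdvd 1 P.
Proof.
by move=> /eqP /factor_theorem [Q ->]; exists Q; rewrite subr0 expr1.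
Qed.

Lemma Xdvd_cancel m G P : G.[0] != 0 -> Xdvd m (G * P) -> Xdvd m P.
Proof.
move=> G0; elim: m P => [|m IH] P; first by move=> _; apply: Xdvd0.
move=> [Q e]; have P0 : P.[0] = 0.
  apply/eqP; have := congr1 (fun p => p.[0]) e.
  by rewrite exprS !hornerM hornerX mul0r mulr0 => /eqP; rewrite mulf_eq0 (negPf G0).
have [P1 eP] := Xdvd1 P0; move: e; rewrite expr1 in eP.
rewrite eP exprSr !mulrA => /(mulIf (negbT (polyX_eq0 _))) e.
have [Q' ->] := IH P1 (ex_intro _ Q e); by exists Q'; rewrite exprSr mulrA.
Qed.

End Xdvd.

Lemma pvar_mon (I : finType) (F : comNzRingType) (m : 'X_{1..#|I|}) :
  'X_[m] = \prod_(i : I) pvar F i ^+ m (enum_rank i).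
Proof.
under eq_bigr do rewrite pvarE.
rewrite mpolyXE_id (reindex_onto (@enum_rank I) enum_val) /=.
  by apply: eq_big => i; rewrite enum_rankK ?eqxx.
by move=> t _; rewrite enum_valK.
Qed.

Lemma pvar_neq0 (I : finType) (F : comNzRingType) (i : I) : pvar F i != 0.
Proof. by rewrite pvarE -msupp_eq0 msuppX. Qed.

(** * Multihomogeneous polynomials *)

Section CyclicIndices.

Variables (N : nat) (N_ge3 : (3 <= N)%N).
Implicit Types n m : 'Z_N.

Lemma ZN_two_neq0 : (1 + 1 : 'Z_N) != 0.
Proof.
case: N N_ge3 => [|[|[|M]]] // _.
Qed.

Lemma ZN_succ_neq n : (n + 1 == n) = false.
Proof. by rewrite -subr_eq0 addrC addKr oner_eq0. Qed.

Lemma ZN_pred_neq n : (n - 1 == n) = false.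
Proof. by rewrite -subr_eq0 addrC addKr oppr_eq0 oner_eq0. Qed.

Lemma ZN_pred_succ n : (n - 1 == n + 1) = false.
Proof.
rewrite -subr_eq0 opprD addrA [n - 1]addrC addrK -opprD oppr_eq0.
exact: negPf ZN_two_neq0.
Qed.

Lemma ZN_eqS n m : (n == m + 1) = (n - 1 == m).
Proof. by rewrite subr_eq. Qed.

Lemma ZN_eqP n m : (n == m - 1) = (n + 1 == m).
Proof. by rewrite eq_sym subr_eq eq_sym. Qed.

End CyclicIndices.

Notation polyring N F := {mpoly F[#|zidx N|]}.

Section Homogeneous.

Variables (N : nat) (F : fieldType).
Local Notation Kz := (polyring N F).

Definition zdeg (m : 'X_{1..#|zidx N|}) (n : 'Z_N) : nat :=
  (m (enum_rank (n, false)) + m (enum_rank (n, true)))%N.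

Definition cpoly : {rmorphism F -> {poly Kz}} := @polyC Kz \o @mpolyC #|zidx N| F.

(** The one-parameter subgroup that scales the homogeneous coordinates of the
    [n]-th factor. Homogeneity becomes an equation between values of a ring
    morphism. *)
Definition torus (n : 'Z_N) (P : Kz) : {poly Kz} :=
  psubst cpoly (fun z : zidx N => (pvar F z)%:P * 'X^(z.1 == n)) P.

HB.instance Definition _ (n : 'Z_N) := GRing.RMorphism.copy (torus n)
  (psubst cpoly (fun z : zidx N => (pvar F z)%:P * 'X^(z.1 == n))).

Lemma torusC n c : torus n c%:MP = (c%:MP)%:P.
Proof. by rewrite /torus /= psubstC. Qed.

Lemma torus_pvar n z : torus n (pvar F z) = (pvar F z)%:P * 'X^(z.1 == n).
Proof. by rewrite /torus /= psubstX. Qed.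

Lemma sum_zdeg n (m : 'X_{1..#|zidx N|}) :
  (\sum_(z : zidx N) (z.1 == n) * m (enum_rank z))%N = zdeg m n.
Proof.
rewrite (eq_bigr (fun z => (z.1 == n) * m (enum_rank (z.1, z.2)))%N); last by case.
rewrite -(pair_bigA _ (fun i (j : bool) => (i == n) * m (enum_rank (i, j)))%N) /=.
rewrite (bigD1 n) //= [X in (_ + X)%N]big1 => [|i /negPf ->]; last by rewrite big1.
by rewrite eqxx big_bool /= !mul1n addn0 addnC.
Qed.

Lemma torusXm n m : torus n 'X_[m] = ('X_[m] : Kz)%:P * 'X^(zdeg m n).
Proof.
rewrite /torus /= psubstXm.
under eq_bigr do rewrite exprMn -exprM.
rewrite big_split /= prodrXr sum_zdeg pvar_mon rmorph_prod /=.
by congr (_ * _); apply: eq_bigr => z _; rewrite rmorphXn.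
Qed.

Lemma torusE n (P : Kz) :
  torus n P = \sum_(m <- msupp P) (P@_m *: 'X_[m])%:P * 'X^(zdeg m n).
Proof.
rewrite {1}(mpolyE P) rmorph_sum /=; apply: eq_bigr => m _.
by rewrite -mul_mpolyC !rmorphM /= torusXm mulrA /torus /= psubstC.
Qed.

Definition factor_homog (n : 'Z_N) (d : nat) (P : Kz) : Prop :=
  torus n P = P%:P * 'X^d.

Lemma factor_homogP n d P :
  factor_homog n d P <-> (forall m, m \in msupp P -> zdeg m n = d).
Proof.
split=> [h m mP|h]; last first.
  rewrite /factor_homog torusE {3}(mpolyE P) rmorph_sum mulr_suml.
  by rewrite big_seq [RHS]big_seq; apply: eq_bigr => m /h ->.
have /(congr1 (fun Q : {poly Kz} => (Q`_(zdeg m n))@_m)) := h.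
rewrite torusE coef_sum coefCM coefXn raddf_sum /=.
rewrite (bigD1_seq m) ?msupp_uniq //= big1 => [|m' m'm]; last first.
  by rewrite coefCM coefXn mulr_natr mcoeffMn; rewrite mcoeffZ mcoeffX (negPf m'm) mulr0 mul0rn.
rewrite coefCM coefXn eqxx mulr1 mcoeffZ mcoeffX eqxx mulr1 addr0.
case: eqP => // _; rewrite mulr0 mcoeff0 => e0.
by move: mP; rewrite mcoeff_msupp e0 eqxx.
Qed.

Lemma factor_homog_cancel n a b P Q : Q != 0 -> P != 0 ->
  factor_homog n a Q -> factor_homog n b (P * Q) ->
  exists2 d, b = (d + a)%N & factor_homog n d P.
Proof.
rewrite /factor_homog => Q0 P0 hQ hPQ.
have X0 : ('X : {poly Kz}) != 0 by rewrite polyX_eq0.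
move: hPQ; rewrite rmorphM /= hQ rmorphM /=.
have -> : torus n P * (Q%:P * 'X^a) = torus n P * 'X^a * Q%:P by rewrite -mulrA [Q%:P * _]mulrC.
have -> : P%:P * Q%:P * 'X^b = P%:P * 'X^b * Q%:P by rewrite mulrAC.
have Q0' : Q%:P != 0 by rewrite polyC_eq0.
move/(mulIf Q0') => e; have ab : (a <= b)%N.
  rewrite leqNgt; apply/negP => ba.
  have /(congr1 (fun p : {poly Kz} => p`_b)) := e.
  by rewrite coefMXn ba coefCM coefXn eqxx mulr1 => /esym/eqP; rewrite (negPf P0).
exists (b - a)%N; first by rewrite subnK.
move: e; rewrite -{1}(subnK ab) exprD mulrA => /mulIf; apply.
by rewrite expf_eq0 (negPf X0) andbF.
Qed.

Lemma factor_homogM n a b P Q : factor_homog n a P -> factor_homog n b Q ->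
  factor_homog n (a + b) (P * Q).
Proof.
by rewrite /factor_homog => hP hQ; rewrite !rmorphM /= hP hQ mulrACA exprD.
Qed.

Lemma factor_homogD n a P Q : factor_homog n a P -> factor_homog n a Q -> factor_homog n a (P + Q).
Proof.
by rewrite /factor_homog => hP hQ; rewrite !rmorphD /= hP hQ mulrDl.
Qed.

Lemma factor_homogZ n a c P : factor_homog n a P -> factor_homog n a (c *: P).
Proof.
rewrite /factor_homog => hP; rewrite -mul_mpolyC !rmorphM /= hP mulrA.
by rewrite torusC.
Qed.

Lemma factor_homogX n a k P : factor_homog n a P -> factor_homog n (a * k) (P ^+ k).
Proof. by rewrite /factor_homog => hP; rewrite !rmorphXn /= hP exprMn exprM. Qed.

Lemma factor_homog_pvar n z : factor_homog n (z.1 == n) (pvar F z).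
Proof. by rewrite /factor_homog /torus /= psubstX. Qed.

End Homogeneous.

(** * Vanishing order along a center *)

Section Center.

Variables (N : nat) (N_ge3 : (3 <= N)%N) (F : fieldType).
Local Notation Kz := (polyring N F).
Local Notation zv n b := (@pvar (zidx N) F (n, b)).

Variables (n : 'Z_N) (b : bool) (c : F).

Definition center_form : Kz := zv n false + c *: zv n true.

Definition center_gens (t : 'I_3) : Kz :=
  tnth [tuple zv (n - 1) b; center_form; zv (n + 1) (~~ b)] t.

(** The deformation that fixes the center pointwise and contracts towards it:
    each of the three generators of the ideal of the center is multiplied by
    the parameter ['X]. The vanishing order along the center is the order in
    ['X] of the image ([vanishP]). *)
Definition flow (P : Kz) : {poly Kz} :=
  psubst (cpoly N F) (fun z =>
    if z == (n, false) then 'X * center_form%:P - (c *: zv n true)%:P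
    else (pvar F z)%:P * 'X^((z == (n - 1, b)) || (z == (n + 1, ~~ b)))) P.

HB.instance Definition _ := GRing.RMorphism.copy flow
  (psubst (cpoly N F) (fun z =>
    if z == (n, false) then 'X * center_form%:P - (c *: zv n true)%:P
    else (pvar F z)%:P * 'X^((z == (n - 1, b)) || (z == (n + 1, ~~ b))))).

(** Restriction to the center. *)
Definition restr (P : Kz) : Kz :=
  psubst (@mpolyC #|zidx N| F) (fun z =>
    if z == (n, false) then - (c *: zv n true)
    else if (z == (n - 1, b)) || (z == (n + 1, ~~ b)) then 0 else pvar F z) P.

HB.instance Definition _ := GRing.RMorphism.copy restr
  (psubst (@mpolyC #|zidx N| F) (fun z =>
    if z == (n, false) then - (c *: zv n true)
    else if (z == (n - 1, b)) || (z == (n + 1, ~~ b)) then 0 else pvar F z)).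

Definition vanish (m : nat) (P : Kz) : Prop := Xdvd m (flow P).

Lemma restr_pvar z : restr (pvar F z) =
  if z == (n, false) then - (c *: zv n true)
  else if (z == (n - 1, b)) || (z == (n + 1, ~~ b)) then 0 else pvar F z.
Proof. by rewrite /restr /= psubstX. Qed.

Lemma restrZ a P : restr (a *: P) = a *: restr P.
Proof. by rewrite -!mul_mpolyC rmorphM /= /restr /= psubstC. Qed.

Lemma flowC a : flow a%:MP = (a%:MP)%:P.
Proof. by rewrite /flow /= psubstC. Qed.

Lemma flowZ a P : flow (a *: P) = (a%:MP)%:P * flow P.
Proof. by rewrite -mul_mpolyC rmorphM /= flowC. Qed.

Lemma flow_pvar z : z.1 != n -> flow (pvar F z) =
  (pvar F z)%:P * 'X^((z == (n - 1, b)) || (z == (n + 1, ~~ b))).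
Proof.
by rewrite /flow /= psubstX; case: z => m b' /= /negPf mn; rewrite xpair_eqE mn.
Qed.

Lemma flow_n1 : flow (zv n true) = (zv n true)%:P.
Proof.
rewrite /flow /= psubstX !xpair_eqE eqxx /= ![n == _]eq_sym.
by rewrite (ZN_pred_neq n) (ZN_succ_neq n) /= mulr1.
Qed.

Lemma flow_n0 : flow (zv n false) = 'X * center_form%:P - (c *: zv n true)%:P.
Proof. by rewrite /flow /= psubstX eqxx. Qed.

Lemma flow_center_form : flow center_form = 'X * center_form%:P.
Proof.
rewrite {1}/center_form rmorphD /= flow_n0 flowZ flow_n1 -rmorphM mul_mpolyC.
by rewrite subrK.
Qed.

Lemma flow_gens t : flow (center_gens t) = 'X * (center_gens t)%:P.
Proof.
case: t => -[|[|[|//]]] i; rewrite /center_gens !(tnth_nth 0) /=.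
- by rewrite flow_pvar ?(ZN_pred_neq n) // eqxx mulrC.
- exact: flow_center_form.
- by rewrite flow_pvar ?(ZN_succ_neq n) // eqxx orbT mulrC.
Qed.

Lemma horner0_flow P : (flow P).[0] = restr P.
Proof.
rewrite -[LHS]/((horner_eval (0 : Kz) \o flow) P).
apply: psubst_uniq => [a|z] /=.
  by rewrite /horner_eval flowC hornerC.
rewrite /horner_eval /flow /= psubstX.
case: ifP => _.
  by rewrite hornerD hornerN hornerM hornerX mul0r !hornerC sub0r.
rewrite hornerM hornerC hornerXn.
by case: ifP => _; rewrite ?expr1 ?expr0 ?mulr0 ?mulr1.
Qed.

Lemma vanish1P P : restr P = 0 -> vanish 1 P.
Proof. by rewrite -horner0_flow; apply: Xdvd1. Qed.

Lemma vanish_gens t : vanish 1 (center_gens t).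
Proof. by rewrite /vanish flow_gens; exists (center_gens t)%:P; rewrite mulrC. Qed.

(** Stated for a morphism [f] and generators [g], in order to apply to the
    flow preceded by a transport of the center. *)
Lemma ideal_vanish (f : {rmorphism Kz -> {poly Kz}}) (g : 'I_3 -> Kz) m P :
  (forall t, Xdvd 1 (f (g t))) -> ideal_pow g m P -> Xdvd m (f P).
Proof.
move=> h; elim: m P => [|m IH] P /=; first by move=> _; apply: Xdvd0.
move=> [Q hQ ->]; rewrite rmorph_sum; apply: Xdvd_sum => t _.
by rewrite rmorphM; apply: (@XdvdM _ 1 m); [apply: h | apply: IH (hQ t)].
Qed.

(** Taylor expansion along the center: the coefficient of ['X^j] in the image
    of [P] is the part of [P] that has degree [j] in the generators. *)
Lemma flow_coef_ideal P j : ideal_pow center_gens j (flow P)`_j.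
Proof.
elim/mpoly_ring_ind: P j => [a|i|p q hp hq|p q hp hq] j.
- rewrite flowC coefC; case: eqP => [->//|_]; exact: ideal_pow0.
- rewrite pvar_ord; move: (enum_val i) => z.
  have lin (g : Kz) k : ideal_pow center_gens k g -> ideal_pow center_gens j (g%:P * 'X^k)`_j.
    move=> hg; rewrite coefCM coefXn; case: eqP => [->|_]; first by rewrite mulr1.
    by rewrite mulr0; apply: ideal_pow0.
  have g0 := @ideal_pow_gen _ _ center_gens (inord 0).
  have g1 := @ideal_pow_gen _ _ center_gens (inord 1).
  have g2 := @ideal_pow_gen _ _ center_gens (inord 2).
  rewrite /center_gens !(tnth_nth 0) !inordK //= in g0 g1 g2.
  have [->|z0] := eqVneq z (n, false).
    rewrite flow_n0 coefB mulrC; apply: ideal_powD; first exact: lin 1%N g1.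
    rewrite coefC; case: eqP => [->//|_]; rewrite oppr0; exact: ideal_pow0.
  rewrite /flow /= psubstX (negPf z0).
  case: (eqVneq z (n - 1, b)) => [->|_]; first exact: lin 1%N g0.
  case: (eqVneq z (n + 1, ~~ b)) => [->|_]; first exact: lin 1%N g2.
  exact: lin 0%N I.
- rewrite rmorphD coefD; exact: ideal_powD (hp j) (hq j).
- rewrite rmorphM coefM; apply: ideal_pow_sum => i _.
  rewrite -{1}(subnKC (ltn_ord i : (i <= j)%N)).
  exact: ideal_powM (hp i) (hq _).
Qed.

Lemma horner1_flow P : (flow P).[1] = P.
Proof.
rewrite -[LHS]/((horner_eval (1 : Kz) \o flow) P).
transitivity (psubst (@mpolyC #|zidx N| F) (pvar F) P); last first.
  by symmetry; apply: (psubst_uniq (f := idfun)).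
apply: psubst_uniq => [a|z] /=.
  by rewrite /horner_eval flowC hornerC.
rewrite /horner_eval /flow /= psubstX.
case: ifP => [/eqP ->|_].
  by rewrite hornerD hornerN hornerM hornerX mul1r !hornerC /center_form addrK.
by rewrite hornerM hornerC hornerXn expr1n mulr1.
Qed.

(** The coefficients of the flow at ['X^j] sum to [P], so that membership in a
    power of the ideal can be tested on the order in ['X], which is additive
    on products. *)
Lemma vanishP m P : vanish m P <-> ideal_pow center_gens m P.
Proof.
split=> [h|]; last by apply: ideal_vanish => t; apply: vanish_gens.
rewrite -[P]horner1_flow horner_coef; apply: ideal_pow_sum => j _.
rewrite expr1n mulr1; have [jm|mj] := ltnP j m.
  by rewrite (Xdvd_coef h jm); apply: ideal_pow0.
exact: ideal_pow_le mj (flow_coef_ideal P j).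
Qed.

(** The center is irreducible: a factor that is not identically zero on it
    does not contribute to the vanishing order. *)
Lemma vanish_cancel m G P : restr G != 0 -> vanish m (G * P) -> vanish m P.
Proof. by rewrite /vanish rmorphM -horner0_flow; apply: Xdvd_cancel. Qed.

Lemma vanishM m m' P Q : vanish m P -> vanish m' Q -> vanish (m + m') (P * Q).
Proof. by rewrite /vanish rmorphM; apply: XdvdM. Qed.

Lemma vanish0 P : vanish 0 P.
Proof. exact: Xdvd0. Qed.

Lemma center_form_neq0 : center_form != 0.
Proof.
apply: contra_neq (oner_neq0 F) => c0.
have <- : psubst (idfun : {rmorphism F -> F}) (fun z => (z == (n, false))%:R) center_form = 1.
  by rewrite /center_form rmorphD /= psubstZ !psubstX eqxx xpair_eqE andbF mulr0 addr0.
by rewrite c0 rmorph0.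
Qed.

(** The equation of the center in the middle factor has vanishing order
    exactly 1. *)
Lemma vanish_cancel_center_form m k P : vanish (k + m) (center_form ^+ k * P) -> vanish m P.
Proof.
rewrite /vanish rmorphM rmorphXn /= flow_center_form exprMn => -[Q].
rewrite exprD [Q * _]mulrCA -mulrA.
have X0 : ('X^k : {poly Kz}) != 0 by rewrite expf_eq0 polyX_eq0 andbF.
move/(mulfI X0) => e.
apply: (@Xdvd_cancel _ m (center_form%:P ^+ k)); last by exists Q.
by rewrite -rmorphXn hornerC expf_eq0 (negPf center_form_neq0) andbF.
Qed.

End Center.

(** * Mutation of polynomials *)

Lemma psubst_scale (N : nat) (F : fieldType) (S : comNzRingType)
  (g : {rmorphism F -> S}) (w : zidx N -> S) (n : 'Z_N) (q : S) d
  (P : polyring N F) : factor_homog n d P ->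
  psubst g (fun z => q ^+ (z.1 == n) * w z) P = q ^+ d * psubst g w P.
Proof.
move=> /factor_homogP h; rewrite (mpolyE P) !rmorph_sum mulr_sumr /=.
rewrite big_seq [RHS]big_seq; apply: eq_bigr => m /h <-.
rewrite !psubstZ mulrCA; congr (_ * _); rewrite !psubstXm.
under eq_bigr do rewrite exprMn -exprM.
by rewrite big_split /= prodrXr sum_zdeg.
Qed.

Lemma psubst_eq (I : finType) (F S : comNzRingType) (g : {rmorphism F -> S})
  (v w : I -> S) P : v =1 w -> psubst g v P = psubst g w P.
Proof.
move=> vw; apply: (psubst_uniq (f := psubst g v)) => [c|i]; first by rewrite /= psubstC.
by rewrite /= psubstX vw.
Qed.

Section LinearForm.

Variables (N : nat) (F : fieldType) (n : 'Z_N) (c : F).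
Local Notation Kz := (polyring N F).
Local Notation l := (center_form n c).

(** Reduction modulo the linear form. *)
Definition elim_var (P : Kz) : Kz :=
  psubst (@mpolyC #|zidx N| F) (fun z =>
    if z == (n, false) then - (c *: pvar F (n, true)) else pvar F z) P.

HB.instance Definition _ := GRing.RMorphism.copy elim_var
  (psubst (@mpolyC #|zidx N| F) (fun z =>
    if z == (n, false) then - (c *: pvar F (n, true)) else pvar F z)).

Lemma elim_varP P : exists Q, P = elim_var P + l * Q.
Proof.
elim/mpoly_ring_ind: P => [a|i|p q [p' hp] [q' hq]|p q [p' hp] [q' hq]].
- by exists 0; rewrite mulr0 addr0 /elim_var /= psubstC.
- rewrite pvar_ord; move: (enum_val i) => z.
  rewrite /elim_var /= psubstX; case: eqP => [->|_]; last by exists 0; rewrite mulr0 addr0.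
  by exists 1; rewrite mulr1 /center_form addrC addrK.
- by exists (p' + q'); rewrite rmorphD mulrDr addrACA -hp -hq.
- exists (p' * q + q' * elim_var p); rewrite {1}hp mulrDl {1}hq rmorphM; ring.
Qed.

Lemma elim_var_pvar i : elim_var (pvar F (n, i)) =
  if i then pvar F (n, true) else - (c *: pvar F (n, true)).
Proof. by rewrite /elim_var /= psubstX xpair_eqE eqxx; case: i. Qed.

Lemma elim_varZ a P : elim_var (a *: P) = a *: elim_var P.
Proof. by rewrite -!mul_mpolyC rmorphM /= /elim_var /= psubstC. Qed.

Lemma elim_var_form : elim_var l = 0.
Proof.
by rewrite /center_form rmorphD /= elim_varZ !elim_var_pvar addNr.
Qed.

(** The linear form is prime, so its powers divide [P] as soon as they divide
    the product of [P] with a polynomial that is nonzero modulo the form. *)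
Lemma form_dvd_cancel k P G Q : elim_var G != 0 -> P * G = l ^+ k * Q ->
  exists Q', P = l ^+ k * Q'.
Proof.
move=> G0; elim: k P Q => [|k IH] P Q e; first by exists P; rewrite mul1r.
have [P' eP] := elim_varP P.
have P0 : elim_var P = 0.
  have /eqP := congr1 elim_var e; rewrite !rmorphM rmorphXn /= elim_var_form.
  by rewrite expr0n mul0r mulf_eq0 (negPf G0) orbF => /eqP.
move: eP e; rewrite P0 add0r => ->; rewrite exprS -!mulrA.
move/(mulfI (center_form_neq0 n c)) => /IH [Q' ->].
by exists Q'; rewrite mulrA.
Qed.

End LinearForm.

Lemma scaled_prod (S : comPzRingType) (x1 x2 y p q : S) i j :
  (x1 * y) ^+ i * (x2 * y) ^+ j * (p * q) =
  y ^+ i * (y ^+ j * (q * (x1 ^+ i * x2 ^+ j * p))).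
Proof. by rewrite !exprMn; ring. Qed.

Lemma split_factor (S : comPzRingType) (x y p : S) (e : bool) :
  x ^+ e * y * (p * x ^+ (~~ e)) = x * (y * p).
Proof. by case: e; rewrite expr0 expr1; ring. Qed.

Lemma unit_factor (S : comPzRingType) (p : S) :
  1 * 1 * (p * 1) = 1 * (1 * (1 * 1 * p)).
Proof. by rewrite !mul1r mulr1. Qed.

Fact exch_factor_key : unit. Proof. exact: tt. Qed.

Section Mutation.

Variables (N : nat) (N_ge3 : (3 <= N)%N) (F : fieldType).
Local Notation Kz := (polyring N F).
Local Notation zv n b := (@pvar (zidx N) F (n, b)).

Variables (s : {rmorphism F -> F}) (n : 'Z_N) (co : bool -> bool -> F).
Hypothesis sK : involutive s.
Hypothesis co_neq0 : forall b i, co b i != 0.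
Hypothesis s_co : forall b i, s (co b i) = co (~~ b) i.

(** The two exchange forms: [exch true] and [exch false], evaluated at the tau
    variables, are the numerators of the images of tau_n^1 and of tau_n^{-1}.
    The center C_n^{-1}, which has side [true], is the zero of [exch true];
    C_n^1, of side [false], is the zero of [exch false]. *)
Definition exch (b : bool) : Kz := co b false *: zv n false + co b true *: zv n true.
Definition exch_ratio (b : bool) : F := co b true / co b false.
Hypothesis exch_ratio_neq : exch_ratio true != exch_ratio false.

(** tau_n^1 occurs in zeta_{n+1}^oo and in zeta_{n-1}^0, tau_n^{-1} in
    zeta_{n+1}^0 and in zeta_{n-1}^oo. *)
Definition exch_factor (z : zidx N) : Kz :=
  locked_with exch_factor_key (exch z.2 ^+ (z.1 == n + 1) * exch (~~ z.2) ^+ (z.1 == n - 1)).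

Lemma exch_factorE z :
  exch_factor z = exch z.2 ^+ (z.1 == n + 1) * exch (~~ z.2) ^+ (z.1 == n - 1).
Proof. by rewrite /exch_factor; case: exch_factor_key. Qed.

(** The effect on polynomials of the reflection at [(n, 0)], up to a power of
    tau_n^1 tau_n^{-1}. *)
Definition mut (P : Kz) : Kz :=
  psubst (@mpolyC #|zidx N| F \o s) (fun z => exch_factor z * pvar F z) P.

HB.instance Definition _ := GRing.RMorphism.copy mut
  (psubst (@mpolyC #|zidx N| F \o s) (fun z => exch_factor z * pvar F z)).

Lemma mutC c : mut c%:MP = (s c)%:MP.
Proof. by rewrite /mut /= psubstC. Qed.

Lemma mutZ c P : mut (c *: P) = s c *: mut P.
Proof. by rewrite -!mul_mpolyC rmorphM /= mutC. Qed.

Lemma mut_pvar z : mut (pvar F z) = exch_factor z * pvar F z.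
Proof. by rewrite /mut /= psubstX. Qed.

Lemma rmorph_exch_factor (S : comNzRingType) (f : {rmorphism Kz -> S}) z :
  f (exch_factor z) = f (exch z.2) ^+ (z.1 == n + 1) * f (exch (~~ z.2)) ^+ (z.1 == n - 1).
Proof. by rewrite exch_factorE rmorphM !rmorphXn. Qed.

Lemma exch_factor_S b : exch_factor (n + 1, b) = exch b.
Proof. by rewrite exch_factorE /= eqxx eq_sym (ZN_pred_succ N_ge3) mulr1. Qed.

Lemma exch_factor_P b : exch_factor (n - 1, b) = exch (~~ b).
Proof. by rewrite exch_factorE /= eqxx (ZN_pred_succ N_ge3) mul1r. Qed.

Lemma exch_factor_n b : exch_factor (n, b) = 1.
Proof.
by rewrite exch_factorE /= ![n == _]eq_sym (ZN_pred_neq n) (ZN_succ_neq n) mulr1.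
Qed.

Lemma mut_form c : mut (center_form n c) = center_form n (s c).
Proof. by rewrite /center_form rmorphD /= mutZ !mut_pvar !exch_factor_n !mul1r. Qed.

Lemma exchE b : exch b = co b false *: center_form n (exch_ratio b).
Proof. by rewrite /center_form scalerDr scalerA mulrCA divff ?mulr1. Qed.

Lemma s_exch_ratio b : s (exch_ratio b) = exch_ratio (~~ b).
Proof. by rewrite /exch_ratio fmorph_div !s_co. Qed.

Lemma mut_exch b : mut (exch b) = exch (~~ b).
Proof. by rewrite !exchE mutZ mut_form s_exch_ratio s_co. Qed.

Lemma exch_neq0 b : exch b != 0.
Proof. by rewrite exchE scaler_eq0 negb_or co_neq0 center_form_neq0. Qed.

Lemma exch_ratio_neqC b : exch_ratio b != exch_ratio (~~ b).
Proof. by case: b; rewrite // eq_sym. Qed.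

(** The reflection of the coefficients exchanges the two exchange forms, so
    that each coordinate of a neighbouring factor meets both of them. *)
Lemma mut_mut d1 d2 P : factor_homog (n + 1) d1 P -> factor_homog (n - 1) d2 P ->
  mut (mut P) = (exch true * exch false) ^+ (d1 + d2) * P.
Proof.
move=> h1 h2; rewrite exprD -mulrA.
have {2}-> : P = psubst (@mpolyC #|zidx N| F) (pvar F) P.
  exact: (psubst_uniq (f := idfun)).
rewrite -(psubst_scale _ _ _ h2) -(psubst_scale _ _ _ h1).
apply: (psubst_uniq (f := mut \o mut)) => [a|z] /=.
  by rewrite !mutC sK.
rewrite mut_pvar rmorphM /= mut_pvar mulrA mulrA; congr (_ * _).
rewrite exch_factorE !rmorphM !rmorphXn /= !mut_exch negbK.
have e b : exch (~~ b) * exch b = exch true * exch false by case: b; rewrite // mulrC.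
rewrite -(e z.2) !exprMn; ring.
Qed.

Lemma mut_inj P d1 d2 : factor_homog (n + 1) d1 P -> factor_homog (n - 1) d2 P ->
  mut P = 0 -> P = 0.
Proof.
move=> h1 h2 e0; have := mut_mut h1 h2; rewrite e0 rmorph0 => /esym/eqP.
by rewrite mulf_eq0 expf_eq0 mulf_eq0 !(negPf (exch_neq0 _)) andbF => /eqP.
Qed.

Lemma elim_var_exch b : elim_var n (exch_ratio b) (exch (~~ b)) != 0.
Proof.
rewrite /exch rmorphD /= !elim_varZ !elim_var_pvar.
rewrite scalerN scalerA -scaleNr -scalerDl scaler_eq0 negb_or.
rewrite pvar_neq0 andbT addrC subr_eq0 eq_sym.
apply: contra (exch_ratio_neqC b) => /eqP e.
by rewrite [exch_ratio (~~ b)]/exch_ratio -e mulrAC divff ?mul1r.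
Qed.

(** The reflection exchanges the two centers over the factor [n], hence each
    generator of the ideal of one center becomes a multiple of the exchange
    form of the other one. *)
Lemma mut_ideal_dvd b m P : ideal_pow (center_gens n b (exch_ratio b)) m P ->
  exists Q, mut P = exch (~~ b) ^+ m * Q.
Proof.
elim: m P => [|m IH] P /=; first by exists (mut P); rewrite mul1r.
move=> [Q hQ ->]; rewrite rmorph_sum /=.
apply: (big_ind (fun R => exists Q', R = exch (~~ b) ^+ m.+1 * Q'))  => [|p q [p' ->] [q' ->]|t _].
- by exists 0; rewrite mulr0.
- by exists (p' + q'); rewrite mulrDr.
rewrite rmorphM /=; have [Q' ->] := IH _ (hQ t).
suff [g ->] : exists g, mut (center_gens n b (exch_ratio b) t) = exch (~~ b) * g.
  by exists (g * Q'); rewrite exprS mulrACA.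
case: t => -[|[|[|//]]] i; rewrite /center_gens !(tnth_nth 0) /=.
- by exists (zv (n - 1) b); rewrite mut_pvar exch_factor_P.
- exists (co (~~ b) false)^-1%:MP.
  by rewrite mut_form s_exch_ratio exchE -mul_mpolyC mulrAC -rmorphM divff // mul1r.
- by exists (zv (n + 1) (~~ b)); rewrite mut_pvar exch_factor_S.
Qed.

(** Dividing by the powers of both exchange forms is possible because these
    are coprime. *)
Lemma mut_dvd (e : bool -> nat) P :
  (forall b, ideal_pow (center_gens n b (exch_ratio b)) (e b) P) ->
  exists Q, mut P = exch true ^+ e false * exch false ^+ e true * Q.
Proof.
move=> h; have [Q1 e1] := mut_ideal_dvd (h true).
have [Q2 e2] := mut_ideal_dvd (h false).
have e3 : Q2 * exch true ^+ e false =
    center_form n (exch_ratio false) ^+ e true * (co false false ^+ e true *: Q1).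
  by rewrite mulrC -e2 e1 /= exchE exprZn -scalerAl -scalerAr.
have nz : elim_var n (exch_ratio false) (exch true ^+ e false) != 0.
  by rewrite rmorphXn expf_eq0 (negPf (elim_var_exch false)) andbF.
have [Q eQ] := form_dvd_cancel nz e3.
exists (((co false false) ^+ e true)^-1 *: Q).
rewrite e2 eQ [exch false]exchE exprZn /= -!scalerAr -scalerAl scalerA.
by rewrite mulVf ?expf_neq0 ?co_neq0 // scale1r mulrA.
Qed.

Lemma mut_homog m d1 d2 d P : factor_homog (n + 1) d1 P -> factor_homog (n - 1) d2 P ->
  factor_homog m d P -> factor_homog m (d + (m == n) * (d1 + d2)) (mut P).
Proof.
move=> h1 h2 h; rewrite /factor_homog.
have lfh b : torus m (exch b) = (exch b)%:P * 'X^(m == n).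
  rewrite /exch; apply: factor_homogD; apply: factor_homogZ.
    by have := @factor_homog_pvar N F m (n, false); rewrite eq_sym.
  by have := @factor_homog_pvar N F m (n, true); rewrite eq_sym.
have e1 : torus m (mut P) = psubst (cpoly N F \o s) (fun z =>
    ('X^(m == n)) ^+ (z.1 == n + 1) * (('X^(m == n)) ^+ (z.1 == n - 1) *
     ('X ^+ (z.1 == m) * (exch_factor z * pvar F z)%:P))) P.
  pose f : {rmorphism Kz -> {poly Kz}} := torus m \o mut.
  rewrite -[LHS]/(f P); move: P {h1 h2 h}.
  apply: psubst_uniq => [a|z]; rewrite /f /=.
    by rewrite mutC torusC.
  rewrite mut_pvar exch_factorE !rmorphM /= !rmorphXn /= !lfh.
  have -> : torus m (pvar F z) = (pvar F z)%:P * 'X^(z.1 == m).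
    exact: factor_homog_pvar.
  exact: scaled_prod.
rewrite e1 (psubst_scale _ _ _ h1) (psubst_scale _ _ _ h2) (psubst_scale _ _ _ h).
have -> : psubst (cpoly N F \o s) (fun z => (exch_factor z * pvar F z)%:P) P = (mut P)%:P.
  symmetry; apply: (psubst_uniq (f := (@polyC Kz) \o mut)) => [a|z] /=.
    by rewrite mutC.
  by rewrite mut_pvar.
by rewrite -!exprM mulrA -exprD -mulnDr mulrA -exprD mulrC addnC.
Qed.

Lemma exch_homog m b : factor_homog m (m == n) (exch b).
Proof.
rewrite /exch; apply: factor_homogD; apply: factor_homogZ.
  by have := @factor_homog_pvar N F m (n, false); rewrite eq_sym.
by have := @factor_homog_pvar N F m (n, true); rewrite eq_sym.
Qed.

(** The condition under which mutation maps the ideal of a center over the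
    factor [m] into itself. Over the factors next to [n], the middle
    coordinates are multiplied by the exchange forms, whose restriction to the
    center is a multiple of one of the coordinates of the factor [n]. *)
Definition compat (m : 'Z_N) (b : bool) (c : F) : Prop :=
  if m == n + 1 then s c * co true (~~ b) = c * co false (~~ b)
  else if m == n - 1 then s c * co false b = c * co true b
  else s c = c.

Local Notation restr := (@restr N F).

Lemma restr_pvar_S b c i :
  restr (n + 1) b c (zv n i) = if i == b then 0 else zv n i.
Proof.
rewrite restr_pvar !xpair_eqE addrK eqxx eq_sym ZN_succ_neq /=.
by rewrite -[n == _]subr_eq0 !opprD !addrA addrN sub0r -opprD oppr_eq0
  (negPf (ZN_two_neq0 N_ge3)) orbF.
Qed.

Lemma restr_pvar_P b c i :
  restr (n - 1) b c (zv n i) = if i == ~~ b then 0 else zv n i.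
Proof.
rewrite restr_pvar !xpair_eqE subrK eqxx [n == n - 1]eq_sym ZN_pred_neq /=.
by rewrite -[n == _]subr_eq0 !opprD !opprK !addrA addrN add0r
  (negPf (ZN_two_neq0 N_ge3)).
Qed.

Lemma restr_pvar_other m b c i : m != n -> m != n + 1 -> m != n - 1 ->
  restr m b c (zv n i) = zv n i.
Proof.
move=> mn mS mP; rewrite restr_pvar !xpair_eqE [n == m]eq_sym (negPf mn) /=.
rewrite [n == m - 1]eq_sym subr_eq (negPf mS).
by rewrite -[n == m + 1]subr_eq [n - 1 == m]eq_sym (negPf mP).
Qed.

Lemma restr_exch_S b c j :
  restr (n + 1) b c (exch j) = co j (~~ b) *: zv n (~~ b).
Proof.
rewrite /exch rmorphD /= !restrZ !restr_pvar_S.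
by case: b => /=; rewrite scaler0 ?addr0 ?add0r.
Qed.

Lemma restr_exch_P b c j :
  restr (n - 1) b c (exch j) = co j b *: zv n b.
Proof.
rewrite /exch rmorphD /= !restrZ !restr_pvar_P.
by case: b => /=; rewrite scaler0 ?addr0 ?add0r.
Qed.

Lemma restr_exch_n b c j :
  restr n b c (exch j) = (co j true - co j false * c) *: zv n true.
Proof.
rewrite /exch rmorphD /= !restrZ !restr_pvar eqxx !xpair_eqE andbF /=.
rewrite [n == n - 1]eq_sym ZN_pred_neq [n == n + 1]eq_sym ZN_succ_neq /=.
by rewrite scalerN scalerA addrC scalerBl.
Qed.

Lemma restr_exch_other m b c j : m != n -> m != n + 1 -> m != n - 1 ->
  restr m b c (exch j) = exch j.
Proof.
by move=> mn mS mP; rewrite /exch rmorphD /= !restrZ !restr_pvar_other.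
Qed.

Lemma restr_mid1 m b c : restr m b c (zv m true) = zv m true.
Proof.
by rewrite restr_pvar !xpair_eqE eqxx [m == m - 1]eq_sym ZN_pred_neq
  [m == m + 1]eq_sym ZN_succ_neq.
Qed.

Lemma restr_mid0 m b c : restr m b c (zv m false) = - (c *: zv m true).
Proof. by rewrite restr_pvar eqxx. Qed.

Lemma restr_mut_pvar m b c z :
  restr m b c (mut (pvar F z)) = restr m b c (exch_factor z) * restr m b c (pvar F z).
Proof.
exact: etrans (congr1 (restr m b c) (mut_pvar z)) (rmorphM (restr m b c) _ _).
Qed.

Lemma restr_mut_center_form m b c : restr m b c (mut (center_form m c)) =
  - (restr m b c (exch_factor (m, false)) * (c *: zv m true))
  + s c *: (restr m b c (exch_factor (m, true)) * zv m true).
Proof.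
have e : mut (center_form m c) =
  exch_factor (m, false) * zv m false + s c *: (exch_factor (m, true) * zv m true).
  by rewrite /center_form rmorphD /= mutZ !mut_pvar.
apply: etrans (congr1 (restr m b c) e) _.
rewrite rmorphD /= restrZ !rmorphM /=.
by rewrite restr_mid0 restr_mid1 mulrN.
Qed.

Lemma restr_mut_gens m b c t : compat m b c ->
  restr m b c (mut (center_gens m b c t)) = 0.
Proof.
move=> hc; case: t => -[|[|[|//]]] i; rewrite /center_gens !(tnth_nth 0) /=.
- rewrite restr_mut_pvar restr_pvar xpair_eqE (ZN_pred_neq m) /=.
  by rewrite eqxx mulr0.
- rewrite restr_mut_center_form.
  move: hc; rewrite /compat; have [->|mS] := eqVneq m (n + 1).
    rewrite !exch_factor_S !restr_exch_S => e.
    by rewrite -!scalerAl -!scalerAr !scalerA e mulrC addNr.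
  have [->|mP] := eqVneq m (n - 1).
    rewrite !exch_factor_P !restr_exch_P => e.
    by rewrite -!scalerAl -!scalerAr !scalerA e mulrC addNr.
  move=> e; rewrite !exch_factorE (negPf mS) (negPf mP) !mulr1 !rmorph1 !mul1r e.
  by rewrite addNr.
- rewrite restr_mut_pvar restr_pvar xpair_eqE (ZN_succ_neq m) /=.
  by rewrite eqxx orbT mulr0.
Qed.

Lemma mut_vanish m b c k P : compat m b c ->
  ideal_pow (center_gens m b c) k P -> vanish m b c k (mut P).
Proof.
move=> hc; pose f : {rmorphism Kz -> {poly Kz}} := @flow N F m b c \o mut.
apply: (ideal_vanish (f := f)) => t; apply: vanish1P; exact: restr_mut_gens.
Qed.

Lemma restr_exch_neq0 m b c j : (m = n -> c != exch_ratio j) -> restr m b c (exch j) != 0.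
Proof.
move=> h; have [->|mS] := eqVneq m (n + 1).
  by rewrite restr_exch_S scaler_eq0 negb_or co_neq0 pvar_neq0.
have [->|mP] := eqVneq m (n - 1).
  by rewrite restr_exch_P scaler_eq0 negb_or co_neq0 pvar_neq0.
have [mn|mn] := eqVneq m n; last by rewrite restr_exch_other // exch_neq0.
rewrite mn restr_exch_n scaler_eq0 negb_or pvar_neq0 andbT subr_eq0.
apply: contra (h mn) => /eqP e.
by rewrite /exch_ratio e mulrAC divff ?mul1r.
Qed.

(** Each coordinate of the two neighbouring factors either vanishes on the
    center itself or acquires the exchange form that vanishes on it. *)
Lemma mut_vanish_opp b d1 d2 P : factor_homog (n + 1) d1 P -> factor_homog (n - 1) d2 P ->
  vanish n b (exch_ratio b) (d1 + d2) (mut P).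
Proof.
move=> h1 h2; rewrite /vanish.
have Pn : (n == n - 1) = false by rewrite eq_sym ZN_pred_neq.
have flf j : flow n b (exch_ratio b) (exch j) =
   'X ^+ (j == b) * (if j == b then (exch j)%:P else flow n b (exch_ratio b) (exch j)).
  case: eqP => [->|_]; last by rewrite mul1r.
  by rewrite exchE flowZ flow_center_form expr1 mulrCA -mul_mpolyC rmorphM.
(* What is left of the flow of the image of each coordinate after one factor
   'X has been removed from every coordinate of a neighbouring factor. *)
pose g (z : zidx N) : {poly Kz} :=
  (if z.1 == n + 1 then
     if z.2 == b then (exch z.2)%:P else flow n b (exch_ratio b) (exch z.2)
   else 1) *
  (if z.1 == n - 1 then
     if ~~ z.2 == b then (exch (~~ z.2))%:P
     else flow n b (exch_ratio b) (exch (~~ z.2))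
   else 1) *
  (if z.1 == n then flow n b (exch_ratio b) (pvar F z) else (pvar F z)%:P).
suff -> : flow n b (exch_ratio b) (mut P) =
    psubst (cpoly N F \o s) (fun z => 'X ^+ (z.1 == n + 1) * ('X ^+ (z.1 == n - 1) * g z)) P.
  rewrite (psubst_scale _ _ _ h1) (psubst_scale _ _ _ h2) mulrA -exprD mulrC.
  by eexists.
pose f : {rmorphism Kz -> {poly Kz}} := @flow N F n b (exch_ratio b) \o mut.
rewrite -[LHS]/(f P); move: P {h1 h2}.
apply: psubst_uniq => [a|z]; rewrite /f /=; first by rewrite mutC flowC.
rewrite mut_pvar exch_factorE !rmorphM !rmorphXn /= /g.
have [zn|zn] := eqVneq z.1 n.
  by rewrite zn Pn eq_sym ZN_succ_neq !expr0 !mul1r.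
rewrite flow_pvar //; case: z zn => m i /= mn; rewrite !xpair_eqE.
have [->|mS] := eqVneq m (n + 1).
  rewrite eq_sym (ZN_pred_succ N_ge3) !expr0 !expr1 !mul1r !mulr1 /=.
  rewrite {1}flf (_ : (i == ~~ b) = ~~ (i == b)); last by case: (i) (b) => -[].
  exact: split_factor.
have [->|mP] := eqVneq m (n - 1).
  rewrite !expr0 !expr1 !mul1r /= orbF.
  rewrite {1}flf (_ : (i == b) = ~~ (~~ i == b)); last by case: (i) (b) => -[].
  exact: split_factor.
rewrite /= !expr0; exact: unit_factor.
Qed.

End Mutation.

(** * Labels and positions *)

Section Labels.

Variables (N : nat) (k l : 'Z_N -> nat).
Local Notation eidx := (eidx k l).
Local Notation ridx := (ridx k l).

(** Position in the chain E_n^{-l_n}, .., E_n^{-1}, E_n^1, .., E_n^{k_n},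
    counted so that the reflection labelled [i] exchanges the positions [i]
    and [i + 1] for every [i], including [i = 0]: there is no upper label 0.
    *)
Definition chain_pos (x : eidx) : int :=
  match tagged x with inl i => i.+1%:Z | inr j => - j%:Z end.

Definition chain_lab (h : int) : int := if 0 < h then h else h - 1.

Lemma elabE x : elab x = (tag x, chain_lab (chain_pos x)).
Proof.
case: x => n [i|j]; rewrite /elab /chain_pos /chain_lab //=.
by case: ifP => // j0; congr (_, _); lia.
Qed.

Lemma chain_lab_inj : injective chain_lab.
Proof. by move=> a b; rewrite /chain_lab; do 2!case: ifP; lia. Qed.

Lemma eidx_eq (x y : eidx) : (x == y) = (tag x == tag y) && (chain_pos x == chain_pos y).
Proof.
apply/eqP/andP => [->|[]]; first by rewrite !eqxx.
case: x y => n a [m b] /= /eqP nm; subst m; rewrite /chain_pos /=.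
case: a b => [i|j] [i'|j'] /eqP e; congr (existT _ _ _).
- by congr inl; apply/val_inj => /=; lia.
- by exfalso; lia.
- by exfalso; lia.
- by congr inr; apply/val_inj => /=; lia.
Qed.

Lemma elab_eq x n h : (elab x == (n, chain_lab h)) = (tag x == n) && (chain_pos x == h).
Proof. by rewrite elabE xpair_eqE (inj_eq chain_lab_inj). Qed.

Lemma elab_inj : injective (@elab N k l).
Proof.
move=> x y; rewrite !elabE => -[e1 /chain_lab_inj e2].
by apply/eqP; rewrite eidx_eq e1 e2 !eqxx.
Qed.

Lemma chain_pos_surj n h : 1 - (l n)%:Z <= h <= (k n)%:Z ->
  exists2 x : eidx, tag x = n & chain_pos x = h.
Proof.
move=> hr; have [h0|h0] := ltrP 0 h.
  have lt : (`|h| - 1 < k n)%N by lia.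
  by exists (epos l (Ordinal lt)) => //; rewrite /chain_pos /=; lia.
have lt : (`|h| < l n)%N by lia.
by exists (eneg k (Ordinal lt)) => //; rewrite /chain_pos /=; lia.
Qed.

Lemma rlab_inj : injective (@rlab N k l).
Proof.
move=> [n a] [m b]; rewrite /rlab /= => -[nm]; subst m.
case: a b => [[i|j]|] [[i'|j']|] e; congr (existT _ _ _) => //; try by exfalso; lia.
  by congr (Some (inl _)); apply/val_inj => /=; lia.
by congr (Some (inr _)); apply/val_inj => /=; lia.
Qed.

Lemma rlab_surj n i : - (l n)%:Z < i < (k n)%:Z ->
  exists r : ridx, rlab r = (n, i).
Proof.
move=> ir; have [i0|i0|e0] := ltrgtP 0 i.
- have lt : (`|i| - 1 < (k n).-1)%N by lia.
  exists (Tagged (fun n => option ('I_(k n).-1 + 'I_(l n).-1)%type)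
    (Some (inl (Ordinal lt)))).
  by rewrite /rlab /=; congr (_, _); lia.
- have lt : (`|i| - 1 < (l n).-1)%N by lia.
  exists (Tagged (fun n => option ('I_(k n).-1 + 'I_(l n).-1)%type)
    (Some (inr (Ordinal lt)))).
  by rewrite /rlab /=; congr (_, _); lia.
- exists (existT (fun n => option ('I_(k n).-1 + 'I_(l n).-1)%type) n None).
  by rewrite /rlab /= e0.
Qed.

Lemma sum_rlab (A : nmodType) (g : 'Z_N -> int -> A) n i :
  (~~ (- (l n)%:Z < i < (k n)%:Z) -> g n i = 0) ->
  \sum_(r : ridx | rlab r == (n, i)) g (rlab r).1 (rlab r).2 = g n i.
Proof.
move=> g0; have [/rlab_surj [r er]|/g0 e0] := boolP (- (l n)%:Z < i < (k n)%:Z).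
  rewrite (big_pred1 r) ?er // => q.
  by rewrite -er (inj_eq rlab_inj).
by rewrite big1 // => r /eqP ->.
Qed.

Lemma adjacentE (r q : ridx) (n : 'Z_N) (i : int) : rlab r = (n, i) ->
  adjacent r q = [|| rlab q == (n, i + 1), rlab q == (n, i - 1),
    (i == 0) && (rlab q == (n + 1, 0)) | (i == 0) && (rlab q == (n - 1, 0))].
Proof.
rewrite /adjacent => ->; case: (rlab q) => m j; rewrite !xpair_eqE.
by do ![case: eqP => ? //=].
Qed.

Lemma adjacent_irr (r : ridx) : adjacent r r = false.
Proof.
case e: (rlab r) => [n i]; rewrite (adjacentE _ e) e !xpair_eqE eqxx.
rewrite [n == n + 1]eq_sym [n == n - 1]eq_sym (ZN_succ_neq n) (ZN_pred_neq n) !andbF !orbF /=.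
by apply/norP; split; apply/eqP; lia.
Qed.

Section Ranges.

Hypothesis k_gt0 : forall n, (0 < k n)%N.
Hypothesis l_gt0 : forall n, (0 < l n)%N.

Lemma chain_pos_range x : 1 - (l (tag x))%:Z <= chain_pos x <= (k (tag x))%:Z.
Proof.
case: x => n [i|j]; rewrite /chain_pos /=.
  by have := ltn_ord i; have := l_gt0 n; lia.
by have := ltn_ord j; have := k_gt0 n; lia.
Qed.

Lemma rlab_range (r : ridx) :
  - (l (rlab r).1)%:Z < (rlab r).2 < (k (rlab r).1)%:Z.
Proof.
case: r => n [[i|j]|]; rewrite /rlab /=.
- by have := ltn_ord i; have := k_gt0 n; have := l_gt0 n; lia.
- by have := ltn_ord j; have := k_gt0 n; have := l_gt0 n; lia.
- by have := k_gt0 n; have := l_gt0 n; lia.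
Qed.

Lemma refl_pos (r : ridx) : exists x0 x1 : eidx,
  [/\ tag x0 = (rlab r).1, tag x1 = (rlab r).1,
      chain_pos x0 = (rlab r).2 & chain_pos x1 = (rlab r).2 + 1].
Proof.
have := rlab_range r; case: (rlab r) => n i /= ir.
have [|x0 t0 h0] := @chain_pos_surj n i; first by lia.
have [|x1 t1 h1] := @chain_pos_surj n (i + 1); first by lia.
by exists x0, x1.
Qed.

End Ranges.

Hypothesis N_ge3 : (3 <= N)%N.

(** The function is required to vanish at the labels out of range, so that the
    ends of the chain need not be distinguished. *)
Lemma sum_adjacent (A : zmodType) (g : 'Z_N -> int -> A) (r : ridx) n i :
  rlab r = (n, i) ->
  (forall m j, ~~ (- (l m)%:Z < j < (k m)%:Z) -> g m j = 0) ->
  \sum_(q | adjacent r q) g (rlab q).1 (rlab q).2 =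
  g n (i + 1) + g n (i - 1) + (if i == 0 then g (n + 1) 0 + g (n - 1) 0 else 0).
Proof.
move=> er g0; rewrite (eq_bigl _ _ (fun q => adjacentE q er)).
have E m j := sum_rlab (g0 m j).
rewrite (bigID (fun q => rlab q == (n, i + 1))) /=; rewrite -addrA; congr (_ + _).
  rewrite -(E n (i + 1)); apply: eq_bigl => q.
  by case: eqP => //= _; rewrite andbF.
rewrite (bigID (fun q => rlab q == (n, i - 1))) /=; congr (_ + _).
  rewrite -(E n (i - 1)); apply: eq_bigl => q.
  case: (eqVneq (rlab q) (n, i - 1)) => [->|_]; rewrite ?andbF ?andbT //.
  by rewrite !xpair_eqE !eqxx orbT /=; apply/eqP; lia.
case: (eqVneq i 0) => i0 /=; last first.
  by apply: big1 => q; case: eqP => //=; case: eqP.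
rewrite (bigID (fun q => rlab q == (n + 1, 0))) /=; congr (_ + _).
  rewrite -(E (n + 1) 0); apply: eq_bigl => q.
  case: (eqVneq (rlab q) (n + 1, 0)) => [->|_]; rewrite ?andbF ?andbT //.
  by rewrite !xpair_eqE (ZN_succ_neq n) !eqxx.
rewrite -(E (n - 1) 0); apply: eq_bigl => q.
case: (eqVneq (rlab q) (n - 1, 0)) => [->|_]; last first.
  by case: (_ == _) => //=; case: (_ == _) => //=; case: (_ == _).
by rewrite !xpair_eqE (ZN_pred_neq n) (ZN_pred_succ N_ge3) !eqxx orbT.
Qed.

End Labels.

(** * Exponents of the centers *)

Section Exponents.

Variables (N : nat) (k l : 'Z_N -> nat).
Hypothesis k_gt0 : forall n, (0 < k n)%N.
Hypothesis l_gt0 : forall n, (0 < l n)%N.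
Local Notation ridx := (ridx k l).
Local Notation expo := (expo k l).

Lemma expoD (e f : expo) r : (e + f) r = (e r : rat) + f r.
Proof. by rewrite ffunE. Qed.

Lemma expoN (e : expo) r : (- e) r = - (e r : rat).
Proof. by rewrite ffunE. Qed.

Lemma expoZ (a : rat) (e : expo) r : (a *: e) r = a * e r.
Proof. by rewrite ffunE. Qed.

Lemma expaE n i (r : ridx) : expa k l n i r = (rlab r == (n, i))%:R.
Proof. by rewrite ffunE. Qed.

Definition center_exp_at (n : 'Z_N) (h : int) (m : 'Z_N) (i : int) : rat :=
  if m == n then ((l n)%:R + i%:~R) / ((k n)%:R + (l n)%:R) - (h <= i)%R%:R
  else 0.

(** Exponent vector of the coordinate of the center at position [h]: that of
    u_n^h for [h > 0], and that of the inverse of v_n^{h-1} for [h <= 0]. Both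
    cases are given by the same formula, an affine function of the label minus
    a step at [h]. *)
Definition center_exp (n : 'Z_N) (h : int) : expo :=
  [ffun r => center_exp_at n h (rlab r).1 (rlab r).2].

Lemma sum_indicator (f : nat -> rat) (a b c : nat) (P : nat -> bool) :
  (forall j, P j = (j == c)) ->
  \sum_(a <= j < b) f j * (P j)%:R = if (a <= c < b)%N then f c else 0.
Proof.
move=> hP; under eq_bigr do rewrite hP.
case: ifP => [cab|cab].
  rewrite (bigD1_seq c) ?mem_index_iota ?iota_uniq //= eqxx mulr1 big1 ?addr0 //.
  by move=> j /negPf ->; rewrite mulr0.
rewrite big_nat big1 // => j jab.
by case: eqP => [e|_]; [rewrite -e jab in cab | rewrite mulr0].
Qed.

Lemma sum_indicator0 (f : nat -> rat) (a b : nat) (P : nat -> bool) :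
  (forall j, (a <= j < b)%N -> P j = false) ->
  \sum_(a <= j < b) f j * (P j)%:R = 0.
Proof.
move=> hP; rewrite big_nat big1 // => j /hP ->; exact: mulr0.
Qed.

Lemma sum_expaE (f : nat -> rat) (g : nat -> int) (a b : nat) n (r : ridx) :
  (\sum_(a <= j < b) f j *: expa k l n (g j)) r =
  \sum_(a <= j < b) f j * (rlab r == (n, g j))%:R.
Proof. by rewrite sum_ffunE; apply: eq_bigr => j _; rewrite !ffunE. Qed.

Lemma sum_expaE1 (g : nat -> int) (a b : nat) n (r : ridx) :
  (\sum_(a <= j < b) expa k l n (g j)) r =
  \sum_(a <= j < b) 1 * (rlab r == (n, g j))%:R :> rat.
Proof. by rewrite sum_ffunE; apply: eq_bigr => j _; rewrite !ffunE mul1r. Qed.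

Lemma expu1E n (r : ridx) : expu1 k l n r =
  (l n)%:R / ((k n)%:R + (l n)%:R) * ((rlab r == (n, 0))%:R +
    \sum_(1 <= j < l n) (1 - j%:R / (l n)%:R) * (rlab r == (n, - j%:Z))%:R)
  - (k n)%:R / ((k n)%:R + (l n)%:R) *
    \sum_(1 <= i < k n) (1 - i%:R / (k n)%:R) * (rlab r == (n, i%:Z))%:R.
Proof. by rewrite /expu1 !(expoD, expoN, expoZ, sum_expaE, expaE). Qed.

Lemma expv1E n (r : ridx) : expv1 k l n r =
  (k n)%:R / ((k n)%:R + (l n)%:R) * ((rlab r == (n, 0))%:R +
    \sum_(1 <= j < k n) (1 - j%:R / (k n)%:R) * (rlab r == (n, j%:Z))%:R)
  - (l n)%:R / ((k n)%:R + (l n)%:R) *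
    \sum_(1 <= i < l n) (1 - i%:R / (l n)%:R) * (rlab r == (n, - i%:Z))%:R.
Proof. by rewrite /expv1 !(expoD, expoN, expoZ, sum_expaE, expaE). Qed.

Lemma sum_pos_lab (f : nat -> rat) b n (r : ridx) :
  \sum_(1 <= j < b) f j * (rlab r == (n, j%:Z))%:R =
  if ((rlab r).1 == n) && (0 < (rlab r).2 < b%:Z) then f `|(rlab r).2|%N else 0.
Proof.
case: (rlab r) => m i /=; have [mn|mn] /= := eqVneq m n; last first.
  by apply: sum_indicator0 => j _; rewrite xpair_eqE (negPf mn).
have [i0|i0] := ltrP 0 i; last first.
  by apply: sum_indicator0 => j jr; rewrite xpair_eqE mn; apply/andP => -[_ /eqP]; lia.
rewrite (@sum_indicator _ _ _ `|i|%N) => [|j].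
  by congr (if _ then _ else _); lia.
by rewrite xpair_eqE mn eqxx /=; apply/eqP/eqP; lia.
Qed.

Lemma sum_neg_lab (f : nat -> rat) b n (r : ridx) :
  \sum_(1 <= j < b) f j * (rlab r == (n, - j%:Z))%:R =
  if ((rlab r).1 == n) && (- b%:Z < (rlab r).2 < 0) then f `|(rlab r).2|%N else 0.
Proof.
case: (rlab r) => m i /=; have [mn|mn] /= := eqVneq m n; last first.
  by apply: sum_indicator0 => j _; rewrite xpair_eqE (negPf mn).
have [i0|i0] := ltrP i 0; last first.
  rewrite andbF; apply: sum_indicator0 => j jr.
  by rewrite xpair_eqE mn; apply/andP => -[_ /eqP]; lia.
rewrite (@sum_indicator _ _ _ `|i|%N) => [|j].
  by congr (if _ then _ else _); lia.
by rewrite xpair_eqE mn eqxx /=; apply/eqP/eqP; lia.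
Qed.

Let kl_neq0 n : (k n)%:R + (l n)%:R != 0 :> rat.
Proof. by rewrite -natrD pnatr_eq0 addn_eq0 negb_and -lt0n k_gt0. Qed.

Let k_neq0 n : (k n)%:R != 0 :> rat.
Proof. by rewrite pnatr_eq0 -lt0n. Qed.

Let l_neq0 n : (l n)%:R != 0 :> rat.
Proof. by rewrite pnatr_eq0 -lt0n. Qed.

Lemma expu1_center_exp n : expu1 k l n = center_exp n 1.
Proof.
apply/ffunP => r; rewrite expu1E sum_pos_lab sum_neg_lab ffunE /center_exp_at.
have := rlab_range k_gt0 l_gt0 r; case: (rlab r) => m i /=.
rewrite xpair_eqE; have [->|mn] /= := eqVneq m n; last first.
  by rewrite addr0 !mulr0 subr0.
have kl0 := kl_neq0 n; have k0 := k_neq0 n; have l0 := l_neq0 n.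
move=> /andP[il ik]; rewrite il ik andbT /=.
have [i0|i0|i0] := ltrgtP i 0.
- have -> : (1 <= i) = false by lia.
    rewrite natr_absz ltr0_norm // mulrNz ?mulr0n ?mulr1n; field.
  by rewrite ?kl0 ?k0 ?l0.
- have -> : (1 <= i) by lia.
  rewrite natr_absz gtr0_norm // ?mulr0n ?mulr1n; field.
  by rewrite ?kl0 ?k0 ?l0.
- by rewrite i0 /= ?mulr0n ?mulr1n; field; rewrite ?kl0 ?k0 ?l0.
Qed.

Lemma expv1_center_exp n : expv1 k l n = - center_exp n 0.
Proof.
apply/ffunP => r; rewrite expv1E sum_pos_lab sum_neg_lab expoN ffunE /center_exp_at.
have := rlab_range k_gt0 l_gt0 r; case: (rlab r) => m i /=.
rewrite xpair_eqE; have [->|mn] /= := eqVneq m n; last first.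
  by rewrite addr0 !mulr0 subr0 oppr0.
have kl0 := kl_neq0 n; have k0 := k_neq0 n; have l0 := l_neq0 n.
move=> /andP[il ik]; rewrite il ik andbT /=.
have [i0|i0|i0] := ltrgtP i 0.
-   rewrite natr_absz ltr0_norm // mulrNz ?mulr0n ?mulr1n; field.
  by rewrite ?kl0 ?k0 ?l0.
- rewrite natr_absz gtr0_norm // ?mulr0n ?mulr1n; field.
  by rewrite ?kl0 ?k0 ?l0.
- by rewrite i0 /= ?mulr0n ?mulr1n; field; rewrite ?kl0 ?k0 ?l0.
Qed.

Lemma expuE n h : (0 < h)%N -> expu k l n h = center_exp n h%:Z.
Proof.
move=> h0; apply/ffunP => r; rewrite /expu expoD expu1_center_exp sum_expaE1 sum_pos_lab.
rewrite !ffunE /center_exp_at; case: (rlab r) => m i /=.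
have [mn|mn] /= := eqVneq m n; last by rewrite addr0.
have [h1|h1] := boolP (0 < i < h%:Z).
  have -> : (1 <= i) by lia.
  have -> : (h%:Z <= i) = false by lia.
  by rewrite subrK subr0.
by rewrite addr0; congr (_ - _%:R); lia.
Qed.

Lemma expvE n j : (0 < j)%N -> expv k l n j = - center_exp n (1 - j%:Z).
Proof.
move=> h0; apply/ffunP => r; rewrite /expv expoD expv1_center_exp sum_expaE1 sum_neg_lab.
rewrite !expoN !ffunE /center_exp_at; case: (rlab r) => m i /=.
have [mn|mn] /= := eqVneq m n; last by rewrite addr0.
have [h1|h1] := boolP (- j%:Z < i < 0).
  have -> : (0 <= i) = false by lia.
  have -> : (1 - j%:Z <= i) by lia.
  by rewrite subr0 opprB addrC.
by rewrite addr0; congr (- (_ - _%:R)); lia.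
Qed.

(** Action of a simple reflection on the exponents of monomials
    ([reflK_mono]). *)
Definition refl_exp (r : ridx) (e : expo) : expo :=
  [ffun q => if q == r then - (e r : rat) + \sum_(q' | adjacent r q') (e q' : rat)
             else (e q : rat)].

Hypothesis N_ge3 : (3 <= N)%N.

(** On its own factor the reflection adds a second difference. That of an
    affine function is zero, hence only the step counts, and the exponents of
    the centers are permuted. The formula gives 0 at the labels -l_n and k_n,
    just out of range, so that the ends of the chain need no correction. *)
Lemma refl_exp_center_exp (r : ridx) m h : 1 - (l m)%:Z <= h <= (k m)%:Z ->
  refl_exp r (center_exp m h) = let: (n, i) := rlab r in
    if m == n then
      (if h == i then center_exp m (i + 1)
       else if h == i + 1 then center_exp m i else center_exp m h)
    else center_exp m h + ((i == 0) && ((n == m + 1) || (n == m - 1)))%:R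
      *: (center_exp_at m h m 0 *: expa k l n i).
Proof.
move=> hr; case er: (rlab r) => [n i].
pose g m' j := if - (l m')%:Z < j < (k m')%:Z then center_exp_at m h m' j else 0.
have gE q : center_exp m h q = g (rlab q).1 (rlab q).2.
  by rewrite ffunE /g rlab_range.
have g0 m' j : ~~ (- (l m')%:Z < j < (k m')%:Z) -> g m' j = 0.
  by rewrite /g => /negPf ->.
have gm j : - (l m)%:Z <= j <= (k m)%:Z -> g m j = center_exp_at m h m j.
  move=> jr; rewrite /g; case: ifP => // jr'; rewrite /center_exp_at eqxx.
  have [->|->] : j = (k m)%:Z \/ j = - (l m)%:Z by lia.
    have -> : (h <= (k m)%:Z) by lia.
    by rewrite -pmulrn [(l m)%:R + _]addrC divff ?subrr.
  have -> : (h <= - (l m)%:Z) = false by lia.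
  by rewrite mulrNz -pmulrn subrr mul0r subr0.
have gm0 m' j : (m' == m) = false -> g m' j = 0.
  by rewrite /g /center_exp_at => ->; case: ifP.
have ir := rlab_range k_gt0 l_gt0 r; rewrite er /= in ir.
apply/ffunP => q; rewrite ffunE; have [->|qr] := eqVneq q r.
  rewrite (eq_bigr _ (fun q _ => gE q)) (sum_adjacent N_ge3 er g0) gE er /=.
  have [mn|mn] := eqVneq m n.
    have n1 : (n + 1 == m) = false by rewrite mn ZN_succ_neq.
    have n2 : (n - 1 == m) = false by rewrite mn ZN_pred_neq.
    rewrite (gm0 _ 0 n1) (gm0 _ 0 n2) addr0 if_same addr0 -mn.
    have gi j : `|j - i| <= 1 -> g m j = center_exp_at m h m j.
      by move=> ji; apply: gm; rewrite mn; lia.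
    rewrite (gi i) ?(gi (i + 1)) ?(gi (i - 1)); [|lia..].
    have e h' : center_exp m h' r = center_exp_at m h' m i by rewrite ffunE er -mn.
    rewrite [RHS](_ : _ = center_exp_at m
      (if h == i then i + 1 else if h == i + 1 then i else h) m i);
      last by case: (h == i) => //; case: (h == i + 1).
    rewrite /center_exp_at eqxx !intrD.
    have -> : (h <= i + 1)%R%:R = (h <= i)%R%:R + (h == i + 1)%:R :> rat.
      by rewrite -natrD; congr _%:R; lia.
    have -> : (h <= i - 1)%R%:R = (h <= i)%R%:R - (h == i)%:R :> rat.
      by apply/eqP; rewrite eq_sym subr_eq -natrD; apply/eqP; congr _%:R; lia.
    have -> : ((if h == i then i + 1 else if h == i + 1 then i else h) <= i)%R%:R
       = (h <= i)%R%:R - (h == i)%:R + (h == i + 1)%:R :> rat.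
      apply/eqP; rewrite addrAC eq_sym subr_eq -!natrD; apply/eqP; congr _%:R.
      by case: (eqVneq h i) => // ?; case: (eqVneq h (i + 1)) => // ?; lia.
    have kl0 := kl_neq0 m; field.
    by rewrite kl0.
  have nm : (n == m) = false by rewrite eq_sym (negPf mn).
  rewrite expoD !expoZ gE er /= !(gm0 n _ nm) oppr0 !add0r expaE er eqxx mulr1.
  case: eqP => i0 /=; last by rewrite mul0r.
  rewrite [n == m + 1]eq_sym [n == m - 1]eq_sym.
  have -> : (m + 1 == n) = (n - 1 == m) by rewrite subr_eq eq_sym.
  have -> : (m - 1 == n) = (n + 1 == m) by rewrite subr_eq eq_sym.
  have m0 : g m 0 = center_exp_at m h m 0 by apply: gm; have := k_gt0 m; have := l_gt0 m; lia.
  have [e1|e1] := eqVneq (n + 1) m.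
    have e2 : (n - 1 == m) = false by rewrite -e1 (ZN_pred_succ N_ge3).
    by rewrite e2 e1 m0 (gm0 _ _ e2) addr0 mul1r.
  rewrite (gm0 _ _ (negPf e1)) add0r; have [e2|e2] := eqVneq (n - 1) m.
    by rewrite e2 m0 mul1r.
  by rewrite (gm0 _ _ (negPf e2)) mul0r.
have rq : rlab q != (n, i) by rewrite -er (inj_eq (@rlab_inj _ _ _)).
have [mn|mn] := eqVneq m n; last first.
  by rewrite expoD !expoZ expaE (negPf rq) !mulr0 addr0.
case eq: (rlab q) => [n' j]; rewrite eq /= in rq.
rewrite !(fun_if (fun e : expo => e q)) !ffunE eq /= /center_exp_at.
case: (eqVneq n' m) => [nn|_]; last by case: (h == i) => //; case: (h == i + 1).
have ji : j != i by apply: contraNneq rq => ->; rewrite nn mn.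
by case: eqP => [->|_]; [|case: eqP => [->|_]] => //; congr (_ - _%:R); lia.
Qed.

End Exponents.

(** * Laurent polynomials in the root variables *)

Section Monomials.

Variables (R : realType) (N : nat) (k l : 'Z_N -> nat) (p : nat).
Hypothesis p_gt0 : (0 < p)%N.
Local Notation ridx := (ridx k l).
Local Notation expo := (expo k l).
Local Notation K := (K R k l).
Local Notation in_K := (@in_K N k l p).
Local Notation mono := (@mono R N k l p).
Implicit Types (e f : expo) (r q : ridx).

Lemma in_KD e f : in_K e -> in_K f -> in_K (e + f).
Proof. by move=> he hf r; rewrite expoD mulrDr rpredD. Qed.

Lemma in_KN e : in_K e -> in_K (- e).
Proof. by move=> he r; rewrite expoN mulrN rpredN. Qed.

Lemma in_KB e f : in_K e -> in_K f -> in_K (e - f).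
Proof. by move=> he hf; apply: in_KD => //; apply: in_KN. Qed.

Lemma in_K_int e : (forall r, (e r : rat) \is a Num.int) -> in_K e.
Proof. by move=> he r; rewrite rpredM // rpred_nat. Qed.

Lemma in_K0 : in_K 0.
Proof. by apply: in_K_int => r; rewrite ffunE rpred0. Qed.

Lemma in_K_refl_exp r e : in_K e -> in_K (refl_exp r e).
Proof.
move=> he q; rewrite ffunE; case: eqP => // _.
rewrite mulrDr mulrN mulr_sumr rpredD ?rpredN //.
by apply: rpred_sum => q' _.
Qed.

Definition zex (e : expo) (r : ridx) : int := Num.floor (p%:R * (e r : rat)).

Lemma zexE e r : in_K e -> (zex e r)%:~R = p%:R * (e r : rat).
Proof. by move=> he; apply/eqP; rewrite -intrEfloor. Qed.

Lemma zex_eq e r z : in_K e -> z%:~R = p%:R * (e r : rat) -> zex e r = z.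
Proof. by move=> he ez; apply: (@intr_inj rat); rewrite zexE. Qed.

Lemma root_a_neq0 r : root_a R r != 0.
Proof. by rewrite /root_a tofrac_eq0 -msupp_eq0 msuppX. Qed.

Lemma monoE e : mono e = \prod_r root_a R r ^ zex e r.
Proof. by []. Qed.

Lemma mono_neq0 e : mono e != 0.
Proof. by rewrite prodf_seq_neq0; apply/allP => r _; rewrite expfz_neq0 ?root_a_neq0. Qed.

Lemma monoD e f : in_K e -> in_K f -> mono (e + f) = mono e * mono f.
Proof.
move=> he hf; rewrite !monoE -big_split; apply: eq_bigr => r _ /=.
rewrite -expfzDr ?root_a_neq0 //; congr (_ ^ _).
apply: zex_eq; first exact: in_KD.
by rewrite intrD !zexE // -mulrDr expoD.
Qed.

Lemma mono0 : mono 0 = 1.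
Proof.
rewrite monoE big1 // => r _.
by rewrite (_ : zex 0 r = 0) ?expr0z //; apply: zex_eq; [exact: in_K0|rewrite ffunE mulr0].
Qed.

Lemma monoN e : in_K e -> mono (- e) = (mono e)^-1.
Proof.
move=> he; apply: (mulIf (mono_neq0 e)); rewrite mulVf ?mono_neq0 //.
by rewrite -monoD ?addNr ?mono0 //; apply: in_KN.
Qed.

Definition cK (c : R[i]) : K := FracField.tofrac (c%:MP : {mpoly R[i][#|ridx|]}).

HB.instance Definition _ := GRing.RMorphism.copy cK
  (@FracField.tofrac {mpoly R[i][#|ridx|]} \o @mpolyC #|ridx| R[i]).

Definition qK (c : rat) : K := cK (ratr c).

HB.instance Definition _ := GRing.RMorphism.copy qK (cK \o (ratr : rat -> R[i])).

Lemma root_aE r : root_a R r = FracField.tofrac (pvar R[i] r).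
Proof. by rewrite pvarE. Qed.

(** A sum of Laurent monomials that vanishes becomes a polynomial identity
    after multiplication by a high power of all the variables; the conclusion
    is the value of this identity, and of its first derivatives, at the point
    where all variables are 1. *)
Lemma laurent_indep (s : seq (rat * expo)) :
  (forall t, t \in s -> in_K t.2) ->
  \sum_(t <- s) qK t.1 * mono t.2 = 0 ->
  \sum_(t <- s) t.1 = 0 /\ \sum_(t <- s) t.1 *: t.2 = 0.
Proof.
move=> hs s0.
pose M := (\sum_(t <- s) \sum_r `|zex t.2 r|)%N.
have zM t r : t \in s -> 0 <= zex t.2 r + M%:Z.
  move=> ts; have : (`|zex t.2 r| <= M)%N; last by lia.
  rewrite /M (big_rem t) //=; apply: leq_trans (leq_addr _ _).
  by rewrite (bigD1 r) //= leq_addr.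
clearbody M.
(* Adding M to all exponents makes them nonnegative. *)
pose mon (t : rat * expo) : 'X_{1..#|ridx|} :=
  [multinom `|(zex t.2 (enum_val i) + M%:Z)%R|%N | i < #|ridx|].
have monX t : t \in s ->
    tofrac ('X_[mon t] : {mpoly R[i][#|ridx|]}) = mono t.2 * \prod_(r : ridx) root_a R r ^+ M.
  move=> ts; rewrite pvar_mon rmorph_prod monoE -big_split; apply: eq_bigr => r _ /=.
  rewrite rmorphXn /= -root_aE mnmE enum_rankK !exprnP -expfzDr ?root_a_neq0 //.
  by rewrite gez0_abs // zM.
pose P : {mpoly R[i][#|ridx|]} := \sum_(t <- s) (ratr t.1 : R[i]) *: 'X_[mon t].
have P0 : P = 0.
  apply/eqP; rewrite -tofrac_eq0 rmorph_sum /=.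
  rewrite -[X in X == 0](_ : (\sum_(t <- s) qK t.1 * mono t.2) *
    \prod_(r : ridx) root_a R r ^+ M = _).
    by rewrite s0 mul0r.
  rewrite mulr_suml big_seq [RHS]big_seq; apply: eq_bigr => t ts.
  by rewrite -mulrA -monX // -mul_mpolyC rmorphM.
have c0 : \sum_(t <- s) t.1 = 0.
  apply: (fmorph_inj (ratr : {rmorphism rat -> R[i]})); rewrite rmorph0 rmorph_sum /=.
  have := congr1 (meval (fun=> 1)) P0; rewrite meval0 /P raddf_sum /= => h; rewrite -[RHS]h.
  apply: eq_bigr => t _; rewrite mevalZ mevalX big1 ?mulr1 // => i _.
  by rewrite expr1n.
split=> //; apply/ffunP => r; rewrite sum_ffunE ffunE.
have p0 : p%:R != 0 :> rat by rewrite pnatr_eq0 -lt0n.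
apply: (mulfI p0); rewrite mulr0 mulr_sumr.
have d0 : \sum_(t <- s) t.1 * (zex t.2 r + M%:Z)%:~R = 0.
  apply: (fmorph_inj (ratr : {rmorphism rat -> R[i]})); rewrite rmorph0 rmorph_sum /=.
  have := congr1 (fun Q => meval (fun=> 1) (mderiv (enum_rank r) Q)) P0.
  rewrite mderiv0 meval0 /P (raddf_sum (mderiv (enum_rank r))) raddf_sum => h; rewrite -[RHS]h.
  rewrite big_seq [RHS]big_seq; apply: eq_bigr => t ts.
  rewrite /= mderivZ mderivX !mevalZ mevalX big1 ?mulr1 => [|i _]; last by rewrite expr1n.
  rewrite rmorphM; congr (_ * _); rewrite mnmE enum_rankK.
  rewrite -(ratr_nat R[i]) natr_absz ger0_norm ?zM //.
rewrite -[RHS]d0; apply/esym.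
under eq_bigr do rewrite intrD mulrDr.
rewrite big_split /= -mulr_suml c0 mul0r addr0 big_seq [RHS]big_seq.
apply: eq_bigr => t ts; rewrite (zexE _ (hs _ ts)) expoZ.
by rewrite mulrCA.
Qed.

(** [x] is a Laurent polynomial with rational coefficients, [w] is its value
    and [nu] its gradient, in the logarithms of the root variables, at the
    point where all these variables are equal to 1. *)
Definition jet (x : K) (w : rat) (nu : expo) : Prop := exists s : seq (rat * expo),
  [/\ forall t, t \in s -> in_K t.2, x = \sum_(t <- s) qK t.1 * mono t.2,
      w = \sum_(t <- s) t.1 & nu = \sum_(t <- s) t.1 *: t.2].

(** The value and the gradient do not depend on the expansion. *)
Lemma jet_inj x w nu w' nu' : jet x w nu -> jet x w' nu' -> w = w' /\ nu = nu'.
Proof.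
move=> [s [hs es -> ->]] [s' [hs' es' -> ->]].
pose opp (t : rat * expo) := (- t.1, t.2).
have [] := @laurent_indep (s ++ map opp s').
- move=> t; rewrite mem_cat => /orP[/hs //|/mapP[u /hs' hu ->]]; exact: hu.
- rewrite big_cat big_map /= -es; apply/eqP; rewrite addr_eq0 es' -sumrN; apply/eqP.
  by apply: eq_bigr => t _; rewrite (rmorphN qK) mulNr opprK.
rewrite !big_cat !big_map /= => /eqP + /eqP; rewrite !addr_eq0 -!sumrN => /eqP -> /eqP ->.
by split; apply: eq_bigr => t _; rewrite ?opprK // scaleNr opprK.
Qed.

Lemma jetD x w nu x' w' nu' : jet x w nu -> jet x' w' nu' ->
  jet (x + x') (w + w') (nu + nu').
Proof.
move=> [s [hs -> -> ->]] [s' [hs' -> -> ->]]; exists (s ++ s'); rewrite !big_cat.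
by split=> // t; rewrite mem_cat => /orP[/hs|/hs'].
Qed.

Lemma jet_mono (c : rat) e : in_K e -> jet (qK c * mono e) c (c *: e).
Proof.
by move=> he; exists [:: (c, e)]; rewrite !big_seq1; split=> // t; rewrite inE => /eqP ->.
Qed.

Lemma jet0 : jet 0 0 0.
Proof. by exists [::]; rewrite !big_nil. Qed.

Lemma jetM_mono c e x w nu : in_K e -> jet x w nu ->
  jet (qK c * mono e * x) (c * w) (c *: nu + (c * w) *: e).
Proof.
move=> he [s [hs -> -> ->]]; exists [seq (c * t.1, e + t.2) | t <- s].
rewrite !big_map; split.
- by move=> t /mapP[u /hs hu ->]; apply: in_KD.
- rewrite mulr_sumr big_seq [RHS]big_seq; apply: eq_bigr => t /hs ht /=.
  by rewrite rmorphM monoD // mulrACA.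
- by rewrite mulr_sumr.
- rewrite scaler_sumr mulr_sumr scaler_suml -big_split; apply: eq_bigr => t _ /=.
  by rewrite scalerDr scalerA addrC.
Qed.

Lemma jetM x w nu x' w' nu' : jet x w nu -> jet x' w' nu' ->
  jet (x * x') (w * w') (w' *: nu + w *: nu').
Proof.
move=> [s [hs -> -> ->]] h'; elim: s hs => [|t s IH] hs.
  by rewrite !big_nil !mul0r scaler0 scale0r addr0; apply: jet0.
rewrite !big_cons !mulrDl.
have -> : w' *: (t.1 *: t.2 + \sum_(j <- s) j.1 *: j.2) +
    (t.1 + \sum_(j <- s) j.1) *: nu' =
   (t.1 *: nu' + (t.1 * w') *: t.2) +
   (w' *: (\sum_(j <- s) j.1 *: j.2) + (\sum_(j <- s) j.1) *: nu').
  rewrite scalerDr scalerDl scalerA [w' * _]mulrC [t.1 *: nu' + _]addrC.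
  by rewrite -!addrA; congr (_ + _); rewrite addrCA.
apply: jetD; first by apply: jetM_mono => //; apply: hs; rewrite mem_head.
by apply: IH => u us; apply: hs; rewrite in_cons us orbT.
Qed.

Lemma jet1 : jet 1 1 0.
Proof. by have := jet_mono 1 in_K0; rewrite rmorph1 mono0 mul1r scaler0. Qed.

Lemma jet_pow0 x w m : jet x w 0 -> jet (x ^+ m) (w ^+ m) 0.
Proof.
move=> h; elim: m => [|m IH]; first exact: jet1.
by rewrite !exprS; have := jetM h IH; rewrite !scaler0 addr0.
Qed.

Lemma jetM0 x w x' w' : jet x w 0 -> jet x' w' 0 -> jet (x * x') (w * w') 0.
Proof. by move=> h h'; have := jetM h h'; rewrite !scaler0 addr0. Qed.

Lemma monomial_inj e f : in_K e -> in_K f -> mono e = mono f -> e = f.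
Proof.
move=> he hf ef; have := jet_mono 1 he; have := jet_mono 1 hf.
by rewrite ef => h1 h2; have [_] := jet_inj h1 h2; rewrite !scale1r.
Qed.

End Monomials.

(** * Action of a reflection on the coefficients *)

Lemma prod_expz (F : fieldType) (I : Type) (x : F) (s : seq I) (g : I -> int) :
  x != 0 -> \prod_(i <- s) x ^ g i = x ^ (\sum_(i <- s) g i).
Proof.
move=> x0; elim: s => [|i s IH]; first by rewrite !big_nil expr0z.
by rewrite !big_cons IH -expfzDr.
Qed.

Lemma prod_twist (F : fieldType) (I : finType) (a : I -> F) (r : I)
  (c z : I -> int) : a r != 0 ->
  \prod_q (a q * a r ^ c q) ^ z q =
  \prod_q a q ^ (if q == r then z q + \sum_q' c q' * z q' else z q).
Proof.
move=> r0; under eq_bigr do rewrite expfzMl exprz_exp.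
rewrite big_split prod_expz //= (bigD1 r) //= [RHS](bigD1 r) //= eqxx.
rewrite mulrAC -expfzDr //; congr (_ * _).
by apply: eq_bigr => q /negPf ->.
Qed.

Section CoefficientReflection.

Variables (R : realType) (N : nat) (k l : 'Z_N -> nat) (p : nat).
Hypothesis p_gt0 : (0 < p)%N.
Hypothesis k_gt0 : forall n, (0 < k n)%N.
Hypothesis l_gt0 : forall n, (0 < l n)%N.
Local Notation ridx := (ridx k l).
Local Notation expo := (expo k l).
Local Notation K := (K R k l).
Local Notation in_K := (@in_K N k l p).
Local Notation mono := (@mono R N k l p).
Local Notation reflK := (@reflK R N k l).
Local Notation qK := (@qK R N k l).
Local Notation integral := (@integral_laurent R N k l p).
Implicit Types (e f : expo) (r q : ridx).

Definition reflP (r : ridx) : {mpoly R[i][#|ridx|]} -> K :=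
  psubst (@cK R N k l) (refl_a R r).

HB.instance Definition _ r :=
  GRing.RMorphism.copy (reflP r) (psubst (@cK R N k l) (refl_a R r)).

Lemma reflPC r c : reflP r c%:MP = @cK R N k l c.
Proof. by rewrite /reflP psubstC. Qed.

Lemma reflP_pvar r q : reflP r (pvar R[i] q) = refl_a R r q.
Proof. by rewrite /reflP psubstX. Qed.

Lemma reflKE r x : reflK r x = subst_frac (reflP r) x.
Proof. by rewrite /reflP /subst_frac !psubstE. Qed.

Lemma reflP_inv r a : inv_at (reflP r) a.
Proof.
elim/mpoly_ring_ind: a => [c|i|a b|a b]; last 2 first.
- exact: inv_atD.
- exact: inv_atM.
- by apply: (@inv_at_poly _ _ _ c%:MP); rewrite /= reflPC.
rewrite pvar_ord; move: (enum_val i) => q.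
have er : reflP r (pvar R[i] r) = (root_a R r)^-1.
  by rewrite reflP_pvar /refl_a eqxx.
have [->|qr] := eqVneq q r.
  exists 1, (pvar R[i] r); split.
  - by rewrite /= er -root_aE rmorph1; exact: mulVf (root_a_neq0 R r).
  - by rewrite /= er invr_eq0 root_a_neq0.
  - by rewrite /= er -root_aE rmorph1; exact/esym/divff/root_a_neq0.
case aq: (adjacent r q).
  apply: (@inv_at_poly _ _ _ (pvar R[i] r * pvar R[i] q)).
    by rewrite /= reflP_pvar /refl_a (negPf qr) aq rmorphM /= -!root_aE.
  rewrite rmorphM /= er reflP_pvar /refl_a (negPf qr) aq mulKf ?root_a_neq0 //.
  by rewrite root_aE.
by apply: (@inv_at_poly _ _ _ (pvar R[i] q));
  rewrite /= reflP_pvar /refl_a (negPf qr) aq root_aE.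
Qed.

Fact reflK_zmod r : zmod_morphism (reflK r).
Proof. by move=> x y; rewrite !reflKE (subst_frac_zmod (reflP_inv r)). Qed.

Fact reflK_monoid r : monoid_morphism (reflK r).
Proof.
have [h1 h2] := subst_frac_monoid (reflP_inv r).
split=> [|x y]; first by rewrite reflKE; exact: h1.
by rewrite !reflKE; exact: h2.
Qed.

HB.instance Definition _ r :=
  GRing.isZmodMorphism.Build K K (reflK r) (reflK_zmod r).
HB.instance Definition _ r :=
  GRing.isMonoidMorphism.Build K K (reflK r) (reflK_monoid r).

Lemma reflKK r : involutive (reflK r).
Proof. by move=> x; rewrite !reflKE (subst_fracK (reflP_inv r)). Qed.

Lemma reflK_cK r c : reflK r (@cK R N k l c) = @cK R N k l c.
Proof. by rewrite reflKE (subst_frac_tofrac (reflP_inv r)) /= reflPC. Qed.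

Lemma reflK_qK r c : reflK r (qK c) = qK c.
Proof. exact: reflK_cK. Qed.

Lemma reflK_root r q : reflK r (root_a R q) = refl_a R r q.
Proof.
by rewrite reflKE root_aE (subst_frac_tofrac (reflP_inv r)) /= reflP_pvar.
Qed.

Lemma refl_aE r q : refl_a R r q = root_a R q *
  root_a R r ^ (if q == r then - 2 else (adjacent r q)%:Z).
Proof.
have r0 := root_a_neq0 R r.
rewrite /refl_a; case: eqP => [->|_].
  by rewrite -[X in X * _]expr1z -expfzDr // -exprN1.
by case: (adjacent r q); rewrite ?expr1z ?expr0z ?mulr1 // mulrC.
Qed.

(** The substitution multiplies the variables adjacent to [r] by that of [r],
    which it inverts; on exponents this is the transposed action. *)
Lemma reflK_mono r e : in_K e -> reflK r (mono e) = mono (refl_exp r e).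
Proof.
move=> he; transitivity (\prod_q (root_a R q *
    root_a R r ^ (if q == r then - 2 else (adjacent r q)%:Z)) ^ zex p e q).
  rewrite monoE rmorph_prod; apply: eq_bigr => q _.
  by rewrite /= fmorphXz /= reflK_root refl_aE.
rewrite (prod_twist _ _ (root_a_neq0 R r)) monoE.
apply: eq_bigr => q _; congr (_ ^ _); apply/esym/zex_eq; first exact: in_K_refl_exp.
rewrite ffunE; case: eqP => [->|_]; last by rewrite zexE.
rewrite (bigD1 r) //= eqxx !intrD intrM zexE // mulrDr mulrN.
rewrite addrA; congr (_ + _); first by rewrite mulNr; ring.
rewrite rmorph_sum mulr_sumr [RHS]big_mkcond [in RHS](bigD1 r) //= adjacent_irr add0r.
apply: eq_bigr => q' qr; rewrite (negPf qr) intrM zexE //.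
by case: (adjacent r q'); rewrite ?mul1r ?mul0r.
Qed.

Lemma refl_expE r e q : refl_exp r e q =
  (if q == r then - (e r : rat) + \sum_(q' | adjacent r q') (e q' : rat) else e q) :> rat.
Proof. by rewrite ffunE. Qed.

Lemma refl_exp_lin r e f (a b : rat) :
  refl_exp r (a *: e + b *: f) = a *: refl_exp r e + b *: refl_exp r f.
Proof.
apply/ffunP => q; rewrite expoD !expoZ !refl_expE; case: eqP => _; last by rewrite expoD !expoZ.
under eq_bigr do rewrite expoD !expoZ.
by rewrite expoD !expoZ big_split /= -!mulr_sumr; ring.
Qed.

Lemma refl_expD r e f : refl_exp r (e + f) = refl_exp r e + refl_exp r f.
Proof. by have := refl_exp_lin r e f 1 1; rewrite !scale1r. Qed.

Lemma refl_expZ r a e : refl_exp r (a *: e) = a *: refl_exp r e.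
Proof. by have := refl_exp_lin r e e a 0; rewrite !scale0r !addr0. Qed.

Lemma refl_exp0 r : refl_exp r 0 = 0.
Proof. by have := refl_expZ r 0 0; rewrite !scale0r. Qed.

Lemma refl_expN r e : refl_exp r (- e) = - refl_exp r e.
Proof. by have := refl_expZ r (-1) e; rewrite !scaleN1r. Qed.

(** The point where all variables are 1 is fixed by the reflections. *)
Lemma jet_refl r x w nu : jet p x w nu -> jet p (reflK r x) w (refl_exp r nu).
Proof.
move=> [s [hs -> -> ->]]; exists [seq (t.1, refl_exp r t.2) | t <- s].
rewrite !big_map; split=> //.
- by move=> t /mapP[u /hs hu ->]; apply: in_K_refl_exp.
- rewrite rmorph_sum big_seq [RHS]big_seq; apply: eq_bigr => t /hs ht.
  by rewrite rmorphM /= reflK_qK reflK_mono.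
- elim: s {hs} => [|t s IH]; first by rewrite !big_nil refl_exp0.
  by rewrite !big_cons refl_expD refl_expZ IH.
Qed.

Lemma integral_mono e : in_K e -> integral (mono e).
Proof.
move=> he; exists [:: (1, e)]; last by rewrite big_seq1 mul1r.
by move=> t; rewrite inE => /eqP ->.
Qed.

Lemma intlaurent0 : integral 0.
Proof. by exists [::] => //; rewrite big_nil. Qed.

Lemma integralD x y : integral x -> integral y -> integral (x + y).
Proof.
move=> [s hs ->] [s' hs' ->]; exists (s ++ s'); last by rewrite big_cat.
by move=> t; rewrite mem_cat => /orP[/hs|/hs'].
Qed.

Lemma integralN x : integral x -> integral (- x).
Proof.
move=> [s hs ->]; exists [seq (- t.1, t.2) | t <- s].
  by move=> t /mapP[u /hs hu ->].
by rewrite big_map -sumrN; apply: eq_bigr => t _; rewrite mulrNz mulNr.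
Qed.

Lemma integralM x y : integral x -> integral y -> integral (x * y).
Proof.
move=> [s hs ->] [s' hs' ->]; elim: s hs => [|t s IH] hs.
  by rewrite big_nil mul0r; apply: intlaurent0.
rewrite big_cons mulrDl; apply: integralD; last first.
  by apply: IH => u us; apply: hs; rewrite in_cons us orbT.
have ht : in_K t.2 by apply: hs; rewrite mem_head.
exists [seq (t.1 * u.1, t.2 + u.2) | u <- s'].
  by move=> u /mapP[v /hs' hv ->]; apply: in_KD.
rewrite big_map mulr_sumr big_seq [RHS]big_seq; apply: eq_bigr => u /hs' hu /=.
by rewrite monoD // intrM mulrACA.
Qed.

Lemma intlaurent1 : integral 1.
Proof. by rewrite -(mono0 R k l p); apply: integral_mono; apply: in_K0. Qed.

Lemma integral_refl r x : integral x -> integral (reflK r x).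
Proof.
move=> [s hs ->]; exists [seq (t.1, refl_exp r t.2) | t <- s].
  by move=> t /mapP[u /hs hu ->]; apply: in_K_refl_exp.
rewrite big_map rmorph_sum big_seq [RHS]big_seq; apply: eq_bigr => t /hs ht.
by rewrite rmorphM /= rmorph_int reflK_mono.
Qed.

Lemma integral_jet x : integral x -> exists (z : int) nu, jet p x z%:~R nu.
Proof.
move=> [s hs ->]; exists (\sum_(t <- s) t.1), (\sum_(t <- s) (t.1%:~R : rat) *: t.2).
exists [seq (t.1%:~R, t.2) | t <- s]; rewrite !big_map; split=> //.
- by move=> t /mapP[u /hs hu ->].
- by apply: eq_bigr => t _; rewrite rmorph_int.
- by rewrite rmorph_sum.
Qed.

End CoefficientReflection.

(** * Evaluation at the tau variables *)

Lemma div_splitl (F : fieldType) (a b e : F) : a != 0 -> b != 0 ->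
  e / a = b * ((a * b)^-1 * e * 1).
Proof. by move=> a0 b0; field; rewrite a0 b0. Qed.

Lemma div_splitr (F : fieldType) (a b e : F) : a != 0 -> b != 0 ->
  e / b = a * (1 * ((a * b)^-1 * e)).
Proof. by move=> a0 b0; field; rewrite a0 b0. Qed.

Lemma mulr11 (F : fieldType) (a : F) : a = a * (1 * 1).
Proof. by rewrite !mulr1. Qed.

Section TauSide.

Variables (N : nat) (k l : 'Z_N -> nat).
Hypothesis N_ge3 : (3 <= N)%N.
Hypothesis k_gt0 : forall n, (0 < k n)%N.
Variables (F : fieldType) (s : {rmorphism F -> F}).
Local Notation eidx := (eidx k l).
Local Notation T := {mpoly F[#|eidx|]}.
Local Notation Kz := (polyring N F).
Variables (LF : fieldType) (tf : {rmorphism T -> LF}).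
Hypothesis tf_inj : injective tf.
Implicit Types x y : eidx.

(** In this section [tf] is the embedding of polynomials in tau into a field,
    and [s] a reflection of the coefficients. *)
Definition embed_cst (c : F) : LF := tf c%:MP.

HB.instance Definition _ :=
  GRing.RMorphism.copy embed_cst (tf \o @mpolyC #|eidx| F).

Definition tau_var x : LF := tf (pvar F x).

Definition xiT (n : 'Z_N) : T := \prod_(x : eidx | (tag x == n) && (0 < chain_pos x)) pvar F x.
Definition etaT (n : 'Z_N) : T := \prod_(x : eidx | (tag x == n) && ~~ (0 < chain_pos x)) pvar F x.

Definition zetaT (z : zidx N) : T :=
  if z.2 then xiT (z.1 - 1) * etaT (z.1 + 1) else xiT (z.1 + 1) * etaT (z.1 - 1).

Definition evalT : Kz -> T := psubst (@mpolyC #|eidx| F) zetaT.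

HB.instance Definition _ := GRing.RMorphism.copy evalT (psubst (@mpolyC #|eidx| F) zetaT).

Definition eval_tau (P : Kz) : LF := tf (evalT P).

HB.instance Definition _ := GRing.RMorphism.copy eval_tau (tf \o evalT).

Lemma eval_tau_pvar z : eval_tau (pvar F z) = tf (zetaT z).
Proof. by rewrite /eval_tau /evalT psubstX. Qed.

Lemma eval_tauC c : eval_tau c%:MP = embed_cst c.
Proof. by rewrite /eval_tau /evalT psubstC. Qed.

Lemma eval_tauZ c P : eval_tau (c *: P) = embed_cst c * eval_tau P.
Proof. by rewrite -mul_mpolyC rmorphM /= eval_tauC. Qed.

Lemma tau_var_neq0 x : tau_var x != 0.
Proof. by rewrite -(rmorph0 tf) (inj_eq tf_inj) pvar_neq0. Qed.

Definition subst_tau (g : eidx -> LF) : T -> LF := psubst (embed_cst \o s) g.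

HB.instance Definition _ g := GRing.RMorphism.copy (subst_tau g) (psubst (embed_cst \o s) g).

Lemma subst_tau_pvar g x : subst_tau g (pvar F x) = g x.
Proof. by rewrite /subst_tau psubstX. Qed.

Lemma subst_tauC g c : subst_tau g c%:MP = embed_cst (s c).
Proof. by rewrite /subst_tau psubstC. Qed.

Lemma subst_tau_evalT g P : subst_tau g (evalT P) =
  psubst (embed_cst \o s) (fun z => subst_tau g (zetaT z)) P.
Proof.
pose f : {rmorphism Kz -> LF} := subst_tau g \o evalT.
rewrite -[LHS]/(f P); move: P; apply: psubst_uniq => [c|z]; rewrite /f /=.
  by rewrite /evalT psubstC subst_tauC.
by rewrite /evalT psubstX.
Qed.

Section Swap.

Variables x0 x1 : eidx.
Hypothesis x01_tag : tag x0 = tag x1.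
Hypothesis x01_pos : (0 < chain_pos x0) = (0 < chain_pos x1).

Definition tau_swap x : LF := tau_var (tperm x0 x1 x).

Lemma swap_prod (P : pred eidx) : P x0 = P x1 ->
  subst_tau tau_swap (\prod_(x | P x) pvar F x) = tf (\prod_(x | P x) pvar F x).
Proof.
move=> P01; rewrite !rmorph_prod /= [RHS](reindex_inj (@perm_inj _ (tperm x0 x1))) /=.
apply: eq_big => [x|x _]; last by rewrite subst_tau_pvar.
by case: tpermP => // ->.
Qed.

Lemma swap_zetaT z : subst_tau tau_swap (zetaT z) = tf (zetaT z).
Proof.
rewrite /zetaT /xiT /etaT; case: z.2; rewrite !rmorphM /= !swap_prod //;
  by rewrite x01_tag x01_pos.
Qed.

Definition map_coef : Kz -> Kz := psubst (@mpolyC #|zidx N| F \o s) (pvar F).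

HB.instance Definition _ :=
  GRing.RMorphism.copy map_coef (psubst (@mpolyC #|zidx N| F \o s) (pvar F)).

Lemma map_coef_pvar z : map_coef (pvar F z) = pvar F z.
Proof. by rewrite /map_coef psubstX. Qed.

Lemma map_coefC c : map_coef c%:MP = (s c)%:MP.
Proof. by rewrite /map_coef psubstC. Qed.

(** The variables zeta are symmetric in the tau variables of each sign. *)
Lemma swap_eval_tau P : subst_tau tau_swap (evalT P) = eval_tau (map_coef P).
Proof.
rewrite subst_tau_evalT.
pose f : {rmorphism Kz -> LF} := eval_tau \o map_coef.
rewrite -[RHS]/(f P); symmetry; move: P; apply: psubst_uniq => [c|z]; rewrite /f /=.
  by rewrite map_coefC eval_tauC.
by rewrite map_coef_pvar eval_tau_pvar swap_zetaT.
Qed.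

End Swap.

Section Mutate.

Variables (n : 'Z_N) (co : bool -> bool -> F).
Hypothesis co_neq0 : forall b i, co b i != 0.
Hypothesis s_co : forall b i, s (co b i) = co (~~ b) i.
Local Notation exch := (@exch N F n co).
Local Notation exch_factor := (@exch_factor N F n co).
Local Notation mut := (@mut N F s n co).

(** Specializing to 0 one factor of zeta_n^0 that does not occur in zeta_n^oo
    leaves one nonzero coefficient of the form. *)
Lemma evalT_exch_neq0 b : evalT (exch b) != 0.
Proof.
pose y := epos l (Ordinal (k_gt0 (n + 1))).
pose v (x : eidx) : F := (x != y)%:R.
apply: contra_neq (co_neq0 b true) => e0.
have prod1 (P : pred eidx) : ~~ P y ->
    psubst idfun v (\prod_(x | P x) pvar F x) = 1.
  move=> Py; rewrite rmorph_prod big1 //= => x Px.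
  by rewrite psubstX /v; case: eqP => // xy; rewrite xy (negPf Py) in Px.
have <- : psubst idfun v (evalT (exch b)) = co b true.
  rewrite /exch rmorphD -!mul_mpolyC !rmorphM /= /evalT !psubstC !psubstX /zetaT /=.
  rewrite rmorphD !rmorphM /= !psubstC.
  have -> : psubst idfun v (xiT (n + 1)) = 0.
    rewrite rmorph_prod (bigD1 y) /=; last by rewrite eqxx.
    by rewrite psubstX /v eqxx mul0r.
  rewrite mul0r mulr0 add0r !prod1 ?mulr1 //=.
    by rewrite andbF.
  by rewrite eq_sym (ZN_pred_succ N_ge3).
by rewrite e0 rmorph0.
Qed.

Lemma eval_tau_exch_neq0 b : eval_tau (exch b) != 0.
Proof. by rewrite /eval_tau -(rmorph0 tf) (inj_eq tf_inj) evalT_exch_neq0. Qed.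

Variables x0 x1 : eidx.
Hypotheses (x0_tag : tag x0 = n) (x1_tag : tag x1 = n).
Hypotheses (x0_pos : chain_pos x0 = 0) (x1_pos : chain_pos x1 = 1).

(** Images of the tau variables under the reflection at [(n, 0)]; [x0] and
    [x1] are the indices of tau_n^{-1} and of tau_n^1. *)
Definition tau_mut x : LF :=
  if x == x1 then eval_tau (exch true) / tau_var x0
  else if x == x0 then eval_tau (exch false) / tau_var x1 else tau_var x.

Definition mut_scale : LF := (tau_var x0 * tau_var x1)^-1.

Lemma x01_neq : x0 != x1.
Proof. by rewrite eidx_eq x0_pos x1_pos andbF. Qed.

Lemma tau_mutE x : tau_mut x = tau_var x *
  ((if x == x1 then mut_scale * eval_tau (exch true) else 1) *
   (if x == x0 then mut_scale * eval_tau (exch false) else 1)).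
Proof.
have h0 := tau_var_neq0 x0; have h1 := tau_var_neq0 x1; rewrite /tau_mut /mut_scale.
have x10 : (x1 == x0) = false by rewrite eq_sym (negPf x01_neq).
have [->|_] := eqVneq x x1; first by rewrite x10; exact: div_splitl.
have [->|_] := eqVneq x x0; [exact: div_splitr | exact: mulr11].
Qed.

Lemma tau_mut_xi m : subst_tau tau_mut (xiT m) =
  tf (xiT m) * (mut_scale * eval_tau (exch true)) ^+ (m == n).
Proof.
rewrite /xiT !rmorph_prod /=; under eq_bigr do rewrite subst_tau_pvar tau_mutE.
rewrite big_split; congr (_ * _); rewrite big_split /= [X in _ * X]big1 ?mulr1.
  have [->|mn] := eqVneq m n; last first.
    rewrite big1 // => x /andP[/eqP tx _]; case: eqP => // xx1.
    by rewrite -tx xx1 x1_tag eqxx in mn.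
  rewrite (bigD1 x1) /= ?x1_tag ?x1_pos ?eqxx // big1 ?mulr1 //.
  by move=> x /andP[_ /negPf ->].
move=> x /andP[_ px]; case: eqP => // xx0.
by rewrite xx0 x0_pos in px.
Qed.

Lemma tau_mut_eta m : subst_tau tau_mut (etaT m) =
  tf (etaT m) * (mut_scale * eval_tau (exch false)) ^+ (m == n).
Proof.
rewrite /etaT !rmorph_prod /=; under eq_bigr do rewrite subst_tau_pvar tau_mutE.
rewrite big_split; congr (_ * _); rewrite big_split /= [X in X * _]big1 ?mul1r.
  have [->|mn] := eqVneq m n; last first.
    rewrite big1 // => x /andP[/eqP tx _]; case: eqP => // xx0.
    by rewrite -tx xx0 x0_tag eqxx in mn.
  rewrite (bigD1 x0) /= ?x0_tag ?x0_pos ?eqxx // big1 ?mulr1 //.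
  by move=> x /andP[_ /negPf ->].
move=> x /andP[_ px]; case: eqP => // xx1.
by rewrite xx1 x1_pos in px.
Qed.

Lemma prod_pairs (S : comPzRingType) (a b q c d : S) i j :
  a * (q * c) ^+ i * (b * (q * d) ^+ j) =
  q ^+ i * (q ^+ j * (c ^+ i * d ^+ j * (a * b))).
Proof. by rewrite !exprMn; ring. Qed.

Lemma tau_mut_zetaT z : subst_tau tau_mut (zetaT z) =
  mut_scale ^+ (z.1 == n + 1) * (mut_scale ^+ (z.1 == n - 1) * eval_tau (exch_factor z * pvar F z)).
Proof.
have eS m : (m - 1 == n) = (m == n + 1) by rewrite ZN_eqS.
have eP m : (m + 1 == n) = (m == n - 1) by rewrite ZN_eqP.
have -> : eval_tau (exch_factor z * pvar F z) = eval_tau (exch z.2) ^+ (z.1 == n + 1) *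
    eval_tau (exch (~~ z.2)) ^+ (z.1 == n - 1) * tf (zetaT z).
  by rewrite exch_factorE !rmorphM !rmorphXn /= eval_tau_pvar.
rewrite /zetaT; case: z => m [] /=; rewrite !rmorphM /= tau_mut_xi tau_mut_eta eS eP.
  exact: prod_pairs.
rewrite prod_pairs mulrCA; congr (_ * (_ * _)); congr (_ * _); exact: mulrC.
Qed.

Hypothesis n_exch_factor : forall b, exch_factor (n, b) = 1.

Lemma tau_mut_exch b : subst_tau tau_mut (evalT (exch b)) = eval_tau (exch (~~ b)).
Proof.
rewrite subst_tau_evalT /exch !rmorphD -!mul_mpolyC !rmorphM /= !psubstC !psubstX /= !s_co.
rewrite !eval_tauC; congr (_ * _ + _ * _);
by rewrite tau_mut_zetaT n_exch_factor mul1r /= ![n == _]eq_sym (ZN_pred_neq n)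
  (ZN_succ_neq n) !mul1r.
Qed.

(** The exchange forms are exchanged by the reflection, which is thus an
    involution on tau_n^1 and tau_n^{-1}. *)
Lemma tau_mut_inv x : exists b c : T,
  [/\ subst_tau tau_mut (pvar F x) * tf c = tf b, subst_tau tau_mut c != 0 &
      subst_tau tau_mut b = tau_var x * subst_tau tau_mut c].
Proof.
have e1 : subst_tau tau_mut (pvar F x1) = eval_tau (exch true) / tau_var x0.
  by rewrite subst_tau_pvar /tau_mut eqxx.
have e0 : subst_tau tau_mut (pvar F x0) = eval_tau (exch false) / tau_var x1.
  by rewrite subst_tau_pvar /tau_mut (negPf x01_neq) eqxx.
have [->|h1] := eqVneq x x1.
  exists (evalT (exch true)), (pvar F x0); split.
  - rewrite e1; exact: (mulfVK (tau_var_neq0 x0)).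
  - by rewrite e0 mulf_neq0 ?invr_eq0 ?tau_var_neq0 ?eval_tau_exch_neq0.
  - by rewrite e0 tau_mut_exch mulrC (mulfVK (tau_var_neq0 x1)).
have [->|h0] := eqVneq x x0.
  exists (evalT (exch false)), (pvar F x1); split.
  - rewrite e0; exact: (mulfVK (tau_var_neq0 x1)).
  - by rewrite e1 mulf_neq0 ?invr_eq0 ?tau_var_neq0 ?eval_tau_exch_neq0.
  - by rewrite e1 tau_mut_exch mulrC (mulfVK (tau_var_neq0 x0)).
have e : subst_tau tau_mut (pvar F x) = tau_var x.
  by rewrite subst_tau_pvar /tau_mut (negPf h1) (negPf h0).
by exists (pvar F x), 1; rewrite !rmorph1 !mulr1 oner_neq0 e.
Qed.

(** [mut] models the reflection: the power of [mut_scale] is the contribution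
    of the denominators, one for each coordinate of a neighbouring factor. *)
Lemma mut_eval_tau d1 d2 P : factor_homog (n + 1) d1 P -> factor_homog (n - 1) d2 P ->
  subst_tau tau_mut (evalT P) = mut_scale ^+ (d1 + d2) * eval_tau (mut P).
Proof.
move=> h1 h2; rewrite subst_tau_evalT.
rewrite (psubst_eq _ _ tau_mut_zetaT) (psubst_scale _ _ _ h1) (psubst_scale _ _ _ h2).
rewrite mulrA -exprD; congr (_ * _).
pose f : {rmorphism Kz -> LF} := eval_tau \o mut.
rewrite -[RHS]/(f P); symmetry; move: P {h1 h2}; apply: psubst_uniq => [c|z]; rewrite /f /=.
  by rewrite mutC eval_tauC.
by rewrite mut_pvar.
Qed.

End Mutate.

End TauSide.

(** * The exchange coefficients *)

Section Instance.

Variables (R : realType) (N : nat) (k l : 'Z_N -> nat) (p : nat).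
Hypothesis N_ge3 : (3 <= N)%N.
Hypothesis k_gt0 : forall n, (0 < k n)%N.
Hypothesis l_gt0 : forall n, (0 < l n)%N.
Hypothesis p_suitable : suitable k l p.
Local Notation ridx := (ridx k l).
Local Notation eidx := (eidx k l).
Local Notation expo := (expo k l).
Local Notation K := (K R k l).
Local Notation in_K := (@in_K N k l p).
Local Notation mono := (@mono R N k l p).
Local Notation reflK := (@reflK R N k l).
Local Notation omega := (@omega N k l).
Local Notation center_exp := (@center_exp N k l).
Implicit Types (e f : expo) (r q : ridx) (x y : eidx).

Lemma p_gt0 : (0 < p)%N. Proof. by case: p_suitable. Qed.

Lemma in_K_center_exp n h : in_K (center_exp n h).
Proof.
case: p_suitable => _ /(_ n)[hu _] _; rewrite (expu1_center_exp k_gt0 l_gt0) in hu.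
rewrite -[center_exp n h](subrK (center_exp n 1)); apply: in_KD => //.
apply: in_K_int => r; rewrite expoD expoN !ffunE /center_exp_at.
case: eqP => _; last by rewrite subr0.
rewrite (_ : _ - _ = (1 <= (rlab r).2)%R%:R - (h <= (rlab r).2)%R%:R); last by ring.
by rewrite rpredB ?rpred_nat.
Qed.

Definition co_exp n (b i : bool) : expo :=
  if b then (if i then -1 + omega n else omega n) *: expv1 k l n
  else (if i then 1 - omega n else - omega n) *: expu1 k l n.

(** Coefficients of the exchange forms. *)
Definition co n b i : K := mono (co_exp n b i).

Lemma in_K_co_exp n b i : in_K (co_exp n b i).
Proof.
case: p_suitable => _ /(_ n)[hu hv] /(_ n)[hou hov]; rewrite /co_exp.
case: b; case: i.
- rewrite scalerDl scaleN1r addrC; exact: in_KB hov hv.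
- exact: hov.
- rewrite scalerBl scale1r; exact: in_KB hu hou.
- rewrite scaleNr; exact: in_KN hou.
Qed.

Lemma co_neq0 n b i : co n b i != 0.
Proof. exact: mono_neq0. Qed.

Lemma refl_exp_co_exp r n b i : rlab r = (n, 0) -> refl_exp r (co_exp n b i) = co_exp n (~~ b) i.
Proof.
move=> er; have kn := k_gt0 n; have ln := l_gt0 n.
have su : refl_exp r (expu1 k l n) = - expv1 k l n.
  rewrite (expu1_center_exp k_gt0 l_gt0) (expv1_center_exp k_gt0 l_gt0) opprK.
  by rewrite (refl_exp_center_exp k_gt0 l_gt0 N_ge3) ?er ?eqxx //; lia.
have sv : refl_exp r (expv1 k l n) = - expu1 k l n.
  rewrite (expu1_center_exp k_gt0 l_gt0) (expv1_center_exp k_gt0 l_gt0) refl_expN.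
  by rewrite (refl_exp_center_exp k_gt0 l_gt0 N_ge3) ?er ?eqxx //; lia.
rewrite /co_exp; move: (expu1 k l n) (expv1 k l n) su sv => u v su sv.
case: b; case: i; rewrite refl_expZ ?su ?sv scalerN -scaleNr //.
- by rewrite opprD opprK.
- by rewrite opprB addrC.
- by rewrite opprK.
Qed.

Lemma reflK_co r n b i : rlab r = (n, 0) -> reflK r (co n b i) = co n (~~ b) i.
Proof.
move=> er; rewrite /co (reflK_mono R r (in_K_co_exp n b i)).
by rewrite (refl_exp_co_exp _ _ er).
Qed.

Lemma exch_ratioE n b : exch_ratio (co n) b = mono (center_exp n (if b then 0 else 1)).
Proof.
have ce : co_exp n b true - co_exp n b false = center_exp n (if b then 0 else 1).
  rewrite /co_exp; case: b; rewrite -scalerBl.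
    rewrite (_ : _ - _ = -1); last by ring.
    by rewrite scaleN1r (expv1_center_exp k_gt0 l_gt0) opprK.
  rewrite (_ : _ - _ = 1); last by ring.
  by rewrite scale1r (expu1_center_exp k_gt0 l_gt0).
have ht := in_K_co_exp n b true; have hf := in_K_co_exp n b false.
by rewrite -ce (monoD R ht (in_KN hf)) (monoN R hf).
Qed.

Lemma center_exp_inj n h h' : 1 - (l n)%:Z <= h <= (k n)%:Z ->
  1 - (l n)%:Z <= h' <= (k n)%:Z -> center_exp n h = center_exp n h' -> h = h'.
Proof.
wlog lt : h h' / h < h' => [H hr hr' e|hr hr' e].
  by have [/H|/H|] := ltrgtP h h' => [hh|hh|//]; [exact: hh | apply/esym/hh].
have [|r er] := @rlab_surj N k l n h; first by lia.
have /(congr1 (fun f : rat => f)) := congr1 (fun f : expo => (f r : rat)) e.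
rewrite !ffunE er /center_exp_at eqxx lexx => /addrI /oppr_inj.
have -> : (h' <= h) = false by lia.
by move/eqP; rewrite oner_eq0.
Qed.

Lemma mono_center_exp_inj n h h' : 1 - (l n)%:Z <= h <= (k n)%:Z ->
  1 - (l n)%:Z <= h' <= (k n)%:Z -> mono (center_exp n h) = mono (center_exp n h') -> h = h'.
Proof.
move=> hr hr' /(monomial_inj p_gt0 (in_K_center_exp n h) (in_K_center_exp n h'));
  exact: center_exp_inj.
Qed.

Lemma exch_ratio_neq n : exch_ratio (co n) true != exch_ratio (co n) false.
Proof.
have kn := k_gt0 n; have ln := l_gt0 n.
rewrite !exch_ratioE; apply/eqP => e.
by have := mono_center_exp_inj (h := 0) (h' := 1) _ _ e; lia.
Qed.

Hypothesis kl_eq : forall n : 'Z_N,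
  (k (n - 1)%R * k (n + 1)%R = l (n - 1)%R * l (n + 1)%R)%N.

(** The relation between [k] and [l] says that the ratio of the two components
    of theta at [n] is also the ratio k : l at [n + 1], and the ratio l : k at
    [n - 1]. *)
Lemma omega_S n : omega n = (k (n + 1))%:R / ((k (n + 1))%:R + (l (n + 1))%:R).
Proof.
have := congr1 (fun m : nat => m%:R : rat) (kl_eq n); rewrite !natrM => e.
rewrite /Defs.omega /theta0 /thetaoo !natrD.
have := k_gt0 (n + 1); have := l_gt0 (n + 1); have := k_gt0 (n - 1); have := l_gt0 (n - 1).
rewrite -!(ltr0n rat); move: e; set a := (k (n - 1))%:R; set b := (k (n + 1))%:R.
set c := (l (n - 1))%:R; set d := (l (n + 1))%:R => e c0 a0 d0 b0.
apply/eqP; rewrite eqr_div; [|by apply: lt0r_neq0; lra..].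
by apply/eqP; lra.
Qed.

Lemma omega_P n : omega n = (l (n - 1))%:R / ((k (n - 1))%:R + (l (n - 1))%:R).
Proof.
have := congr1 (fun m : nat => m%:R : rat) (kl_eq n); rewrite !natrM => e.
rewrite /Defs.omega /theta0 /thetaoo !natrD.
have := k_gt0 (n + 1); have := l_gt0 (n + 1); have := k_gt0 (n - 1); have := l_gt0 (n - 1).
rewrite -!(ltr0n rat); move: e; set a := (k (n - 1))%:R; set b := (k (n + 1))%:R.
set c := (l (n - 1))%:R; set d := (l (n + 1))%:R => e c0 a0 d0 b0.
apply/eqP; rewrite eqr_div; [|by apply: lt0r_neq0; lra..].
by apply/eqP; lra.
Qed.

Definition pos_swap (i h : int) : int := if h == i then i + 1 else if h == i + 1 then i else h.

Lemma expuv n : expu1 k l n + expv1 k l n = expa k l n 0.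
Proof.
rewrite (expu1_center_exp k_gt0 l_gt0) (expv1_center_exp k_gt0 l_gt0); apply/ffunP => q.
rewrite expoD expoN expaE !ffunE /center_exp_at; case: (rlab q) => m j; rewrite xpair_eqE /=.
case: eqP => _ /=; last by rewrite oppr0 addr0.
rewrite (_ : _ - _ = (0 <= j)%R%:R - (1 <= j)%R%:R); last by ring.
by apply/eqP; rewrite subr_eq -natrD; apply/eqP; congr _%:R; lia.
Qed.

Lemma refl_exp_center_exp_same r n i h : rlab r = (n, i) ->
  1 - (l n)%:Z <= h <= (k n)%:Z -> refl_exp r (center_exp n h) = center_exp n (pos_swap i h).
Proof.
move=> er hr; rewrite (refl_exp_center_exp k_gt0 l_gt0 N_ge3) // er eqxx /pos_swap.
by case: (h == i) => //; case: (h == i + 1).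
Qed.

Lemma reflK_center_exp_same r n i h : rlab r = (n, i) ->
  1 - (l n)%:Z <= h <= (k n)%:Z ->
  reflK r (mono (center_exp n h)) = mono (center_exp n (pos_swap i h)).
Proof.
move=> er hr; rewrite (reflK_mono R r (in_K_center_exp n h)).
by rewrite (refl_exp_center_exp_same er).
Qed.

Lemma reflK_center_exp_other r n i m h : rlab r = (n, i) -> i != 0 -> m != n ->
  1 - (l m)%:Z <= h <= (k m)%:Z -> reflK r (mono (center_exp m h)) = mono (center_exp m h).
Proof.
move=> er i0 mn hr; rewrite (reflK_mono R r (in_K_center_exp m h)).
rewrite (refl_exp_center_exp k_gt0 l_gt0 N_ge3) // er (negPf mn) (negPf i0) /=.
by rewrite scale0r addr0.
Qed.

(** The reflection multiplies the coordinate of a center over a neighbouring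
    factor by a power of a_n^0, with exponent given by [k] and [l] there. It
    has to be the ratio of two exchange coefficients, which are powers of u_n
    and v_n with exponents given by omega_n; and a_n^0 = u_n v_n ([expuv]). *)
Lemma compat_center_exp r n m h : rlab r = (n, 0) ->
  1 - (l m)%:Z <= h <= (k m)%:Z -> (m = n -> pos_swap 0 h = h) ->
  compat (reflK r) n (co n) m (h <= 0) (mono (center_exp m h)).
Proof.
move=> er hr hn; rewrite /compat.
have kl0 j : (k j)%:R + (l j)%:R != 0 :> rat.
  by rewrite -natrD pnatr_eq0 addn_eq0 negb_and -lt0n k_gt0.
have key j j' b : m != n -> (n == m + 1) || (n == m - 1) ->
    center_exp_at k l m h m 0 *: (expu1 k l n + expv1 k l n) = co_exp n j b - co_exp n j' b ->
    reflK r (mono (center_exp m h)) * co n j' b = mono (center_exp m h) * co n j b.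
  move=> mn nm e; rewrite (reflK_mono R r (in_K_center_exp m h)).
  rewrite (refl_exp_center_exp k_gt0 l_gt0 N_ge3) //.
  rewrite er (negPf mn) nm scale1r -expuv e.
  have hj := in_K_co_exp n j b; have hj' := in_K_co_exp n j' b.
  rewrite (monoD R (in_K_center_exp m h) (in_KB hj hj')) -mulrA; congr (_ * _).
  by rewrite /co -(monoD R (in_KB hj hj') hj') subrK.
have mE : center_exp_at k l m h m 0 = (l m)%:R / ((k m)%:R + (l m)%:R) - (h <= 0)%R%:R.
  by rewrite /center_exp_at eqxx addr0.
have [mS|mS] := eqVneq m (n + 1).
  apply: key; first by rewrite mS ZN_succ_neq.
    by rewrite mS addrK eqxx orbT.
  rewrite mE mS /co_exp omega_S; have k0 := kl0 (n + 1).
  move: (expu1 k l n) (expv1 k l n) => u v.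
  by case: (h <= 0); rewrite scalerDr /= -scaleNr; congr (_ *: _ + _ *: _);
    rewrite ?mulr0n ?mulr1n; field; exact: k0.
have [mP|mP] := eqVneq m (n - 1).
  apply: key; first by rewrite mP ZN_pred_neq.
    by rewrite mP subrK eqxx.
  rewrite mE mP /co_exp omega_P; have k0 := kl0 (n - 1).
  move: (expu1 k l n) (expv1 k l n) => u v.
  by case: (h <= 0); rewrite scalerDr /= addrC -scaleNr; congr (_ *: _ + _ *: _);
    rewrite ?mulr0n ?mulr1n; field; exact: k0.
rewrite /= (reflK_mono R r (in_K_center_exp m h)); congr (Defs.mono _ _ _).
have [mn|mn] := eqVneq m n.
  by rewrite mn (refl_exp_center_exp_same er) -?mn // hn.
rewrite (refl_exp_center_exp k_gt0 l_gt0 N_ge3) // er (negPf mn) /=.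
rewrite [n == m + 1]ZN_eqS [n - 1 == m]eq_sym (negPf mP) [n == m - 1]ZN_eqP.
by rewrite [n + 1 == m]eq_sym (negPf mS) scale0r addr0.
Qed.

End Instance.

(** * Action of a reflection on the tau variables *)

Section TauInstance.

Variables (R : realType) (N : nat) (k l : 'Z_N -> nat) (p : nat).
Local Notation ridx := (ridx k l).
Local Notation eidx := (eidx k l).
Local Notation K := (K R k l).
Local Notation L := (L R k l).
Local Notation T := {mpoly K[#|eidx|]}.
Local Notation reflK := (@reflK R N k l).
Local Notation reflL := (@reflL R N k l p).
Local Notation refl_tau := (@refl_tau R N k l p).
Local Notation co := (@co R N k l p).
Implicit Types (r q : ridx) (x y : eidx).

Definition tfL : {rmorphism T -> L} := @FracField.tofrac T.

Lemma tfL_inj : injective tfL.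
Proof. by move=> a b /eqP; rewrite tofrac_eq => /eqP. Qed.

Lemma tauXE x : tauX R x = tau_var tfL x.
Proof. by rewrite /tau_var pvarE. Qed.

Lemma tauX_neq0 x : tauX R x != 0.
Proof. by rewrite tauXE; apply: tau_var_neq0; apply: tfL_inj. Qed.

Lemma prod_tag_pos n (P : pred bool) :
  \prod_(x : eidx | (tag x == n) && P (0 < chain_pos x)) tauX R x =
  (\prod_(i < k n | P true) tauX R (epos l i)) *
  (\prod_(j < l n | P false) tauX R (eneg k j)).
Proof.
pose tg n' (a : ('I_(k n') + 'I_(l n'))%type) : eidx := Tagged _ a.
transitivity (\prod_(x : eidx | (tag x == n) && P (0 < chain_pos (tg _ (tagged x))))
   tauX R (tg _ (tagged x))); first by apply: eq_big => -[].
rewrite -(@sig_big_dep _ _ _ _ (fun j => ('I_(k j) + 'I_(l j))%type : finType)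
  (pred1 n) (fun j a => P (0 < chain_pos (tg j a))) (fun j a => tauX R (tg j a))).
rewrite (big_pred1 n) // big_sumType /=; congr (_ * _).
apply: eq_bigl => j; congr P; rewrite /chain_pos /=; lia.
Qed.

Lemma xiE n : xi R k l n = tfL (xiT k l K n).
Proof.
rewrite /xiT rmorph_prod.
transitivity (\prod_(x : eidx | (tag x == n) && (0 < chain_pos x)) tauX R x); last first.
  by apply: eq_bigr => x _; rewrite tauXE.
rewrite (prod_tag_pos n id) [X in _ * X]big_pred0 //; exact/esym/mulr1.
Qed.

Lemma etaE n : Defs.eta R k l n = tfL (etaT k l K n).
Proof.
rewrite /etaT rmorph_prod.
transitivity (\prod_(x : eidx | (tag x == n) && ~~ (0 < chain_pos x)) tauX R x); last first.
  by apply: eq_bigr => x _; rewrite tauXE.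
rewrite (prod_tag_pos n negb) [X in X * _]big_pred0 //; exact/esym/mul1r.
Qed.

Lemma zetaLE z : zetaL R k l z = tfL (zetaT k l K z).
Proof.
case: z => n [] /=; rewrite xiE etaE /zetaT /=; exact/esym/rmorphM.
Qed.

Lemma eval_zetaE (Phi : polyring N K) : eval_zeta Phi = eval_tau tfL Phi.
Proof.
transitivity (psubst (embed_cst tfL) (zetaL R k l) Phi); first by rewrite psubstE.
symmetry; move: Phi; apply: psubst_uniq => [c|z]; first exact: eval_tauC.
by rewrite zetaLE; exact: eval_tau_pvar.
Qed.

Lemma tau_E n h x : tag x = n -> chain_pos x = h -> tau_ R k l n (chain_lab h) = tau_var tfL x.
Proof.
move=> tx hx; rewrite -tauXE /tau_; case: pickP => [y|/(_ x)].
  by rewrite elab_eq -tx -hx -eidx_eq => /eqP ->.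
by rewrite elab_eq tx hx !eqxx.
Qed.

Lemma reflLE r f : reflL r f = subst_frac (subst_tau (reflK r) tfL (refl_tau r)) f.
Proof.
rewrite /subst_frac /subst_tau; congr (_ / _); by rewrite psubstE.
Qed.

Lemma elab_eq_pos x y : (elab x == elab y) = (x == y).
Proof. by rewrite (inj_eq (@elab_inj _ _ _)). Qed.

Lemma refl_tau_swap r n i x0 x1 : rlab r = (n, i) -> i != 0 ->
  tag x0 = n -> tag x1 = n -> chain_pos x0 = i -> chain_pos x1 = i + 1 ->
  refl_tau r =1 tau_swap tfL x0 x1.
Proof.
move=> er i0 t0 t1 h0 h1 x; rewrite /Defs.refl_tau er (negPf i0) /tau_swap.
have e0 : elab x0 = (n, chain_lab i) by rewrite elabE t0 h0.
have e1 : elab x1 = (n, chain_lab (i + 1)) by rewrite elabE t1 h1.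
have T0 := tau_E t0 h0; have T1 := tau_E t1 h1.
have [ip|ip] := ltrP 0 i.
  have a0 : chain_lab i = i by rewrite /chain_lab ip.
  have a1 : chain_lab (i + 1) = outer i by rewrite /chain_lab /outer ip; case: ifP => //; lia.
  rewrite a0 a1 in e0 e1 T0 T1; rewrite -e0 -e1 !elab_eq_pos T0 T1.
  case: tpermP => [->|->|/eqP/negPf -> /eqP/negPf ->]; last by rewrite tauXE.
    by rewrite eqxx.
  by rewrite eqxx; case: eqP => // ->.
have a0 : chain_lab i = outer i by rewrite /chain_lab /outer; case: ifP => //; lia.
have a1 : chain_lab (i + 1) = i by rewrite /chain_lab; case: ifP; lia.
rewrite a0 a1 in e0 e1 T0 T1; rewrite -e0 -e1 !elab_eq_pos T0 T1.
case: tpermP => [->|->|/eqP/negPf -> /eqP/negPf ->]; last by rewrite tauXE.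
  by rewrite eqxx; case: eqP => // ->.
by rewrite eqxx.
Qed.

Lemma eval_tau_exch n b : eval_tau tfL (exch n (co n) b) =
  KtoL (co n b false) * zetaL R k l (n, false) + KtoL (co n b true) * zetaL R k l (n, true).
Proof.
have eC c z : eval_tau tfL (c *: pvar K z) = KtoL c * zetaL R k l z.
  transitivity (embed_cst tfL c * eval_tau tfL (pvar K z)); first exact: eval_tauZ.
  by congr (_ * _); rewrite zetaLE; exact: eval_tau_pvar.
apply: etrans (rmorphD (eval_tau tfL) _ _) _; rewrite /=; congr (_ + _); exact: eC.
Qed.

Lemma refl_tau_mut r n x0 x1 : rlab r = (n, 0) ->
  tag x0 = n -> tag x1 = n -> chain_pos x0 = 0 -> chain_pos x1 = 1 ->
  refl_tau r =1 tau_mut tfL n (co n) x0 x1.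
Proof.
move=> er t0 t1 h0 h1 x; rewrite /Defs.refl_tau er eqxx /tau_mut.
have e0 : elab x0 = (n, -1) by rewrite elabE t0 h0.
have e1 : elab x1 = (n, 1) by rewrite elabE t1 h1.
have T0 : tau_ R k l n (-1) = tau_var tfL x0 := tau_E t0 h0.
have T1 : tau_ R k l n 1 = tau_var tfL x1 := tau_E t1 h1.
have c1 : (elab x == (n, 1)) = (x == x1) by rewrite -e1 elab_eq_pos.
have c0 : (elab x == (n, -1)) = (x == x0) by rewrite -e0 elab_eq_pos.
rewrite c1 c0 T0 T1; case: (x == x1); first by congr (_ / _); exact/esym/eval_tau_exch.
case: (x == x0); last exact: tauXE.
congr (_ / _); exact/esym/eval_tau_exch.
Qed.

End TauInstance.

Section ReflL.

Variables (R : realType) (N : nat) (k l : 'Z_N -> nat) (p : nat).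
Hypothesis N_ge3 : (3 <= N)%N.
Hypothesis k_gt0 : forall n, (0 < k n)%N.
Hypothesis l_gt0 : forall n, (0 < l n)%N.
Hypothesis p_suitable : suitable k l p.
Local Notation ridx := (ridx k l).
Local Notation eidx := (eidx k l).
Local Notation K := (K R k l).
Local Notation L := (L R k l).
Local Notation T := {mpoly K[#|eidx|]}.
Local Notation reflK := (@reflK R N k l).
Local Notation reflL := (@reflL R N k l p).
Local Notation refl_tau := (@refl_tau R N k l p).
Local Notation co := (@co R N k l p).
Local Notation tfL := (@tfL R N k l).
Implicit Types (r q : ridx) (x y : eidx).

Definition reflT r : T -> L := subst_tau (reflK r) tfL (refl_tau r).

HB.instance Definition _ r :=
  GRing.RMorphism.copy (reflT r) (subst_tau (reflK r) tfL (refl_tau r)).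

Lemma reflT_pvar r x : reflT r (pvar K x) = refl_tau r x.
Proof. exact: subst_tau_pvar. Qed.

Lemma reflTC r c : reflT r c%:MP = KtoL (reflK r c).
Proof. exact: subst_tauC. Qed.

(** This makes the substitution [reflL r] a well defined automorphism. *)
Lemma reflT_inv r a : inv_at (reflT r) a.
Proof.
elim/mpoly_ring_ind: a => [c|i|a b|a b]; last 2 first.
- exact: inv_atD.
- exact: inv_atM.
- apply: (@inv_at_poly _ _ _ (reflK r c)%:MP); first exact: reflTC.
  by apply: etrans (reflTC _ _) _; rewrite reflKK.
rewrite pvar_ord; move: (enum_val i) => x.
case er: (rlab r) => [n j].
have [x0 [x1 [t0 t1 h0 h1]]] := refl_pos k_gt0 l_gt0 r.
rewrite er /= in t0 t1 h0 h1.
have [j0|j0] := eqVneq j 0; last first.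
  have E := refl_tau_swap R p er j0 t0 t1 h0 h1.
  apply: (@inv_at_poly _ _ _ (pvar K (tperm x0 x1 x))).
    by apply: etrans (reflT_pvar _ _) _; rewrite E.
  by apply: etrans (reflT_pvar _ _) _; rewrite E /tau_swap tpermK.
rewrite j0 add0r in er h0 h1; have E := refl_tau_mut R p er t0 t1 h0 h1.
have EP P : reflT r P = subst_tau (reflK r) tfL (tau_mut tfL n (co n) x0 x1) P.
  exact: psubst_eq.
have s_co b i' : reflK r (co n b i') = co n (~~ b) i'.
  exact: reflK_co.
have [b [c [e1 e2 e3]]] := tau_mut_inv N_ge3 k_gt0 (s := reflK r) (@tfL_inj R N k l)
  (@co_neq0 R N k l p n) s_co t0 t1 h0 h1 (exch_factor_n n (co n)) x.
by exists b, c; split; rewrite /= !EP.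
Qed.

Lemma reflL_E r f : reflL r f = subst_frac (reflT r) f.
Proof. exact: reflLE. Qed.

Fact reflL_zmod r : zmod_morphism (reflL r).
Proof.
move=> x y; rewrite !reflL_E; exact: (subst_frac_zmod (reflT_inv r)).
Qed.

Fact reflL_monoid r : monoid_morphism (reflL r).
Proof.
have [h1 h2] := subst_frac_monoid (reflT_inv r).
split=> [|x y]; first by rewrite reflL_E; exact: h1.
by rewrite !reflL_E; exact: h2.
Qed.

HB.instance Definition _ r :=
  GRing.isZmodMorphism.Build L L (reflL r) (reflL_zmod r).
HB.instance Definition _ r :=
  GRing.isMonoidMorphism.Build L L (reflL r) (reflL_monoid r).

Lemma reflL_tofrac r a : reflL r (tfL a) = reflT r a.
Proof. by rewrite reflL_E; exact: (subst_frac_tofrac (reflT_inv r)). Qed.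

Lemma reflL_tauX r x : reflL r (tauX R x) = refl_tau r x.
Proof.
by rewrite tauXE; apply: etrans (reflL_tofrac _ _) _; exact: reflT_pvar.
Qed.

Lemma reflL_eval_tau_swap r n i P : rlab r = (n, i) -> i != 0 ->
  reflL r (eval_tau tfL P) = eval_tau tfL (map_coef (reflK r) P).
Proof.
move=> er i0; have [x0 [x1 [t0 t1 h0 h1]]] := refl_pos k_gt0 l_gt0 r.
rewrite er /= in t0 t1 h0 h1.
have E := refl_tau_swap R p er i0 t0 t1 h0 h1.
apply: etrans (reflL_tofrac _ _) _.
transitivity (subst_tau (reflK r) tfL (tau_swap tfL x0 x1) (evalT k l P)); first exact: psubst_eq.
apply: swap_eval_tau; first by rewrite t0 t1.
rewrite h0 h1; clear - i0; lia.
Qed.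

Lemma reflL_eval_tau_mut r n x0 x1 d1 d2 P : rlab r = (n, 0) ->
  tag x0 = n -> tag x1 = n -> chain_pos x0 = 0 -> chain_pos x1 = 1 ->
  factor_homog (n + 1) d1 P -> factor_homog (n - 1) d2 P ->
  reflL r (eval_tau tfL P) =
  (tau_var tfL x0 * tau_var tfL x1) ^- (d1 + d2) * eval_tau tfL (mut (reflK r) n (co n) P).
Proof.
move=> er t0 t1 h0 h1 H1 H2.
have E := refl_tau_mut R p er t0 t1 h0 h1.
apply: etrans (reflL_tofrac _ _) _.
transitivity (subst_tau (reflK r) tfL (tau_mut tfL n (co n) x0 x1) (evalT k l P));
  first exact: psubst_eq.
rewrite -exprVn; exact: (mut_eval_tau (reflK r) (@tfL_inj R N k l) (co n) t0 t1 h0 h1 H1 H2).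
Qed.

End ReflL.

(** * Action of a reflection on degrees and multiplicities *)

Section CohomologyAction.

Variables (N : nat) (k l : 'Z_N -> nat).
Local Notation ridx := (ridx k l).
Local Notation eidx := (eidx k l).
Local Notation H2 := (H2 k l).
Implicit Types (r : ridx) (x y : eidx) (La : H2).

Lemma H2_mulz1 (v : H2) (z : int) m : (v *~ z).1 m = v.1 m * z.
Proof.
have E j : (v *+ j).1 m = v.1 m *+ j.
  by elim: j => [|j IH]; rewrite ?mulr0n ?ffunE // !mulrS /= !ffunE IH.
by rewrite -mulrzz; case: z => j; rewrite /intmul /= ?ffunE E.
Qed.

Lemma H2_mulz2 (v : H2) (z : int) x : (v *~ z).2 x = v.2 x * z.
Proof.
have E j : (v *+ j).2 x = v.2 x *+ j.
  by elim: j => [|j IH]; rewrite ?mulr0n ?ffunE // !mulrS /= !ffunE IH.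
by rewrite -mulrzz; case: z => j; rewrite /intmul /= ?ffunE E.
Qed.

Lemma degE r La m : deg (refl r La) m = deg La m + (Defs.root r).1 m * pairing La (coroot r).
Proof. by rewrite /deg /refl /= ffunE H2_mulz1. Qed.

Lemma multE r La x : mult (refl r La) x = mult La x - (Defs.root r).2 x * pairing La (coroot r).
Proof. by rewrite /mult /refl /= ffunE H2_mulz2 opprD. Qed.

Lemma diffE1 n n' i i' m : (clE k l n i - clE k l n' i').1 m = 0.
Proof. by rewrite /= !ffunE ?oppr0 ?addr0 ?add0r. Qed.

Lemma diffE2 n n' i i' x : (clE k l n i - clE k l n' i').2 x =
  (elab x == (n, i))%:R - (elab x == (n', i'))%:R.
Proof. by rewrite /= !ffunE. Qed.

Lemma root0E1 n m : (clH k l n - clE k l n 1 - clE k l n (-1)).1 m = (m == n)%:R.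
Proof. by rewrite /= !ffunE ?oppr0 ?addr0 ?add0r. Qed.

Lemma root0E2 n x : (clH k l n - clE k l n 1 - clE k l n (-1)).2 x =
  - (elab x == (n, 1))%:R - (elab x == (n, -1))%:R.
Proof. by rewrite /= !ffunE ?oppr0 ?addr0 ?add0r. Qed.

Lemma coroot0E1 n m :
  (clh k l (n - 1) + clh k l (n + 1) - cle k l n 1 - cle k l n (-1)).1 m =
  (m == n - 1)%:R + (m == n + 1)%:R.
Proof. by rewrite /= !ffunE ?oppr0 ?addr0 ?add0r. Qed.

Lemma coroot0E2 n x :
  (clh k l (n - 1) + clh k l (n + 1) - cle k l n 1 - cle k l n (-1)).2 x =
  - (elab x == (n, 1))%:R - (elab x == (n, -1))%:R.
Proof. by rewrite /= !ffunE ?oppr0 ?addr0 ?add0r. Qed.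

Lemma clEE x : clE k l (elab x).1 (elab x).2 = (0, [ffun y => (y == x)%:R]).
Proof.
rewrite /clE; congr (_, _); apply/ffunP => y; rewrite !ffunE.
by rewrite -surjective_pairing (inj_eq (@elab_inj _ _ _)).
Qed.

Lemma sum_delta (I : finType) (f : I -> int) i :
  \sum_j f j * (j == i)%:R = f i.
Proof.
rewrite (bigD1 i) //= eqxx mulr1 big1 ?addr0 // => j /negPf ->.
by rewrite mulr0.
Qed.

Lemma refl_swap r n i x0 x1 La : rlab r = (n, i) -> i != 0 ->
  tag x0 = n -> tag x1 = n -> chain_pos x0 = i -> chain_pos x1 = i + 1 ->
  (forall m, deg (refl r La) m = deg La m) /\
  (forall x, mult (refl r La) x = mult La (tperm x0 x1 x)).
Proof.
move=> er i0 t0 t1 h0 h1.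
have [y0 [y1 [ey0 ey1 ey]]] : exists y0 y1, [/\ elab y0 = (n, i), elab y1 = (n, outer i)
    & tperm x0 x1 = tperm y0 y1].
  have e0 : elab x0 = (n, chain_lab i) by rewrite elabE t0 h0.
  have e1 : elab x1 = (n, chain_lab (i + 1)) by rewrite elabE t1 h1.
  have [ip|ip] := ltrP 0 i.
    exists x0, x1; split; rewrite ?e0 ?e1 //; congr (_, _).
      by rewrite /chain_lab ip.
    by rewrite /chain_lab /outer ip; case: ifP => //; lia.
  exists x1, x0; split; rewrite ?e0 ?e1 1?tpermC //; congr (_, _).
    by rewrite /chain_lab; case: ifP; lia.
  by rewrite /chain_lab /outer; case: ifP => //; lia.
have rE : Defs.root r = clE k l n i - clE k l n (outer i) by rewrite /Defs.root er (negPf i0).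
have cE : coroot r = clE k l n i - clE k l n (outer i) :> H2.
  by rewrite /coroot er (negPf i0).
have y01 : y0 != y1.
  apply: contraTneq isT => y01; have := ey1; rewrite -y01 ey0 => -[].
  by rewrite /outer; case: ifP => _; lia.
have eE y j z : elab y = (n, j) -> (elab z == (n, j)) = (z == y).
  by move=> <-; rewrite (inj_eq (@elab_inj _ _ _)).
have pE : pairing La (coroot r) = La.2 y1 - La.2 y0.
  rewrite /pairing cE big1 ?sub0r => [|j _]; last first.
    by rewrite diffE1 mulr0.
  transitivity (- (\sum_y La.2 y * (y == y0)%:R - \sum_y La.2 y * (y == y1)%:R)).
    congr (- _); rewrite -sumrB; apply: eq_bigr => y _; rewrite -mulrBr.
    by rewrite diffE2 (eE _ _ _ ey0) (eE _ _ _ ey1).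
  by rewrite !sum_delta opprB.
split=> [m|x]; first by rewrite degE rE diffE1 mul0r addr0.
rewrite multE pE rE ey.
rewrite diffE2 (eE _ _ _ ey0) (eE _ _ _ ey1).
rewrite /mult; case: tpermP => [->|->|/eqP/negPf -> /eqP/negPf ->].
- by rewrite eqxx (negPf y01) subr0 mul1r; ring.
- by rewrite eqxx eq_sym (negPf y01) sub0r mulN1r; ring.
- by rewrite subrr mul0r subr0.
Qed.

Lemma refl_mut r n x0 x1 La : rlab r = (n, 0) ->
  tag x0 = n -> tag x1 = n -> chain_pos x0 = 0 -> chain_pos x1 = 1 ->
  let c := deg La (n - 1) + deg La (n + 1) - mult La x0 - mult La x1 in
  (forall m, deg (refl r La) m = deg La m + (m == n)%:R * c) /\
  (forall x, mult (refl r La) x = mult La x + ((x == x0) || (x == x1))%:R * c).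
Proof.
move=> er t0 t1 h0 h1 c.
have e0 : elab x0 = (n, -1) by rewrite elabE t0 h0.
have e1 : elab x1 = (n, 1) by rewrite elabE t1 h1.
have rE : Defs.root r = clH k l n - clE k l n 1 - clE k l n (-1) by rewrite /Defs.root er.
have cE : coroot r =
    clh k l (n - 1) + clh k l (n + 1) - cle k l n 1 - cle k l n (-1).
  by rewrite /coroot er.
have x01 : x0 != x1 by rewrite eidx_eq h0 h1 andbF.
have eE y j z : elab y = (n, j) -> (elab z == (n, j)) = (z == y).
  by move=> <-; rewrite (inj_eq (@elab_inj _ _ _)).
have pE : pairing La (coroot r) = c.
  have d1 : \sum_j La.1 j * (coroot r).1 j = La.1 (n - 1) + La.1 (n + 1).
    rewrite (eq_bigr (fun j => La.1 j * (j == n - 1)%:R + La.1 j * (j == n + 1)%:R)).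
      by rewrite big_split /= !sum_delta.
    by move=> j _; rewrite cE coroot0E1 mulrDr.
  have d2 : \sum_y La.2 y * (coroot r).2 y = - La.2 x1 - La.2 x0.
    rewrite (eq_bigr (fun y => - (La.2 y * (y == x1)%:R) - La.2 y * (y == x0)%:R)).
      by rewrite big_split /= !sumrN !sum_delta.
    move=> y _; rewrite cE coroot0E2 (eE _ _ _ e1) (eE _ _ _ e0).
    by rewrite mulrDr !mulrN.
  rewrite /pairing d1 d2.
  by rewrite /c /deg /mult; ring.
split=> [m|x].
  by rewrite degE pE rE root0E1.
rewrite multE pE rE root0E2 (eE _ _ _ e1) (eE _ _ _ e0).
have -> : - (x == x1)%:R - (x == x0)%:R = - ((x == x0) || (x == x1))%:R :> int.
  have [->|_] := eqVneq x x0; first by rewrite (negPf x01) oppr0 add0r.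
  by rewrite oppr0 addr0.
by rewrite mulNr opprK.
Qed.

End CohomologyAction.

(** * Polynomials with coefficients in a subring *)

Section Subring.

Variables (N : nat) (F : fieldType) (Int : F -> Prop).
Local Notation Kz := (polyring N F).
Hypothesis Int0 : Int 0.
Hypothesis Int1 : Int 1.
Hypothesis IntD : forall a b, Int a -> Int b -> Int (a + b).
Hypothesis IntN : forall a, Int a -> Int (- a).
Hypothesis IntM : forall a b, Int a -> Int b -> Int (a * b).
Implicit Types P Q : Kz.

Definition IntP P : Prop := forall m, Int P@_m.

Lemma Int_sum (I : Type) (s : seq I) (p : pred I) (f : I -> F) :
  (forall i, p i -> Int (f i)) -> Int (\sum_(i <- s | p i) f i).
Proof. by move=> h; apply: big_ind. Qed.

Lemma IntPD P Q : IntP P -> IntP Q -> IntP (P + Q).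
Proof. by move=> hP hQ m; rewrite mcoeffD; apply: IntD. Qed.

Lemma IntP_sum (I : eqType) (s : seq I) (f : I -> Kz) :
  (forall i, i \in s -> IntP (f i)) -> IntP (\sum_(i <- s) f i).
Proof.
move=> h; rewrite big_seq; apply: big_ind => //; last exact: IntPD.
by move=> m; rewrite mcoeff0.
Qed.

Lemma IntPM P Q : IntP P -> IntP Q -> IntP (P * Q).
Proof.
move=> hP hQ m; rewrite mcoeffM; apply: Int_sum => i _.
by apply: IntM; [apply: hP | apply: hQ].
Qed.

Lemma IntPC c : Int c -> IntP c%:MP.
Proof. by move=> hc m; rewrite mcoeffC; case: eqP => _; rewrite ?mulr1 ?mulr0. Qed.

Lemma IntPZ c P : Int c -> IntP P -> IntP (c *: P).
Proof. by move=> hc hP m; rewrite mcoeffZ; apply: IntM. Qed.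

Lemma IntP_pvar z : IntP (pvar F z).
Proof.
by move=> m; rewrite pvarE mcoeffX; case: eqP.
Qed.

Lemma IntPX P j : IntP P -> IntP (P ^+ j).
Proof.
move=> hP; elim: j => [|j IH]; last by rewrite exprS; apply: IntPM.
by rewrite expr0 -mpolyC1; apply: IntPC.
Qed.

Lemma IntP_psub (s : {rmorphism F -> F}) (v : zidx N -> Kz) P :
  (forall c, Int c -> Int (s c)) -> (forall z, IntP (v z)) -> IntP P ->
  IntP (psubst (@mpolyC #|zidx N| F \o s) v P).
Proof.
move=> hs hv hP; rewrite (mpolyE P) rmorph_sum /=; apply: IntP_sum => m _.
rewrite psubstZ /= mul_mpolyC; apply: IntPZ; first by apply: hs; apply: hP.
rewrite psubstXm; apply: big_ind => [|P1 P2|z _].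
- by rewrite -mpolyC1; apply: IntPC.
- exact: IntPM.
- exact: IntPX.
Qed.

(** Division by a linear form whose first coefficient is a unit of the subring
    introduces no denominator: the coefficients of the quotient are obtained
    one after the other, by increasing exponent of the second variable. *)
Lemma IntP_div n c0 c1 Q : c0 != 0 -> Int c0^-1 -> Int c1 ->
  IntP ((c0 *: pvar F (n, false) + c1 *: pvar F (n, true)) * Q) -> IntP Q.
Proof.
move=> c00 i0 i1 hQ.
pose t0 := enum_rank (n, false); pose t1 := enum_rank (n, true).
have t01 : t0 != t1 by rewrite (inj_eq enum_rank_inj) xpair_eqE andbF.
suff H j (m : 'X_{1..#|zidx N|}) : (m t1 < j)%N -> Int Q@_m by move=> m; apply: (H (m t1).+1).
elim: j m => // j IH m; rewrite ltnS => mj.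
have := hQ (U_(t0) + m)%MM; rewrite mulrDl mcoeffD -!scalerAl !mcoeffZ !pvarE.
rewrite ![ 'X_ _ * Q]mulrC mcoeffMX => h.
suff h1 : Int (c1 * (Q * 'X_t1)@_(U_(t0) + m)).
  have -> : Q@_m = c0^-1 * (c0 * Q@_m + c1 * (Q * 'X_t1)@_(U_(t0) + m)
                            - c1 * (Q * 'X_t1)@_(U_(t0) + m)).
    by rewrite addrK mulKf.
  by apply: IntM => //; apply: IntD => //; apply: IntN.
apply: IntM => //; have [mt|mt] := posnP (m t1).
  rewrite memN_msupp_eq0 //; apply/negP.
  rewrite (perm_mem (msuppMX _ _)) => /mapP[m' _ /(congr1 (fun q : 'X_{1..#|zidx N|} => q t1))].
  by rewrite !mnmDE !mnm1E (negPf t01) eqxx mt.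
have -> : (U_(t0) + m = U_(t1) + (U_(t0) + (m - U_(t1))))%MM.
  apply/mnmP => i; rewrite !mnmDE mnmBE !mnm1E.
  case: (eqVneq t1 i) => [<-|_]; last by rewrite subn0 add0n.
  by rewrite (negPf t01) !add0n subn1 add1n prednK.
rewrite mcoeffMX; apply: IH; rewrite mnmDE mnmBE !mnm1E (negPf t01) eqxx.
by rewrite subn1 -ltnS prednK.
Qed.

End Subring.

(** * Acting on the coefficients of a polynomial *)

Section CoefficientMap.

Variables (N : nat) (F : fieldType) (s : {rmorphism F -> F}).
Hypothesis sK : involutive s.
Local Notation Kz := (polyring N F).
Implicit Types P : Kz.

Lemma map_coefK : involutive (@map_coef N F s).
Proof.
move=> P; pose f : {rmorphism Kz -> Kz} := @map_coef N F s \o @map_coef N F s.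
transitivity (psubst (@mpolyC #|zidx N| F) (pvar F) P); last first.
  by symmetry; apply: (psubst_uniq (f := idfun)).
rewrite -[LHS]/(f P); move: P; apply: psubst_uniq => [c|z]; rewrite /f /=.
  by rewrite !map_coefC sK.
by rewrite !map_coef_pvar.
Qed.

Lemma map_coef_homog n d P : factor_homog n d P -> factor_homog n d (map_coef s P).
Proof.
move=> h; rewrite /factor_homog.
transitivity (psubst (cpoly N F \o s) (fun z => 'X ^+ (z.1 == n) * (pvar F z)%:P) P).
  pose f : {rmorphism Kz -> {poly Kz}} := @torus N F n \o @map_coef N F s.
  rewrite -[LHS]/(f P); move: P {h}; apply: psubst_uniq => [c|z]; rewrite /f /=.
    by rewrite map_coefC torusC.
  by rewrite map_coef_pvar torus_pvar mulrC.
rewrite (psubst_scale _ _ _ h) mulrC; congr (_ * _).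
pose f : {rmorphism Kz -> {poly Kz}} := @polyC Kz \o @map_coef N F s.
rewrite -[RHS]/(f P); symmetry; move: P {h}; apply: psubst_uniq => [c|z]; rewrite /f /=.
  by rewrite map_coefC.
by rewrite map_coef_pvar.
Qed.

Lemma map_coef_center_form n c : map_coef s (@center_form N F n c) = center_form n (s c).
Proof. by rewrite /center_form rmorphD -!mul_mpolyC rmorphM /= map_coefC !map_coef_pvar. Qed.

Lemma map_coef_vanish m b c j P : ideal_pow (center_gens m b c) j P ->
  vanish m b (s c) j (map_coef s P).
Proof.
pose f : {rmorphism Kz -> {poly Kz}} := @flow N F m b (s c) \o @map_coef N F s.
apply: (ideal_vanish (f := f)) => t.
have -> : f (center_gens m b c t) = flow m b (s c) (@center_gens N F m b (s c) t).
  rewrite /f /=; congr (flow _ _ _ _).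
  case: t => -[|[|[|//]]] i; rewrite /center_gens !(tnth_nth 0) /=.
  - exact: map_coef_pvar.
  - exact: map_coef_center_form.
  - exact: map_coef_pvar.
exact: vanish_gens.
Qed.

End CoefficientMap.

(** * The coefficient at the corner point *)

Section CornerCoefficient.

Variables (N : nat) (F : fieldType).
Local Notation Kz := (polyring N F).
Implicit Types P : Kz.

(** The coefficient of the monomial in the zeta_n^0 alone, that is, the value
    at the point where all f_n are infinite, which lies on no center. *)
Definition corner_coef : Kz -> F := psubst idfun (fun z => (~~ z.2)%:R).

HB.instance Definition _ :=
  GRing.RMorphism.copy corner_coef (psubst idfun (fun z : zidx N => (~~ z.2)%:R)).

Lemma corner_coef_pvar z : corner_coef (pvar F z) = (~~ z.2)%:R.
Proof. by rewrite /corner_coef psubstX. Qed.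

Lemma corner_coefC c : corner_coef c%:MP = c. Proof. by rewrite /corner_coef psubstC. Qed.

Lemma corner_coefZ c P : corner_coef (c *: P) = c * corner_coef P.
Proof. by rewrite -mul_mpolyC rmorphM /= corner_coefC. Qed.

Lemma corner_coef_exch n co b : corner_coef (@exch N F n co b) = co b false.
Proof. by rewrite /exch rmorphD /= !corner_coefZ !corner_coef_pvar mulr1 mulr0 addr0. Qed.

Lemma corner_coef_twist (s : {rmorphism F -> F}) P :
  psubst s (fun z => (~~ z.2)%:R) P = s (corner_coef P).
Proof.
pose f : {rmorphism Kz -> F} := s \o corner_coef.
rewrite -[RHS]/(f P); symmetry; move: P; apply: psubst_uniq => [c|z]; rewrite /f /=.
  by rewrite corner_coefC.
by rewrite corner_coef_pvar rmorph_nat.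
Qed.

Lemma corner_coef_map_coef (s : {rmorphism F -> F}) P :
  corner_coef (map_coef s P) = s (corner_coef P).
Proof.
rewrite -corner_coef_twist; pose f : {rmorphism Kz -> F} := corner_coef \o @map_coef N F s.
rewrite -[LHS]/(f P); move: P; apply: psubst_uniq => [c|z]; rewrite /f /=.
  by rewrite map_coefC corner_coefC.
by rewrite map_coef_pvar corner_coef_pvar.
Qed.

Lemma corner_coef_mut (s : {rmorphism F -> F}) n co d1 d2 P :
  factor_homog (n + 1) d1 P -> factor_homog (n - 1) d2 P ->
  corner_coef (mut s n co P) = co false false ^+ d1 * (co true false ^+ d2 * s (corner_coef P)).
Proof.
move=> h1 h2; rewrite -corner_coef_twist -(psubst_scale _ _ _ h2) -(psubst_scale _ _ _ h1).
pose f : {rmorphism Kz -> F} := corner_coef \o @mut N F s n co.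
rewrite -[LHS]/(f P); move: P {h1 h2}; apply: psubst_uniq => [c|z]; rewrite /f /=.
  by rewrite mutC corner_coefC.
rewrite mut_pvar rmorphM /= corner_coef_pvar exch_factorE rmorphM !rmorphXn /= !corner_coef_exch.
case: z => m [] /=; first by rewrite !mulr0.
by rewrite mulrA.
Qed.

End CornerCoefficient.

(** * The normalization functional *)

Section Normalization.

Variables (R : realType) (N : nat) (k l : 'Z_N -> nat) (p : nat).
Hypothesis k_gt0 : forall n, (0 < k n)%N.
Hypothesis l_gt0 : forall n, (0 < l n)%N.
Hypothesis p_suitable : suitable k l p.
Local Notation ridx := (ridx k l).
Local Notation expo := (expo k l).
Local Notation K := (K R k l).
Local Notation Kz := (polyring N K).
Local Notation mono := (@mono R N k l p).
Local Notation reflK := (@reflK R N k l).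
Local Notation qK := (@qK R N k l).
Local Notation co := (@co R N k l p).
Local Notation jet := (@jet R N k l p).
Local Notation integral := (@integral_laurent R N k l p).
Implicit Types (r : ridx) (P : Kz) (z : zidx N) (w : rat) (nu e : expo).

Let p0 : (0 < p)%N := p_gt0 p_suitable.

(** The point at which the normalization condition is expressed. *)
Definition inv_theta z : rat := ((if z.2 then thetaoo k l z.1 else theta0 k l z.1)%:R)^-1.

Lemma inv_theta_gt0 z : 0 < inv_theta z.
Proof.
rewrite invr_gt0 ltr0n /thetaoo /theta0; case: z.2.
  by rewrite addn_gt0 k_gt0.
by rewrite addn_gt0 k_gt0.
Qed.

Lemma theta_weightE m : theta_weight k l m = \prod_z inv_theta z ^+ m (enum_rank z).
Proof.
rewrite /theta_weight /zexp.
transitivity (\prod_n \prod_(b : bool) inv_theta (n, b) ^+ m (enum_rank (n, b))).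
  apply: eq_bigr => n _; rewrite big_bool /= mulrC.
  by rewrite /inv_theta /= !exprVn.
by rewrite pair_bigA; apply: eq_bigr => -[].
Qed.

Definition eval_theta : Kz -> K := psubst idfun (fun z => qK (inv_theta z)).

HB.instance Definition _ :=
  GRing.RMorphism.copy eval_theta (psubst idfun (fun z => qK (inv_theta z))).

Lemma eval_theta_pvar z : eval_theta (pvar K z) = qK (inv_theta z).
Proof. by rewrite /eval_theta psubstX. Qed.

Lemma eval_thetaC c : eval_theta c%:MP = c. Proof. by rewrite /eval_theta psubstC. Qed.

Lemma eval_thetaZ c P : eval_theta (c *: P) = c * eval_theta P.
Proof. by rewrite /eval_theta psubstZ. Qed.

Lemma eval_thetaX m : eval_theta 'X_[m] = qK (theta_weight k l m).
Proof.
rewrite /eval_theta psubstXm theta_weightE rmorph_prod; apply: eq_bigr => z _.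
by rewrite rmorphXn.
Qed.

Lemma jet_q c : jet (qK c) c 0.
Proof.
have := jet_mono R c (@in_K0 N k l p).
by rewrite mono0 mulr1 scaler0.
Qed.

Lemma jet_prod (I : finType) (f : I -> K) (g : I -> rat) :
  (forall i, jet (f i) (g i) 0) -> jet (\prod_i f i) (\prod_i g i) 0.
Proof.
move=> h; apply: (big_rec2 (fun x w => jet x w 0)); first exact: jet1.
by move=> i x w _ hx; apply: jetM0.
Qed.

Lemma jet_sum2 (I : eqType) (s : seq I) (A B : I -> K) r Q :
  (forall i, i \in s -> exists w nu,
     jet (A i) w nu /\ jet (B i) (Q * w) (Q *: refl_exp r nu)) ->
  exists w nu, jet (\sum_(i <- s) A i) w nu /\
    jet (\sum_(i <- s) B i) (Q * w) (Q *: refl_exp r nu).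
Proof.
elim: s => [|i s IH] h.
  exists 0, 0; rewrite !big_nil; split; first exact: jet0.
  by rewrite mulr0 refl_exp0 scaler0; exact: jet0.
have [|w1 [nu1 [h1 h2]]] := IH.
  by move=> j js; apply: h; rewrite in_cons js orbT.
have [w0 [nu0 [h3 h4]]] := h i (mem_head _ _).
exists (w0 + w1), (nu0 + nu1); rewrite !big_cons; split; first exact: jetD.
by rewrite mulrDr refl_expD scalerDr; exact: jetD.
Qed.

(** Suppose that the new values of the coordinates are multiples of the old
    ones to first order, by factors that multiply all the monomials of [P] by
    the same constant. Then only the coefficients contribute to the gradient,
    which is transformed by the reflection. *)
Lemma jet_transfer r (u : zidx N -> K) (q : zidx N -> rat) (Q : rat) P w nu :
  (forall z, jet (u z) (q z * inv_theta z) 0) ->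
  (forall m, m \in msupp P -> \prod_z q z ^+ m (enum_rank z) = Q) ->
  (forall m, integral P@_m) -> jet (eval_theta P) w nu ->
  jet (psubst (reflK r) u P) (Q * w) (Q *: refl_exp r nu).
Proof.
move=> hu hq hP hw.
suff [w1 [nu1 [h1 h2]]] : exists w1 nu1, jet (eval_theta P) w1 nu1 /\
    jet (psubst (reflK r) u P) (Q * w1) (Q *: refl_exp r nu1).
  by have [-> ->] := jet_inj p0 hw h1.
have e1 : eval_theta P = \sum_(m <- msupp P) P@_m * eval_theta 'X_[m].
  by rewrite {1}(mpolyE P) rmorph_sum; apply: eq_bigr => m _; exact: eval_thetaZ.
have e2 : psubst (reflK r) u P = \sum_(m <- msupp P) reflK r P@_m * psubst (reflK r) u 'X_[m].
  by rewrite {1}(mpolyE P) rmorph_sum; apply: eq_bigr => m _; exact: psubstZ.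
rewrite e1 e2; apply: jet_sum2 => m mP.
have [c0 [nu0 h0]] := integral_jet (hP m).
have k1 : jet (eval_theta 'X_[m]) (theta_weight k l m) 0 by rewrite eval_thetaX; apply: jet_q.
have k2 : jet (psubst (reflK r) u 'X_[m]) (Q * theta_weight k l m) 0.
  rewrite psubstXm theta_weightE -(hq m mP) -big_split /=; apply: jet_prod => z.
  by rewrite -exprMn; apply: jet_pow0.
have t1 := jetM h0 k1; have t2 := jetM (jet_refl r h0) k2.
rewrite !scaler0 !addr0 in t1 t2.
exists (c0%:~R * theta_weight k l m), (theta_weight k l m *: nu0); split; first exact: t1.
by move: t2; rewrite mulrCA refl_expZ scalerA.
Qed.

(** The exponents omega_n and -1 + omega_n of v_n in the first exchange form,
    weighted by 1 / theta_n^0 and 1 / theta_n^oo, cancel; the same holds for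
    u_n in the second one. *)
Lemma jet_eval_theta_exch n b :
  jet (eval_theta (exch n (co n) b)) (inv_theta (n, false) + inv_theta (n, true)) 0.
Proof.
have e : eval_theta (exch n (co n) b) = qK (inv_theta (n, false)) * mono (co_exp k l n b false) +
    qK (inv_theta (n, true)) * mono (co_exp k l n b true).
  transitivity (eval_theta (co n b false *: pvar K (n, false)) +
      eval_theta (co n b true *: pvar K (n, true))); first exact: (rmorphD eval_theta).
  by congr (_ + _); apply: etrans (eval_thetaZ _ _) _; rewrite eval_theta_pvar; exact: mulrC.
have h0 := jet_mono R (inv_theta (n, false)) (in_K_co_exp p_suitable n b false).
have h1 := jet_mono R (inv_theta (n, true)) (in_K_co_exp p_suitable n b true).
have := jetD h0 h1; rewrite -e.
suff -> : inv_theta (n, false) *: co_exp k l n b false +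
    inv_theta (n, true) *: co_exp k l n b true = 0 by [].
have t0 := inv_theta_gt0 (n, false); have t1 := inv_theta_gt0 (n, true).
rewrite /inv_theta /= !invr_gt0 in t0 t1.
rewrite /co_exp; move: (expu1 k l n) (expv1 k l n) => u v.
rewrite /inv_theta /omega natrD /=; set a := (theta0 k l n)%:R; set c := (thetaoo k l n)%:R.
have nz : [&& a != 0, c != 0 & a + c != 0].
  by rewrite !lt0r_neq0 //; rewrite -/a -/c in t0 t1; lra.
case/and3P: nz => a0 c0 ac0.
case: (b); rewrite !scalerA -scalerDl; apply/eqP; rewrite scaler_eq0; apply/orP; left;
  by apply/eqP; field; rewrite a0 c0 ac0.
Qed.

Lemma jet_eval_theta_mut r n d1 d2 P w nu : rlab r = (n, 0) ->
  factor_homog (n + 1) d1 P -> factor_homog (n - 1) d2 P ->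
  (forall m, integral P@_m) -> jet (eval_theta P) w nu ->
  let c := inv_theta (n, false) + inv_theta (n, true) in
  jet (eval_theta (mut (reflK r) n (co n) P)) (c ^+ (d1 + d2) * w)
    (c ^+ (d1 + d2) *: refl_exp r nu).
Proof.
move=> er h1 h2 hP hw c.
have -> : eval_theta (mut (reflK r) n (co n) P) =
    psubst (reflK r) (fun z => eval_theta (exch_factor n (co n) z) * qK (inv_theta z)) P.
  pose f : {rmorphism Kz -> K} := eval_theta \o @mut N K (reflK r) n (co n).
  rewrite -[LHS]/(f P); move: P {h1 h2 hP hw}; apply: psubst_uniq => [a|z]; rewrite /f /=.
    by rewrite mutC eval_thetaC.
  by rewrite mut_pvar rmorphM /= eval_theta_pvar.
apply: (@jet_transfer r _ (fun z => c ^+ (z.1 == n + 1) * c ^+ (z.1 == n - 1))) => //.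
  move=> z; apply: jetM0; last exact: jet_q.
  have /= e := rmorph_exch_factor n (co n) eval_theta z; rewrite e.
  by apply: jetM0; apply: jet_pow0; apply: jet_eval_theta_exch.
move=> m mP; under eq_bigr do rewrite exprMn -!exprM.
rewrite big_split /= !prodrXr !sum_zdeg -exprD.
by rewrite (proj1 (factor_homogP _ _ _) h1 m mP) (proj1 (factor_homogP _ _ _) h2 m mP).
Qed.

Lemma jet_eval_theta_map_coef r P w nu :
  (forall m, integral P@_m) -> jet (eval_theta P) w nu ->
  jet (eval_theta (map_coef (reflK r) P)) w (refl_exp r nu).
Proof.
move=> hP hw; rewrite -[w]mul1r -[refl_exp r nu]scale1r.
have -> : eval_theta (map_coef (reflK r) P) = psubst (reflK r) (fun z => qK (inv_theta z)) P.
  pose f : {rmorphism Kz -> K} := eval_theta \o @map_coef N K (reflK r).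
  rewrite -[LHS]/(f P); move: P {hP hw}; apply: psubst_uniq => [a|z]; rewrite /f /=.
    by rewrite map_coefC eval_thetaC.
  by rewrite map_coef_pvar eval_theta_pvar.
apply: (@jet_transfer r _ (fun=> 1)) => // [z|m _]; first by rewrite mul1r; apply: jet_q.
by rewrite big1 // => z _; rewrite expr1n.
Qed.

End Normalization.

(** * Transport of linear systems by reflections *)

Definition pos_part (z : int) : nat := if 0 <= z then `|z|%N else 0%N.

Lemma pos_part_sub z : (pos_part z)%:Z - (pos_part (- z))%:Z = z.
Proof. by rewrite /pos_part; do 2!case: ifP; lia. Qed.

Section MutationStep.

Variables (N : nat) (N_ge3 : (3 <= N)%N) (F : fieldType).
Local Notation Kz := (polyring N F).
Variables (s : {rmorphism F -> F}) (n : 'Z_N) (co : bool -> bool -> F).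
Hypothesis sK : involutive s.
Hypothesis co_neq0 : forall b i, co b i != 0.
Hypothesis s_co : forall b i, s (co b i) = co (~~ b) i.
Local Notation exch := (@exch N F n co).
Local Notation exch_ratio := (@exch_ratio F co).
Local Notation mut := (@mut N F s n co).
Hypothesis exch_ratio_neq : exch_ratio true != exch_ratio false.
Implicit Types P Q G : Kz.

Lemma restrC m b c a : restr m b c (a%:MP : Kz) = a%:MP.
Proof. by rewrite /restr psubstC. Qed.

Lemma vanish_scale m b c j a P : a != 0 -> vanish m b c j (a *: P) -> vanish m b c j P.
Proof.
move=> a0; rewrite -mul_mpolyC; apply: vanish_cancel.
by rewrite restrC mpolyC_eq0.
Qed.

Lemma vanish_exch b : vanish n b (exch_ratio b) 1 (exch b).
Proof.
rewrite (exchE n co_neq0) /vanish flowZ flow_center_form mulrCA.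
by exists ((co b false)%:MP%:P * (center_form n (exch_ratio b))%:P); rewrite mulrC.
Qed.

Lemma vanish_exchX b j : vanish n b (exch_ratio b) j (exch b ^+ j).
Proof.
elim: j => [|j IH]; first exact: vanish0.
by rewrite exprS -add1n; apply: vanishM; [apply: vanish_exch|].
Qed.

Lemma vanish_cancel_exch b j m P : vanish n b (exch_ratio b) (j + m) (exch b ^+ j * P) ->
  vanish n b (exch_ratio b) m P.
Proof.
rewrite (exchE n co_neq0) exprZn -scalerAl => /vanish_scale h.
by apply: (@vanish_cancel_center_form _ _ _ _ _ m j); apply: h; rewrite expf_neq0.
Qed.

Lemma vanishMr m b c j P Q : vanish m b c j P -> vanish m b c j (P * Q).
Proof. by move=> h; rewrite -[j]addn0; apply: vanishM => //; apply: vanish0. Qed.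

Definition exch_prod (e : bool -> nat) : Kz := exch true ^+ e true * exch false ^+ e false.

Lemma exch_prodE b e : exch_prod e = exch b ^+ e b * exch (~~ b) ^+ e (~~ b).
Proof. by case: b; rewrite /exch_prod // mulrC. Qed.

Lemma exch_prod_neq0 e : exch_prod e != 0.
Proof. by rewrite mulf_neq0 ?expf_neq0 ?(exch_neq0 n co_neq0). Qed.

Lemma exch_prod_homog m e : factor_homog m ((m == n) * (e true + e false)) (exch_prod e).
Proof. by rewrite mulnDr; apply: factor_homogM; apply: factor_homogX; apply: exch_homog. Qed.

Lemma restr_exch_prod m b c e : (forall i, m = n -> c != exch_ratio i) ->
  restr m b c (exch_prod e) != 0.
Proof.
move=> h; rewrite rmorphM !rmorphXn mulf_neq0 ?expf_neq0 //;
by apply: (restr_exch_neq0 N_ge3 co_neq0); apply: h.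
Qed.

(** [mu b] is the multiplicity of [P] along the center of side [b] over the
    mutated factor. It is negative for the class of an exceptional divisor,
    whose polynomial 1 is then multiplied by an exchange form instead of being
    divided by one. *)
Lemma mut_step (mu : bool -> int) d1 d2 P :
  P != 0 -> factor_homog (n + 1) d1 P -> factor_homog (n - 1) d2 P ->
  (forall b, vanish n b (exch_ratio b) (pos_part (mu b)) P) ->
  exists P', [/\ P' != 0,
    P' * exch_prod (fun b => pos_part (mu (~~ b))) =
      mut P * exch_prod (fun b => pos_part (- mu (~~ b))),
    forall m d, factor_homog m d P -> exists2 d', factor_homog m d' P' &
      d'%:Z = d%:Z + (m == n)%:R * ((d1 + d2)%:Z - mu true - mu false),
    forall b j, j%:Z = (d1 + d2)%:Z - mu (~~ b) -> vanish n b (exch_ratio b) j P' &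
    forall m b c j, compat s n co m b c -> (forall i, m = n -> c != exch_ratio i) ->
      vanish m b c j P -> vanish m b c j P'].
Proof.
move=> P0 h1 h2 hmu.
set gp := exch_prod (fun b => pos_part (mu (~~ b))).
set gn := exch_prod (fun b => pos_part (- mu (~~ b))).
have hI b : ideal_pow (center_gens n b (exch_ratio b)) (pos_part (mu b)) P by apply/vanishP.
have [Q eQ] := mut_dvd N_ge3 co_neq0 s_co exch_ratio_neq (e := fun b => pos_part (mu b)) hI.
have e : Q * gn * gp = mut P * gn.
  by rewrite eQ /gp /exch_prod /= mulrAC [Q * _]mulrC.
have mP0 : mut P != 0.
  by apply: contra_neq P0; apply: (mut_inj sK co_neq0 s_co h1 h2).
have Q0 : Q * gn != 0.
  apply: contra_neq mP0 => Q0; move/eqP: e; rewrite Q0 mul0r eq_sym mulf_eq0.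
  by rewrite (negPf (exch_prod_neq0 _)) orbF => /eqP.
exists (Q * gn); split=> //.
- move=> m d hd; have := mut_homog s co h1 h2 hd.
  move/(factor_homogM (exch_prod_homog m (fun b => pos_part (- mu (~~ b))))).
  rewrite mulrC -/gn -e => hh.
  have [d' ed' hd'] := factor_homog_cancel (exch_prod_neq0 _) Q0 (exch_prod_homog m _) hh.
  exists d' => //; move: ed' => /=.
  have := pos_part_sub (mu true); have := pos_part_sub (mu false).
  by case: (m == n) => /=; lia.
- move=> b j ej.
  have hD := vanishM (vanish_exchX b (pos_part (- mu (~~ b))))
    (mut_vanish_opp N_ge3 s co_neq0 b h1 h2).
  have {hD} hD := vanishMr (exch (~~ b) ^+ pos_part (- mu b)) hD.
  have ep : gp = exch b ^+ pos_part (mu (~~ b)) * exch (~~ b) ^+ pos_part (mu b).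
    by rewrite /gp (exch_prodE b) negbK.
  have en : gn = exch b ^+ pos_part (- mu (~~ b)) * exch (~~ b) ^+ pos_part (- mu b).
    by rewrite /gn (exch_prodE b) negbK.
  have eq1 : exch b ^+ pos_part (- mu (~~ b)) * mut P * exch (~~ b) ^+ pos_part (- mu b) =
      exch b ^+ pos_part (mu (~~ b)) * (exch (~~ b) ^+ pos_part (mu b) * (Q * gn)).
    by rewrite mulrAC -en mulrC -e mulrC ep mulrA.
  have eq2 : (pos_part (- mu (~~ b)) + (d1 + d2) = pos_part (mu (~~ b)) + j)%N.
    by have := pos_part_sub (mu (~~ b)); lia.
  rewrite eq1 eq2 in hD; have := vanish_cancel_exch hD; apply: vanish_cancel.
  rewrite rmorphXn expf_neq0 //; apply: (restr_exch_neq0 N_ge3 co_neq0) => _.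
  by case: b {hD ep en eq1 eq2 ej}; rewrite // eq_sym.
- move=> m b c j hc hn hP.
  apply: (@vanish_cancel _ _ _ _ _ _ gp); first exact: restr_exch_prod.
  rewrite mulrC e; apply: vanishMr; apply: (mut_vanish N_ge3) => //; exact/vanishP.
Qed.

End MutationStep.

Section DefiningPolynomials.

Variables (R : realType) (N : nat) (k l : 'Z_N -> nat) (p : nat).
Hypothesis N_ge3 : (3 <= N)%N.
Hypothesis k_gt0 : forall n, (0 < k n)%N.
Hypothesis l_gt0 : forall n, (0 < l n)%N.
Hypothesis p_suitable : suitable k l p.
Hypothesis kl_eq : forall n : 'Z_N,
  (k (n - 1)%R * k (n + 1)%R = l (n - 1)%R * l (n + 1)%R)%N.
Local Notation ridx := (ridx k l).
Local Notation eidx := (eidx k l).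
Local Notation H2 := (H2 k l).
Local Notation K := (K R k l).
Local Notation Kz := (polyring N K).
Local Notation mono := (@mono R N k l p).
Local Notation reflK := (@reflK R N k l).
Local Notation co := (@co R N k l p).
Local Notation center_exp := (@center_exp N k l).
Implicit Types (r : ridx) (x y : eidx) (La : H2) (P : Kz).

Definition center_side x : bool := chain_pos x <= 0.
Definition center_coord x : K := mono (center_exp (tag x) (chain_pos x)).

(** The linear system of the class [La], in terms of the ring morphisms that
    mutation transports. A negative multiplicity imposes no condition. *)
Definition linsys La P : Prop :=
  (forall n, exists2 d : nat, deg La n = d%:Z & factor_homog n d P) /\
  (forall x (j : nat), mult La x = j%:Z -> vanish (tag x) (center_side x) (center_coord x) j P).

Lemma C_gensE x : C_gens R p x =1 center_gens (tag x) (center_side x) (center_coord x).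
Proof.
case: x => n [i|j] t; rewrite /C_gens /center_gens /center_side /center_coord /chain_pos /=
  !(tnth_nth 0) /=.
  rewrite (expuE k_gt0 l_gt0) // /zeta -!pvarE.
  by case: t => -[|[|[|//]]].
have -> : (- j%:Z <= 0) by lia.
have ej : (mono (expv k l n j.+1))^-1 = mono (center_exp n (- j%:Z)).
  have -> : expv k l n j.+1 = - center_exp n (- j%:Z).
    by rewrite (expvE k_gt0 l_gt0) //; congr (- center_exp n _); lia.
  rewrite -[X in _ = mono X]opprK (monoN R (in_KN (in_K_center_exp k_gt0 l_gt0 p_suitable n _))) //.
rewrite ej /zeta -!pvarE.
by case: t => -[|[|[|//]]].
Qed.

Lemma linsys_def La P : P != 0 -> multihomogeneous P La -> passes_through p P La -> linsys La P.
Proof.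
move=> P0 hom pass; split=> [n|x j ej].
  have [m mP] : exists m, m \in msupp P.
    case e: (msupp P) => [|m s]; last by exists m; rewrite mem_head.
    by move/eqP: e; rewrite msupp_eq0 (negPf P0).
  exists (zdeg m n); first by rewrite -(hom m mP n).
  apply/factor_homogP => m' m'P; apply/eqP; rewrite -eqz_nat.
  have /= := hom m' m'P n; have /= := hom m mP n; rewrite /zexp /zdeg.
  by move=> -> ->.
apply/vanishP; apply: (ideal_pow_ext (C_gensE x)).
by have := pass x; rewrite ej.
Qed.

Lemma co_s r n : rlab r = (n, 0) -> forall b i, reflK r (co n b i) = co n (~~ b) i.
Proof. by move=> er b i; exact: reflK_co. Qed.

Lemma chain_pos_tperm n i x0 x1 x : tag x0 = n -> tag x1 = n ->
  chain_pos x0 = i -> chain_pos x1 = i + 1 -> tag x = n ->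
  chain_pos (tperm x0 x1 x) = pos_swap i (chain_pos x).
Proof.
move=> t0 t1 h0 h1 tx; rewrite /pos_swap; case: tpermP => [->|->|xx0 xx1].
- by rewrite h0 h1 eqxx.
- by rewrite h0 h1 eqxx; case: eqP => //; lia.
case: eqP => [e|_]; first by case: xx0; apply/eqP; rewrite eidx_eq tx t0 e h0 !eqxx.
case: eqP => [e|//]; by case: xx1; apply/eqP; rewrite eidx_eq tx t1 e h1 !eqxx.
Qed.

Lemma linsys_swap r n i La P : rlab r = (n, i) -> i != 0 ->
  linsys La P -> linsys (refl r La) (map_coef (reflK r) P).
Proof.
move=> er i0 [hd hm].
have [x0 [x1 [t0 t1 h0 h1]]] := refl_pos k_gt0 l_gt0 r; rewrite er /= in t0 t1 h0 h1.
have [dE mE] := refl_swap La er i0 t0 t1 h0 h1.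
split=> [m|y j].
  have [d ed hd'] := hd m; exists d; first by rewrite dE.
  exact: map_coef_homog.
rewrite mE; move ex: (tperm x0 x1 y) => x ej.
have {ex} -> : y = tperm x0 x1 x by rewrite -ex tpermK.
have tx : tag (tperm x0 x1 x) = tag x by case: tpermP => // ->; rewrite t0 t1.
have hr : 1 - (l (tag x))%:Z <= chain_pos x <= (k (tag x))%:Z by apply: chain_pos_range.
have sx : center_side (tperm x0 x1 x) = center_side x.
  by rewrite /center_side; case: tpermP => // ->; rewrite h0 h1; apply/idP/idP; lia.
have cx : center_coord (tperm x0 x1 x) = reflK r (center_coord x).
  rewrite /center_coord tx; have [xn|xn] := eqVneq (tag x) n.
    rewrite (chain_pos_tperm t0 t1 h0 h1 xn) xn.
    by rewrite (reflK_center_exp_same R N_ge3 k_gt0 l_gt0 p_suitable er) // -xn.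
  rewrite (reflK_center_exp_other R N_ge3 k_gt0 l_gt0 p_suitable er) //.
  by case: tpermP => // xx; rewrite xx ?t0 ?t1 eqxx in xn.
rewrite tx sx cx; have /vanishP h := hm x j ej.
exact: (map_coef_vanish (reflK r) h).
Qed.

Section MutateAt.

Variables (r : ridx) (n : 'Z_N) (x0 x1 : eidx).
Hypothesis er : rlab r = (n, 0).
Hypotheses (t0 : tag x0 = n) (t1 : tag x1 = n) (h0 : chain_pos x0 = 0) (h1 : chain_pos x1 = 1).

Definition mu La (b : bool) : int := mult La (if b then x0 else x1).

Definition gpos La : Kz := exch_prod n (co n) (fun b => pos_part (mu La (~~ b))).
Definition gneg La : Kz := exch_prod n (co n) (fun b => pos_part (- mu La (~~ b))).

Lemma center_mut b : center_side (if b then x0 else x1) = b /\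
  center_coord (if b then x0 else x1) = exch_ratio (co n) b.
Proof.
rewrite (exch_ratioE R k_gt0 l_gt0 p_suitable); case: b; rewrite /center_side /center_coord.
  by rewrite t0 h0.
by rewrite t1 h1.
Qed.

Lemma tag_mut b : tag (if b then x0 else x1) = n.
Proof. by case: b. Qed.

(** The reflection at [(n, 0)] changes the degree in the factor [n], and the
    multiplicities at C_n^1 and C_n^{-1}, by the same amount c. The degree of
    the mutated polynomial grows by d_{n-1} + d_{n+1}, and dividing by the
    exchange forms subtracts the two multiplicities. *)
Lemma linsys_mut La P : P != 0 -> linsys La P ->
  exists P', [/\ P' != 0, P' * gpos La = mut (reflK r) n (co n) P * gneg La
    & linsys (refl r La) P'].
Proof.
move=> P0 [hd hm].
have [dE mE] := refl_mut La er t0 t1 h0 h1.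
have [d1 ed1 hd1] := hd (n + 1); have [d2 ed2 hd2] := hd (n - 1).
have hmu b : vanish n b (exch_ratio (co n) b) (pos_part (mu La b)) P.
  have [cs cx] := center_mut b.
  rewrite /pos_part; case: ifP => mb; last exact: vanish0.
  have := hm (if b then x0 else x1) `|mu La b|%N; rewrite tag_mut cs cx; apply.
  by rewrite -/(mu La b) gez0_abs.
have [P' [P'0 eP' hom' opp' other']] := mut_step N_ge3 (reflKK r)
  (@co_neq0 R N k l p n) (co_s er) (exch_ratio_neq R N_ge3 k_gt0 l_gt0 p_suitable n)
  P0 hd1 hd2 hmu.
exists P'; split; [exact: P'0 | exact: eP' |]; split=> [m|y j].
  have [d ed hdm] := hd m; have [d' hd' ed'] := hom' m d hdm.
  exists d'; last exact: hd'.
  rewrite dE ed ed1 ed2 ed' /mu PoszD /=.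
  by congr (_ + _ * _); rewrite [d2%:Z + _]addrC -!addrA; congr (_ + (_ + _)); rewrite addrC.
rewrite mE ed1 ed2; have [y0|y0] := eqVneq y x0.
  rewrite y0 orTb mul1r => ej; have [cs cx] := center_mut true.
  rewrite cs cx t0; apply: opp'.
  by rewrite -ej /mu /= PoszD; ring.
have [y1|y1] := eqVneq y x1.
  rewrite y1 orbT mul1r => ej; have [cs cx] := center_mut false.
  rewrite cs cx t1; apply: opp'.
  by rewrite -ej /mu /= PoszD; ring.
rewrite mul0r addr0 => ej.
have hr : 1 - (l (tag y))%:Z <= chain_pos y <= (k (tag y))%:Z by apply: chain_pos_range.
have ny0 : tag y = n -> chain_pos y != 0.
  by move=> ty; apply: contraNneq y0 => e; rewrite eidx_eq ty t0 e h0 !eqxx.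
have ny1 : tag y = n -> chain_pos y != 1.
  by move=> ty; apply: contraNneq y1 => e; rewrite eidx_eq ty t1 e h1 !eqxx.
apply: other'.
- apply: (compat_center_exp R N_ge3 k_gt0 l_gt0 p_suitable kl_eq er hr) => ty.
  by rewrite /pos_swap (negPf (ny0 ty)) add0r (negPf (ny1 ty)).
- move=> i ty; rewrite (exch_ratioE R k_gt0 l_gt0 p_suitable) /center_coord ty.
  apply/eqP => /(mono_center_exp_inj N_ge3 k_gt0 l_gt0 p_suitable) H.
  have := k_gt0 n; have := l_gt0 n; move: (ny0 ty) (ny1 ty) H hr; rewrite ty.
  by case: i => n0 n1 H hr lp kp; have := H _ _; lia.
- exact: hm.
Qed.

End MutateAt.

End DefiningPolynomials.

(** * The polynomial attached to a word *)

(** The bookkeeping of exponents in one mutation: [A], [B] are the values of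
    the exchange forms, [t0], [t1] those of tau_n^{-1}, tau_n^1, and [O] the
    contribution of the other tau variables. *)
Lemma mut_eval_identity (F : fieldType) (t A B t0 t1 O M E : F) (a b : int) (D : nat) :
  A != 0 -> B != 0 -> t0 != 0 -> t1 != 0 ->
  t * ((B / t1) ^ b * ((A / t0) ^ a * O)) = (t0 * t1) ^- D * M ->
  E * (A ^+ pos_part a * B ^+ pos_part b) = M * (A ^+ pos_part (- a) * B ^+ pos_part (- b)) ->
  E = t * (t0 ^ (D%:Z - a) * (t1 ^ (D%:Z - b) * O)).
Proof.
move=> A0 B0 t00 t10.
have split_exp (x : F) z : x != 0 -> x ^ z = x ^+ pos_part z / x ^+ pos_part (- z).
  by move=> x0; rewrite -{1}(pos_part_sub z) expfzDr // -exprnN exprnP.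
have subz (x : F) z : x != 0 -> x ^ (D%:Z - z) = x ^+ D / x ^ z.
  by move=> x0; rewrite expfzDr // -exprnP invr_expz.
rewrite !expfzMl !exprz_inv !subz // -!invr_expz !(split_exp A) // !(split_exp B) // exprMn.
have Ap : A ^+ pos_part a != 0 by rewrite expf_neq0.
have An : A ^+ pos_part (- a) != 0 by rewrite expf_neq0.
have Bp : B ^+ pos_part b != 0 by rewrite expf_neq0.
have Bn : B ^+ pos_part (- b) != 0 by rewrite expf_neq0.
have T0 : t0 ^ a != 0 by rewrite expfz_neq0.
have T1 : t1 ^ b != 0 by rewrite expfz_neq0.
have D0 : t0 ^+ D != 0 by rewrite expf_neq0.
have D1 : t1 ^+ D != 0 by rewrite expf_neq0.
move: (A ^+ pos_part a) (A ^+ pos_part (- a)) (B ^+ pos_part b) (B ^+ pos_part (- b))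
  (t0 ^ a) (t1 ^ b) (t0 ^+ D) (t1 ^+ D) Ap An Bp Bn T0 T1 D0 D1
  => ap an bp bn u0 u1 v0 v1 Ap An Bp Bn T0 T1 D0 D1 e1 e2.
have -> : E = M * (an * bn) / (ap * bp) by rewrite -e2 mulfK // mulf_neq0.
have -> : M = v0 * v1 * (t * (bp / bn / u1 * (ap / an / u0 * O))).
  by rewrite e1 mulVKf // mulf_neq0.
field; do ?[apply/andP; split]; assumption.
Qed.

Lemma rmorph_prodz (F G : fieldType) (f : {rmorphism F -> G}) (I : finType)
  (x : I -> F) (z : I -> int) : f (\prod_i x i ^ z i) = \prod_i f (x i) ^ z i.
Proof. by rewrite rmorph_prod; apply: eq_bigr => i _; exact: fmorphXz. Qed.

Lemma prod_two (F : fieldType) (I : finType) (x0 x1 : I) (f : I -> F) : x0 != x1 ->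
  \prod_i f i = f x0 * (f x1 * \prod_(i | (i != x0) && (i != x1)) f i).
Proof. by move=> x01; rewrite (bigD1 x0) //= (bigD1 x1) //= eq_sym. Qed.

Lemma mut_eval_prod (F : fieldType) (I : finType) (x0 x1 : I) (T T' : I -> F)
    (m m' : I -> int) (t A B M E : F) (D : nat) : x0 != x1 ->
  A != 0 -> B != 0 -> T x0 != 0 -> T x1 != 0 ->
  T' x0 = B / T x1 -> T' x1 = A / T x0 ->
  (forall x, x != x0 -> x != x1 -> T' x = T x) ->
  m' x0 = D%:Z - m x1 -> m' x1 = D%:Z - m x0 ->
  (forall x, x != x0 -> x != x1 -> m' x = m x) ->
  t * \prod_x T' x ^ m x = (T x0 * T x1) ^- D * M ->
  E * (A ^+ pos_part (m x1) * B ^+ pos_part (m x0)) =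
    M * (A ^+ pos_part (- m x1) * B ^+ pos_part (- m x0)) ->
  E = t * \prod_x T x ^ m' x.
Proof.
move=> x01 A0 B0 t0 t1 e0 e1 eT f0 f1 fm.
rewrite (prod_two _ x01) [in X in _ -> _ -> X](prod_two _ x01) e0 e1 f0 f1.
have -> : \prod_(x | (x != x0) && (x != x1)) T' x ^ m x =
    \prod_(x | (x != x0) && (x != x1)) T x ^ m x.
  by apply: eq_bigr => x /andP[h0 h1]; rewrite eT.
have -> : \prod_(x | (x != x0) && (x != x1)) T x ^ m' x =
    \prod_(x | (x != x0) && (x != x1)) T x ^ m x.
  by apply: eq_bigr => x /andP[h0 h1]; rewrite fm.
exact: mut_eval_identity.
Qed.

Lemma rmorph_expM (S T : pzRingType) (f : {rmorphism S -> T}) a b i j c d :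
  f a = c -> f b = d -> f (a ^+ i * b ^+ j) = c ^+ i * d ^+ j.
Proof. by move=> <- <-; rewrite rmorphM !rmorphXn. Qed.

Section Construction.

Variables (R : realType) (N : nat) (k l : 'Z_N -> nat) (p : nat).
Hypothesis N_ge3 : (3 <= N)%N.
Hypothesis k_gt0 : forall n, (0 < k n)%N.
Hypothesis l_gt0 : forall n, (0 < l n)%N.
Hypothesis p_suitable : suitable k l p.
Hypothesis kl_eq : forall n : 'Z_N,
  (k (n - 1)%R * k (n + 1)%R = l (n - 1)%R * l (n + 1)%R)%N.
Local Notation ridx := (ridx k l).
Local Notation eidx := (eidx k l).
Local Notation H2 := (H2 k l).
Local Notation K := (K R k l).
Local Notation L := (L R k l).
Local Notation Kz := (polyring N K).
Local Notation in_K := (@in_K N k l p).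
Local Notation mono := (@mono R N k l p).
Local Notation reflK := (@reflK R N k l).
Local Notation reflL := (@reflL R N k l p).
Local Notation co := (@co R N k l p).
Local Notation tfL := (@tfL R N k l).
Local Notation jet := (@jet R N k l p).
Local Notation integral := (@integral_laurent R N k l p).
Local Notation linsys := (@linsys R N k l p).
Local Notation corner_coef := (@corner_coef N K).
Local Notation eval_theta := (@eval_theta R N k l).
Implicit Types (r : ridx) (x y : eidx) (La : H2) (P : Kz).

Lemma H2_eq La Lb : (forall m, deg La m = deg Lb m) ->
  (forall x, mult La x = mult Lb x) -> La = Lb.
Proof.
case: La Lb => [a1 a2] [b1 b2] h1 h2; congr (_, _); apply/ffunP => i; first exact: h1.
by have := h2 i; rewrite /mult /= => /oppr_inj.
Qed.

Lemma reflKH r : involutive (@refl N k l r).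
Proof.
move=> La; case er: (rlab r) => [n i].
have [x0 [x1 [t0 t1 h0 h1]]] := refl_pos k_gt0 l_gt0 r; rewrite er /= in t0 t1 h0 h1.
have [i0|i0] := eqVneq i 0; last first.
  have [d1 m1] := refl_swap La er i0 t0 t1 h0 h1.
  have [d2 m2] := refl_swap (refl r La) er i0 t0 t1 h0 h1.
  by apply: H2_eq => [m|x]; [rewrite d2 d1 | rewrite m2 m1 tpermK].
rewrite i0 ?add0r in er h0 h1.
have [d1 m1] := refl_mut La er t0 t1 h0 h1.
have [d2 m2] := refl_mut (refl r La) er t0 t1 h0 h1.
have x01 : (x1 == x0) = false by rewrite eidx_eq h0 h1 andbF.
have e1 : (n - 1 == n) = false by rewrite ZN_pred_neq.
have e2 : (n + 1 == n) = false by rewrite ZN_succ_neq.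
apply: H2_eq => [m|x]; rewrite ?d2 ?m2 !m1 !d1 e1 e2 eqxx x01 /= eqxx.
  by case: (m == n) => /=; ring.
by case: (_ || _) => /=; ring.
Qed.

(** What a word provides: a polynomial of the linear system of [La] that
    satisfies the tau function formula, with the data that determine its
    normalization. Integrality is needed to exploit primitivity, and to
    compute the gradient. *)
Record constructed La P (t : L) : Prop := Constructed {
  con_neq0 : P != 0;
  con_linsys : linsys La P;
  con_corner_coef : exists2 e, in_K e & corner_coef P = mono e;
  con_eval_theta : exists2 w, 0 < w & jet (eval_theta P) w 0;
  con_int : forall m, integral P@_m;
  con_eval_tau : eval_tau tfL P = t * \prod_x tauX R x ^ mult La x }.

Lemma constructed_base x :
  constructed (clE k l (elab x).1 (elab x).2) 1 (tauX R x).
Proof.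
have mE y : mult (clE k l (elab x).1 (elab x).2) y = - (y == x)%:R.
  by rewrite clEE /mult /= ffunE.
split.
- exact: oner_neq0.
- split=> [n|y j].
    exists 0%N; first by rewrite /deg clEE /= ffunE.
    by rewrite /factor_homog !rmorph1 mulr1.
  rewrite mE; case: eqP => _ ej; first by lia.
  have -> : j = 0%N by lia.
  exact: vanish0.
- by exists 0; [exact: in_K0 | rewrite mono0; exact: (rmorph1 corner_coef)].
- exists 1 => //; have -> : eval_theta 1 = 1 by exact: (rmorph1 eval_theta).
  exact: jet1.
- move=> m; rewrite mcoeff1; case: (m == _).
  exact: (@intlaurent1 R N k l p).
  exact: (@intlaurent0 R N k l p).
- have -> : \prod_y tauX R y ^ mult (clE k l (elab x).1 (elab x).2) y = (tauX R x)^-1.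
    rewrite (bigD1 x) //= mE eqxx big1 => [|y /negPf yx]; last by rewrite mE yx expr0z.
    exact: mulr1.
  apply: etrans (rmorph1 (eval_tau tfL)) _; apply/esym; apply: divff; exact: tauX_neq0.
Qed.

Lemma integral_poly_map_coef r P : (forall m, integral P@_m) ->
  forall m, integral (map_coef (reflK r) P)@_m.
Proof.
move=> hP.
have I0 : integral 0 := @intlaurent0 R N k l p.
have I1 : integral 1 := @intlaurent1 R N k l p.
have ID a b : integral a -> integral b -> integral (a + b) by exact: integralD.
have IM a b : integral a -> integral b -> integral (a * b) by exact: integralM.
apply: (IntP_psub I0 I1 ID IM (s := reflK r)) hP => [c|z]; first exact: integral_refl.
exact: IntP_pvar.
Qed.

Lemma constructed_swap r n i La P t : rlab r = (n, i) -> i != 0 ->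
  constructed La P t -> constructed (refl r La) (map_coef (reflK r) P) (reflL r t).
Proof.
move=> er i0 [P0 hV [e he hrho] [w w0 hkap] hint hev].
have [x0 [x1 [t0 t1 h0 h1]]] := refl_pos k_gt0 l_gt0 r; rewrite er /= in t0 t1 h0 h1.
have [dE mE] := refl_swap La er i0 t0 t1 h0 h1.
split.
- apply: contra_neq P0 => e0; rewrite -(map_coefK (reflKK r) P) e0; exact: rmorph0.
- exact: (linsys_swap _ _ _ _ er).
- exists (refl_exp r e); first exact: in_K_refl_exp.
  apply: etrans (corner_coef_map_coef _ _) _; rewrite hrho; exact: reflK_mono.
- exists w => //; rewrite -(refl_exp0 r); exact: jet_eval_theta_map_coef.
- exact: integral_poly_map_coef.
- rewrite -(reflL_eval_tau_swap N_ge3 k_gt0 l_gt0 p_suitable P er i0) hev.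
  apply: etrans (rmorphM (reflL r) _ _) _; apply: congr1.
  apply: etrans (rmorph_prodz (reflL r) _ _) _.
  have e1 x : reflL r (tauX R x) = tauX R (tperm x0 x1 x).
    apply: etrans (reflL_tauX R N_ge3 k_gt0 l_gt0 p_suitable r x) _.
    rewrite (refl_tau_swap R p er i0 t0 t1 h0 h1) /tau_swap.
    exact/esym/tauXE.
  rewrite [RHS](reindex_inj (@perm_inj _ (tperm x0 x1))) /=.
  apply: eq_bigr => x _; rewrite mE tpermK e1; reflexivity.
Qed.

Let p0 : (0 < p)%N := p_gt0 p_suitable.

Definition ismono (c : K) : Prop := exists2 e, in_K e & c = mono e.

Lemma ismonoM a b : ismono a -> ismono b -> ismono (a * b).
Proof.
by move=> [e he ->] [f hf ->]; exists (e + f); [exact: in_KD | rewrite (monoD R)].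
Qed.

Lemma ismono1 : ismono 1.
Proof. by exists 0; [exact: in_K0 | rewrite mono0]. Qed.

Lemma ismonoX a d : ismono a -> ismono (a ^+ d).
Proof.
move=> ha; elim: d => [|d IH]; first exact: ismono1.
by rewrite exprS; exact: ismonoM.
Qed.

Lemma ismonoV a : ismono a -> ismono a^-1.
Proof. by move=> [e he ->]; exists (- e); [exact: in_KN | rewrite (monoN R)]. Qed.

Lemma ismono_neq0 a : ismono a -> a != 0.
Proof. by move=> [e he ->]; exact: mono_neq0. Qed.

Lemma ismono_div a b c d : ismono b -> ismono c -> ismono d -> a * b = c * d -> ismono a.
Proof.
move=> hb hc hd e; have -> : a = c * d * b^-1 by rewrite -e mulfK // ismono_neq0.
by apply: ismonoM; [exact: ismonoM | exact: ismonoV].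
Qed.

Lemma ismono_refl r a : ismono a -> ismono (reflK r a).
Proof.
by move=> [e he ->]; exists (refl_exp r e); [exact: in_K_refl_exp | exact: reflK_mono].
Qed.

Lemma ismono_co n b i : ismono (co n b i).
Proof. by exists (co_exp k l n b i) => //; exact: in_K_co_exp. Qed.

Lemma ismono_corner_coef_exch_prod n e : ismono (corner_coef (exch_prod n (co n) e)).
Proof.
have -> : corner_coef (exch_prod n (co n) e) =
  co n true false ^+ e true * co n false false ^+ e false.
  exact: (rmorph_expM (f := corner_coef) _ _ (corner_coef_exch n (co n) true)
    (corner_coef_exch n (co n) false)).
by apply: ismonoM; apply: ismonoX; apply: ismono_co.
Qed.

Lemma integral_ismono a : ismono a -> integral a.
Proof. by move=> [e he ->]; exact: integral_mono. Qed.

Let I0 : integral 0 := @intlaurent0 R N k l p.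
Let I1 : integral 1 := @intlaurent1 R N k l p.
Let ID a b : integral a -> integral b -> integral (a + b). Proof. exact: integralD. Qed.
Let IN a : integral a -> integral (- a). Proof. exact: integralN. Qed.
Let IM a b : integral a -> integral b -> integral (a * b). Proof. exact: integralM. Qed.
Local Notation IntP := (@IntP N K integral).

Lemma IntP_exch n b : IntP (exch n (co n) b).
Proof.
apply: (IntPD ID); apply: (IntPZ IM);
  by [apply: integral_ismono; exact: ismono_co | exact: (IntP_pvar I0 I1)].
Qed.

Lemma IntP_exch_prod n e : IntP (exch_prod n (co n) e).
Proof. by apply: (IntPM I0 ID IM); apply: (IntPX I0 I1 ID IM); exact: IntP_exch. Qed.

Lemma IntP_mut r n P : IntP P -> IntP (mut (reflK r) n (co n) P).
Proof.
move=> hP; apply: (IntP_psub I0 I1 ID IM (s := reflK r)) hP => [c|z].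
  exact: integral_refl.
apply: (IntPM I0 ID IM); last exact: (IntP_pvar I0 I1).
rewrite exch_factorE; apply: (IntPM I0 ID IM); apply: (IntPX I0 I1 ID IM); exact: IntP_exch.
Qed.

Lemma IntP_cancel_exch n b d P : IntP (P * exch n (co n) b ^+ d) -> IntP P.
Proof.
elim: d P => [|d IH] P; first by rewrite expr0 mulr1.
rewrite exprS mulrA => /IH; rewrite mulrC.
apply: (IntP_div I0 ID IN IM).
- exact: co_neq0.
- by apply: integral_ismono; apply: ismonoV; exact: ismono_co.
- by apply: integral_ismono; exact: ismono_co.
Qed.

Lemma IntP_cancel_exch_prod n e P : IntP (P * exch_prod n (co n) e) -> IntP P.
Proof. by rewrite mulrA => /IntP_cancel_exch/IntP_cancel_exch. Qed.

Lemma IntP_jet_eval_theta P : IntP P -> exists w nu, jet (eval_theta P) w nu.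
Proof.
move=> hP; have -> : eval_theta P = \sum_(m <- msupp P) P@_m * eval_theta 'X_[m].
  rewrite {1}(mpolyE P); apply: etrans (rmorph_sum eval_theta _ _ _) _.
  by apply: eq_bigr => m _; exact: eval_thetaZ.
elim: (msupp P) => [|m s [w [nu IH]]]; first by exists 0, 0; rewrite big_nil; exact: jet0.
have [z [e h]] := integral_jet (hP m).
have hk : jet (eval_theta 'X_[m]) (theta_weight k l m) 0 by rewrite eval_thetaX; exact: jet_q.
have H := jetD (jetM h hk) IH; rewrite big_cons; eexists; eexists; exact: H.
Qed.

Lemma jet_eval_theta_exch_prod n e : exists2 c, 0 < c & jet (eval_theta (exch_prod n (co n) e)) c 0.
Proof.
pose c : rat := inv_theta k l (n, false) + inv_theta k l (n, true).
have c0 : 0 < c by exact: (addr_gt0 (inv_theta_gt0 l k_gt0 _) (inv_theta_gt0 l k_gt0 _)).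
exists (c ^+ e true * c ^+ e false); first by rewrite mulr_gt0 ?exprn_gt0.
have -> : eval_theta (exch_prod n (co n) e) =
    eval_theta (exch n (co n) true) ^+ e true * eval_theta (exch n (co n) false) ^+ e false.
  exact: (rmorph_expM (f := eval_theta) _ _ erefl erefl).
by apply: jetM0; apply: jet_pow0; exact: jet_eval_theta_exch.
Qed.

Lemma constructed_mut r n La P t : rlab r = (n, 0) ->
  constructed La P t -> exists P', constructed (refl r La) P' (reflL r t).
Proof.
move=> er [P0 hV [e he hrho] [w w0 hkap] hint hev].
have [x0 [x1 [t0 t1 h0 h1]]] := refl_pos k_gt0 l_gt0 r.
rewrite er /= add0r in t0 t1 h0 h1.
have [dE mE] := refl_mut La er t0 t1 h0 h1.
have [P' [P'0 eP' hV']] :=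
  linsys_mut N_ge3 k_gt0 l_gt0 p_suitable kl_eq er t0 t1 h0 h1 P0 hV.
have [d1 ed1 hd1] := hV.1 (n + 1); have [d2 ed2 hd2] := hV.1 (n - 1).
have hint' : IntP P'.
  have hG : IntP (P' * gpos R p n x0 x1 La).
    rewrite eP'; apply: (IntPM I0 ID IM); first exact: IntP_mut.
    exact: IntP_exch_prod.
  exact: IntP_cancel_exch_prod hG.
exists P'; split.
- exact: P'0.
- exact: hV'.
- have er1 : corner_coef P' * corner_coef (gpos R p n x0 x1 La) =
      corner_coef (mut (reflK r) n (co n) P) * corner_coef (gneg R p n x0 x1 La).
    apply: etrans (esym (rmorphM corner_coef _ _)) _; rewrite eP'; exact: (rmorphM corner_coef).
  apply: (ismono_div _ _ _ er1);
    [exact: ismono_corner_coef_exch_prod | | exact: ismono_corner_coef_exch_prod].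
  have h : corner_coef (mut (reflK r) n (co n) P) = _ := corner_coef_mut (reflK r) (co n) hd1 hd2.
  rewrite h hrho.
  apply: ismonoM; first by apply: ismonoX; exact: ismono_co.
  apply: ismonoM; first by apply: ismonoX; exact: ismono_co.
  by apply: ismono_refl; exists e.
(* The exchange forms have value positive and gradient 0, so the equation
   between P' and the mutation of P determines those of P'. *)
- have [w' [nu' hk']] := IntP_jet_eval_theta hint'.
  have [cp cp0 hp] := jet_eval_theta_exch_prod n (fun b => pos_part (mu x0 x1 La (~~ b))).
  have [cn cn0 hn] := jet_eval_theta_exch_prod n (fun b => pos_part (- mu x0 x1 La (~~ b))).
  have hm := jet_eval_theta_mut k_gt0 p_suitable er hd1 hd2 hint hkap.
  set c := inv_theta k l (n, false) + inv_theta k l (n, true) in hm.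
  have c0 : 0 < c by exact: (addr_gt0 (inv_theta_gt0 l k_gt0 _) (inv_theta_gt0 l k_gt0 _)).
  have ek : eval_theta P' * eval_theta (gpos R p n x0 x1 La) =
      eval_theta (mut (reflK r) n (co n) P) * eval_theta (gneg R p n x0 x1 La).
    apply: etrans (esym (rmorphM eval_theta _ _)) _; rewrite eP'; exact: (rmorphM eval_theta).
  have l1 := jetM hk' hp; rewrite ek in l1.
  have [ew enu] := jet_inj p0 l1 (jetM hm hn).
  have w'E : w' = c ^+ (d1 + d2) * w * cn / cp by rewrite -ew mulfK ?gt_eqF.
  exists w'; first by rewrite w'E divr_gt0 ?mulr_gt0 ?exprn_gt0.
  suff nu0 : nu' = 0 by rewrite -nu0.
  apply: (scalerI (lt0r_neq0 cp0)); move: enu; rewrite refl_exp0 !scaler0 !addr0.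
  exact.
- exact: hint'.
- pose T x : L := tauX R x; pose T' x : L := refl_tau R p r x.
  have hT' : T' =1 tau_mut tfL n (co n) x0 x1 := refl_tau_mut R p er t0 t1 h0 h1.
  have x01 : x0 != x1 by rewrite eidx_eq h0 h1 andbF.
  apply: (@mut_eval_prod L eidx x0 x1 T T' (mult La) (mult (refl r La)) (reflL r t)
    (eval_tau tfL (exch n (co n) true)) (eval_tau tfL (exch n (co n) false))
    (eval_tau tfL (mut (reflK r) n (co n) P)) (eval_tau tfL P') (d1 + d2)%N x01).
  + exact: (eval_tau_exch_neq0 N_ge3 k_gt0 (@tfL_inj R N k l) n (@co_neq0 R N k l p n)).
  + exact: (eval_tau_exch_neq0 N_ge3 k_gt0 (@tfL_inj R N k l) n (@co_neq0 R N k l p n)).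
  + exact: tauX_neq0.
  + exact: tauX_neq0.
  + rewrite hT' /tau_mut (negPf x01) eqxx /T tauXE; reflexivity.
  + rewrite hT' /tau_mut eqxx /T tauXE; reflexivity.
  + by move=> x n0 n1; rewrite hT' /tau_mut (negPf n0) (negPf n1) /T tauXE.
  + by rewrite mE ed1 ed2 eqxx PoszD /=; ring.
  + by rewrite mE ed1 ed2 eqxx orbT PoszD /=; ring.
  + by move=> x n0 n1; rewrite mE (negPf n0) (negPf n1) mul0r addr0.
  + have E1 := reflL_eval_tau_mut N_ge3 k_gt0 l_gt0 p_suitable er t0 t1 h0 h1 hd1 hd2.
    rewrite /T !tauXE -E1 hev.
    apply/esym; apply: etrans (rmorphM (reflL r) _ _) _; apply: congr1.
    apply: etrans (rmorph_prodz (reflL r) _ _) _.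
    have e1 x : reflL r (tauX R x) = T' x.
      exact: (reflL_tauX R N_ge3 k_gt0 l_gt0 p_suitable r x).
    by apply: eq_bigr => x _ /=; rewrite e1.
  + have evl (f : bool -> nat) : eval_tau tfL (exch_prod n (co n) f) =
        eval_tau tfL (exch n (co n) true) ^+ f true * eval_tau tfL (exch n (co n) false) ^+ f false.
      exact: (rmorph_expM (f := eval_tau tfL) _ _ erefl erefl).
    have e1 : eval_tau tfL P' * eval_tau tfL (gpos R p n x0 x1 La) =
        eval_tau tfL (mut (reflK r) n (co n) P) * eval_tau tfL (gneg R p n x0 x1 La).
      apply: etrans (esym (rmorphM (eval_tau tfL) _ _)) _; rewrite eP';
        exact: (rmorphM (eval_tau tfL)).
    rewrite !evl in e1; exact: e1.
Qed.

Lemma constructed_word ws x : exists P,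
  constructed (wact ws (clE k l (elab x).1 (elab x).2)) P (wactL p ws (tauX R x)).
Proof.
elim: ws => [|r ws [P hP]]; first by exists 1; exact: constructed_base.
case er: (rlab r) => [n i]; have [i0|i0] := eqVneq i 0.
  by rewrite i0 in er; exact: (constructed_mut er hP).
by exists (map_coef (reflK r) P); exact: (constructed_swap er).
Qed.

End Construction.

(** * Linear systems are one-dimensional *)

Lemma factor_homog0_const (N : nat) (F : fieldType) (P : polyring N F) :
  (forall n, factor_homog n 0 P) -> P = P@_0%MM *: 1.
Proof.
move=> h; apply/mpolyP => m; rewrite mcoeffZ mcoeff1.
have [->|m0] := eqVneq m 0%MM; first by rewrite mulr1.
rewrite mulr0; apply: memN_msupp_eq0; apply: contraNN m0 => mP.
apply/eqP/mnmP => i; rewrite mnm0E -(enum_valK i).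
case: (enum_val i) => n b; have := (factor_homogP _ _ _).1 (h n) m mP.
by move/eqP; rewrite /zdeg addn_eq0 => /andP[/eqP e0 /eqP e1]; case: b.
Qed.

Lemma map_coefZ (N : nat) (F : fieldType) (s : {rmorphism F -> F}) c (P : polyring N F) :
  map_coef s (c *: P) = s c *: map_coef s P.
Proof. by rewrite -!mul_mpolyC rmorphM /= map_coefC. Qed.

Lemma scale_ratio (F : fieldType) (V : lmodType F) (u v w : V) a b :
  b != 0 -> u = b *: w -> v = a *: w -> v = (a / b) *: u.
Proof. by move=> b0 -> ->; rewrite scalerA divfK. Qed.

Lemma quotient_ratio (N : nat) (F : fieldType) (Q1 Q2 M1 M2 G G' : polyring N F) c :
  G' != 0 -> Q1 * G = M1 * G' -> Q2 * G = M2 * G' -> Q2 = c *: Q1 -> M2 = c *: M1.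
Proof.
move=> G0 e1 e2 e; apply: (mulIf G0).
by rewrite -e2 e -!scalerAl e1.
Qed.

Lemma mut_proportional (N : nat) (F : fieldType) (s : {rmorphism F -> F}) (n : 'Z_N)
    (co : bool -> bool -> F) d1 d2 (P1 P2 : polyring N F) c :
  involutive s -> (forall b i, co b i != 0) ->
  (forall b i, s (co b i) = co (~~ b) i) ->
  factor_homog (n + 1) d1 P1 -> factor_homog (n - 1) d2 P1 ->
  factor_homog (n + 1) d1 P2 -> factor_homog (n - 1) d2 P2 ->
  mut s n co P2 = c *: mut s n co P1 -> P2 = s c *: P1.
Proof.
move=> sK co0 s_co h1 h2 h1' h2' e.
have hom m d : factor_homog m d P1 -> factor_homog m d P2 -> factor_homog m d (P2 + (- s c) *: P1).
  by move=> a1 a2; exact: factor_homogD a2 (factor_homogZ _ a1).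
have eq0 : mut s n co (P2 + (- s c) *: P1) = 0.
  by rewrite rmorphD /= mutZ rmorphN /= sK e scaleNr subrr.
have := mut_inj sK co0 s_co (hom _ _ h1 h1') (hom _ _ h2 h2') eq0.
by move/eqP; rewrite scaleNr subr_eq0 => /eqP.
Qed.

Section Uniqueness.

Variables (R : realType) (N : nat) (k l : 'Z_N -> nat) (p : nat).
Hypothesis N_ge3 : (3 <= N)%N.
Hypothesis k_gt0 : forall n, (0 < k n)%N.
Hypothesis l_gt0 : forall n, (0 < l n)%N.
Hypothesis p_suitable : suitable k l p.
Hypothesis kl_eq : forall n : 'Z_N,
  (k (n - 1)%R * k (n + 1)%R = l (n - 1)%R * l (n + 1)%R)%N.
Local Notation ridx := (ridx k l).
Local Notation eidx := (eidx k l).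
Local Notation H2 := (H2 k l).
Local Notation K := (K R k l).
Local Notation Kz := (polyring N K).
Local Notation reflK := (@reflK R N k l).
Local Notation co := (@co R N k l p).
Local Notation linsys := (@linsys R N k l p).
Implicit Types (r : ridx) (x y : eidx) (La : H2) (P : Kz).

Definition linsys_unique La : Prop := forall P1 P2, P1 != 0 -> P2 != 0 ->
  linsys La P1 -> linsys La P2 -> exists c, P2 = c *: P1.

(** For an exceptional class the degree is 0 and no vanishing is imposed:
    these are the constants. *)
Lemma linsys_unique_base x : linsys_unique (clE k l (elab x).1 (elab x).2).
Proof.
have const P : linsys (clE k l (elab x).1 (elab x).2) P -> P = P@_0%MM *: 1.
  move=> [hd _]; apply: factor_homog0_const => n; have [d ed h] := hd n.
  by move: ed; rewrite clEE /deg /= ffunE => -[->].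
move=> P1 P2 n1 _ /const e1 /const e2.
have c1 : P1@_0%MM != 0 by apply: contra_neq n1 => c1; rewrite e1 c1 scale0r.
exists (P2@_0%MM / P1@_0%MM); exact: scale_ratio c1 e1 e2.
Qed.

Lemma linsys_unique_swap r n i La : rlab r = (n, i) -> i != 0 ->
  linsys_unique La -> linsys_unique (refl r La).
Proof.
move=> er i0 hu P1 P2 n1 n2 h1 h2.
have h P : P != 0 -> linsys (refl r La) P ->
    map_coef (reflK r) P != 0 /\ linsys La (map_coef (reflK r) P).
  move=> nP hP; split; last first.
    by rewrite -(reflKH k_gt0 l_gt0 r La); exact: (linsys_swap _ _ _ _ er).
  apply: contra_neq nP => e0; rewrite -(map_coefK (reflKK r) P) e0; exact: rmorph0.
have [m1 v1] := h _ n1 h1; have [m2 v2] := h _ n2 h2.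
have [c ec] := hu _ _ m1 m2 v1 v2; exists (reflK r c).
rewrite -(map_coefK (reflKK r) P2) ec; apply: etrans (map_coefZ _ _ _) _.
by rewrite (map_coefK (reflKK r) P1).
Qed.

Lemma linsys_unique_mut r n La : rlab r = (n, 0) -> linsys_unique La -> linsys_unique (refl r La).
Proof.
move=> er hu P1 P2 n1 n2 h1 h2.
have [x0 [x1 [t0 t1 e0 e1]]] := refl_pos k_gt0 l_gt0 r.
rewrite er /= add0r in t0 t1 e0 e1.
have [Q1 [m1 E1]] := linsys_mut N_ge3 k_gt0 l_gt0 p_suitable kl_eq er t0 t1 e0 e1 n1 h1.
have [Q2 [m2 E2]] := linsys_mut N_ge3 k_gt0 l_gt0 p_suitable kl_eq er t0 t1 e0 e1 n2 h2.
rewrite (reflKH k_gt0 l_gt0) => v2 v1.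
have [c ec] := hu _ _ m1 m2 v1 v2; exists (reflK r c).
have [d1 ed1 H1] := h1.1 (n + 1); have [d2 ed2 H2] := h1.1 (n - 1).
have [d1' ed1' H1'] := h2.1 (n + 1); have [d2' ed2' H2'] := h2.1 (n - 1).
have E : mut (reflK r) n (co n) P2 = c *: mut (reflK r) n (co n) P1.
  have G0 : gneg R p n x0 x1 (refl r La) != 0.
    exact: (exch_prod_neq0 _ (@co_neq0 R N k l p n)).
  exact: quotient_ratio G0 E1 E2 ec.
have dd1 : d1' = d1 by move: ed1'; rewrite ed1 => -[].
have dd2 : d2' = d2 by move: ed2'; rewrite ed2 => -[].
rewrite dd1 in H1'; rewrite dd2 in H2'.
exact: (mut_proportional (reflKK r) (@co_neq0 R N k l p n)
  (co_s R N_ge3 k_gt0 l_gt0 p_suitable er) H1 H2 H1' H2' E).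
Qed.

Lemma linsys_unique_word ws x : linsys_unique (wact ws (clE k l (elab x).1 (elab x).2)).
Proof.
elim: ws => [|r ws IH]; first exact: linsys_unique_base.
case er: (rlab r) => [n i]; have [i0|i0] := eqVneq i 0.
  by rewrite i0 in er; exact: (linsys_unique_mut er).
exact: (linsys_unique_swap er).
Qed.

End Uniqueness.

(** * The normalization constant *)

Section NormalizationConstant.

Variables (R : realType) (N : nat) (k l : 'Z_N -> nat) (p : nat).
Hypothesis p_gt0 : (0 < p)%N.
Local Notation expo := (expo k l).
Local Notation K := (K R k l).
Local Notation Kz := (polyring N K).
Local Notation in_K := (@in_K N k l p).
Local Notation mono := (@mono R N k l p).
Local Notation jet := (@jet R N k l p).
Local Notation integral := (@integral_laurent R N k l p).
Local Notation corner_coef := (@corner_coef N K).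
Local Notation eval_theta := (@eval_theta R N k l).

Definition corner (m : 'X_{1..#|zidx N|}) : bool :=
  [forall z : zidx N, z.2 ==> (m (enum_rank z) == 0%N)].

Lemma corner_coef_mon m : corner_coef 'X_[m] = (corner m)%:R.
Proof.
rewrite -[corner_coef _]/(psubst idfun (fun z => (~~ z.2)%:R) _) psubstXm /corner;
  case: forallP => h.
  rewrite big1 // => z _; have := h z; case: z.2 => /= [/eqP ->|_].
    exact: expr0.
  exact: expr1n.
have [z] : exists z : zidx N, ~~ (z.2 ==> (m (enum_rank z) == 0%N)).
  by apply/existsP; rewrite -negb_forall; apply/forallP.
rewrite negb_imply => /andP[z2 mz].
apply/eqP; rewrite prodf_seq_eq0; apply/hasP; exists z; first exact: mem_index_enum.
by rewrite z2 /= expf_eq0 eqxx lt0n mz.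
Qed.

Lemma jet_mono_sum (s : seq expo) : (forall e, e \in s -> in_K e) ->
  exists nu, jet (\sum_(e <- s) mono e) (size s)%:R nu.
Proof.
elim: s => [|e s IH] h; first by exists 0; rewrite big_nil; exact: jet0.
have [|nu hnu] := IH; first by move=> f fs; apply: h; rewrite in_cons fs orbT.
have h1 := jet_mono R 1 (h e (mem_head _ _)); rewrite rmorph1 mul1r in h1.
exists (1 *: e + nu); rewrite big_cons /= -natr1 [_%:R + 1]addrC; exact: jetD h1 hnu.
Qed.

(** An invertible element has value 1 or -1 at the point where all variables
    are 1, and the value of a sum of monic monomials is their number. *)
Lemma unit_mono_sum (s : seq expo) : (forall e, e \in s -> in_K e) ->
  \sum_(e <- s) mono e != 0 -> integral (\sum_(e <- s) mono e)^-1 ->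
  exists2 e, in_K e & \sum_(e <- s) mono e = mono e.
Proof.
move=> hs c0 /integral_jet[z [nu' hV]]; have [nu hc] := jet_mono_sum hs.
have h := jetM hc hV; rewrite divff // in h.
have [e _] := jet_inj p_gt0 h (jet1 R k l p).
have {}e : ((size s)%:Z * z)%:~R = 1%:~R :> rat by rewrite intrM.
have sz : size s = 1%N.
  have {e} := intr_inj e => e; have : (size s %| 1)%N; last by rewrite dvdn1 => /eqP.
  by have := congr1 absz e; rewrite abszM /= => <-; exact: dvdn_mulr.
case: s hs {c0 hV hc h e} sz => [//|e [|//]] hs _.
exists e; first by apply: hs; exact: mem_head.
exact: big_seq1.
Qed.

(** All coefficients of the expansion are positive, so no cancellation occurs
    in the corner coefficient, which is [c] times a monomial. *)
Lemma corner_expansion (T : seq (term k l)) (Phi P : Kz) c e0 : in_K e0 ->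
  expansion p T Phi -> Phi = c *: P -> corner_coef P = mono e0 ->
  c = \sum_(e <- [seq t.1 - e0 | t <- T & corner t.2]) mono e.
Proof.
move=> he0 [hT eT] ec er.
have e1 : corner_coef Phi = c * mono e0 by rewrite ec; apply: etrans (corner_coefZ _ _) _;
  rewrite er.
have e2 : corner_coef Phi = \sum_(t <- T) mono t.1 * (corner t.2)%:R.
  rewrite eT; apply: etrans (rmorph_sum corner_coef _ _ _) _; apply: eq_bigr => t _.
  by apply: etrans (corner_coefZ _ _) _; apply: congr1; exact: corner_coef_mon.
have -> : c = corner_coef Phi * (mono e0)^-1 by rewrite e1 mulfK // mono_neq0.
rewrite e2 mulr_suml big_map big_filter [RHS]big_mkcond big_seq [RHS]big_seq.
apply: eq_bigr => t /hT ht; case: (corner t.2).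
  by rewrite mulr1 (monoD R ht (in_KN he0)) (monoN R he0).
by rewrite mulr0 mul0r.
Qed.

(** The gradient is the left-hand side of the normalization condition. *)
Lemma jet_eval_theta_expansion (T : seq (term k l)) (Phi : Kz) : expansion p T Phi ->
  jet (eval_theta Phi) (\sum_(t <- T) theta_weight k l t.2)
    (\sum_(t <- T) theta_weight k l t.2 *: t.1).
Proof.
move=> [hT eT].
have -> : eval_theta Phi = \sum_(t <- T) qK R k l (theta_weight k l t.2) * mono t.1.
  rewrite eT; apply: etrans (rmorph_sum eval_theta _ _ _) _; apply: eq_bigr => t _.
  apply: etrans (eval_thetaZ _ _) _; rewrite eval_thetaX; exact: mulrC.
elim: T hT {eT} => [|t T IH] hT; first by rewrite !big_nil; exact: jet0.
rewrite !big_cons; apply: jetD.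
  by apply: jet_mono; apply: hT; exact: mem_head.
by apply: IH => u uT; apply: hT; rewrite in_cons uT orbT.
Qed.

(** By primitivity [c] is invertible, hence a monomial, say of exponent [e].
    The gradient of [eval_theta Phi], which is 0 by the normalization, is then
    [w *: e], where [w] is the value of [eval_theta P] at the point where all
    variables are 1. *)
Lemma normalized_unique (T : seq (term k l)) (Phi P : Kz) c e0 w :
  c != 0 -> Phi = c *: P ->
  in_K e0 -> corner_coef P = mono e0 ->
  0 < w -> jet (eval_theta P) w 0 ->
  (forall m, integral P@_m) ->
  primitive p Phi -> expansion p T Phi -> normalized T -> Phi = P.
Proof.
move=> c0 ec he0 er w0 hk hint prim hT norm.
have cE := corner_expansion he0 hT ec er.
set s := map _ _ in cE.
have hs e : e \in s -> in_K e.
  move=> /mapP[t]; rewrite mem_filter => /andP[_ tT] ->.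
  by apply: in_KB => //; exact: hT.1.
have ic : integral c.
  rewrite cE; exists [seq (1, e) | e <- s].
    by move=> t /mapP[e es ->]; exact: hs.
  by rewrite [RHS]big_map; apply: eq_bigr => e _; rewrite mul1r.
have icV := prim c P c0 ic hint ec.
have [e he ce] : exists2 e, in_K e & c = mono e.
  by rewrite cE; apply: (unit_mono_sum hs); rewrite -cE.
have h1 := jet_eval_theta_expansion hT; rewrite norm in h1.
have h2 : jet (eval_theta Phi) (1 * w) (w *: (1 *: e) + 1 *: 0).
  have -> : eval_theta Phi = c * eval_theta P by rewrite ec; exact: eval_thetaZ.
  have h := jet_mono R 1 he; rewrite rmorph1 mul1r -ce in h.
  exact: jetM h hk.
have [_ e1] := jet_inj p_gt0 h1 h2.
have e00 : e = 0.
  by apply: (scalerI (lt0r_neq0 w0)); rewrite scaler0 e1 scale1r scaler0 addr0.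
by rewrite ec ce e00 mono0 scale1r.
Qed.

End NormalizationConstant.

Theorem theorem3p3 (R : realType) (N : nat) (N_ge3 : (3 <= N)%N)
  (k l : 'Z_N -> nat)
  (k_gt0 : forall n, (0 < k n)%N) (l_gt0 : forall n, (0 < l n)%N)
  (p : nat) (p_suitable : suitable k l p)
  (kl_eq : forall n : 'Z_N,
     (k (n - 1)%R * k (n + 1)%R = l (n - 1)%R * l (n + 1)%R)%N)
  (tau : H2 k l -> L R k l) (tauP : tau_function p tau)
  (La : H2 k l) (La_in_M : in_M La)
  (Phi : {mpoly K R k l[#|zidx N|]})
  (PhiP : normalized_defining_polynomial p La Phi) :
  tau La * \prod_(x : eidx k l) tauX R x ^ mult La x = eval_zeta Phi.
Proof.
have [Phi0 hom pass prim [T hT norm]] := PhiP.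
have [ws [x eLa]] := La_in_M.
(* Two elements of the linear system of La: the given one and the one that is
   built along a word. *)
have [P hP] := constructed_word R N_ge3 k_gt0 l_gt0 p_suitable kl_eq ws x.
have [P0 hV [e0 he0 er] [w w0 hk] hint hev] := hP.
have hV' := linsys_def N_ge3 k_gt0 l_gt0 p_suitable Phi0 hom pass.
rewrite eLa in hV'.
have [c ec] := linsys_unique_word N_ge3 k_gt0 l_gt0 p_suitable kl_eq P0 Phi0 hV hV'.
have c0 : c != 0 by apply: contra_neq Phi0 => c0; rewrite ec c0 scale0r.
have eP : Phi = P.
  exact: (normalized_unique (p_gt0 p_suitable) c0 ec he0 er w0 hk hint prim hT norm).
rewrite eval_zetaE eP hev eLa.
have -> : tau (wact ws (clE k l (elab x).1 (elab x).2)) = wactL p ws (tauX R x).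
  have xM : in_M (clE k l (elab x).1 (elab x).2) by exists [::], x.
  by rewrite (tauP.2 ws _ xM) (tauP.1 x).
reflexivity.
Qed.
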